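(* For each $t\in[0,T]$, $x\in\mathbb R^{n_L}$ and $a\in\Gamma$, $$V^{\mathrm{UB}}\big(t,\|\sigma^{-1}(x-m(t))\|,a,\psi(a,r)\big)\ge V(t,x,a,r)\qquad\text{for all }r\in H(a).$$
   Context: Vector inequalities and $x^+=\max(x,0)$ are componentwise. **Production modes.** For each generator $k\in\mathcal N_G=\{1,\dots,n_G\}$ there is a finite set of production levels $\Theta_k=\{\theta_{k,1}<\dots<\theta_{k,n_k^\theta}\}\subset\mathbb R_+$ and a set $\Lambda_k\subset\Theta_k\times\Theta_k$ of allowed switches (one writes $l$ for $\theta_{k,l}$). Each $(l,m)\in\Lambda_k$ has a delay $\delta_{k,(l,m)}>0$, a switching cost $K_{k,(l,m)}\ge0$, and a monotone continuous ramp function $\theta^T_{k,(l,m)}$ on $[0,\delta_{k,(l,m)}]$ with $\theta^T_{k,(l,m)}(0)=\theta_{k,l}$, $\theta^T_{k,(l,m)}(\delta_{k,(l,m)})=\theta_{k,m}$; all ramp functions are Lipschitz with a common constant $C^{RR}$. Put $D_G=\prod_k[\theta_{k,1},\theta_{k,n_k^\theta}]$, $\Lambda=\bigcup_k\{k\}\times\Lambda_k$; for $\beta=(k,(l,m))\in\Lambda$ write $\beta^{\mathcal N}=k$, $\beta^f=l$, $\beta^t=m$, and $\delta_\beta,K_\beta$ for its delay and cost. Operation modes: $\Gamma=\prod_k(\Theta_k\cup\Lambda_k)$. For $a\in\Gamma$: $\Lambda(a)=\{(k,(l,m))\in\Lambda: a_k=l\}$, and $H(a)=\{r\in\mathbb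 R^{n_G}_+: r_k=0\text{ if }a_k\in\Theta_k,\ r_k\in[0,\delta_{k,a_k})\text{ if }a_k\in\Lambda_k\}$. The production $\zeta(a,r)\in D_G$ is $\zeta_k(a,r)=a_k$ (the level) if $a_k\in\Theta_k$ and $\zeta_k(a,r)=\theta^T_{k,a_k}(r_k)$ if $a_k\in\Lambda_k$. **Feasible sets.** $c\in\mathbb R^{n_L}$ has positive components. For $i=0,\dots,n_c$, $G_i\subset\mathbb R^{n_G}\times\mathbb R^{n_L}_+$ is a closed set (feasible operating points in network configuration $i$), with $G_i(p_G)=\{p_D\in\mathbb R_+^{n_L}:(p_G,p_D)\in G_i\}$, satisfying: (A) $G_i$ is convex and compact; (B) for all $p_G\in D_G$, $p_D\in\mathbb R^{n_L}_+$ there is $z\ge0$ with $(p_G,p_D-z)\in G_i$; (C) for all $p_G\in D_G$, $(\{p_G\}\times G_i(p_G))\cap\operatorname{int}G_i\ne\emptyset$; (D) if $(p_G,p_D)\in G_i$ and $0\le p_D'\le p_D$ then $(p_G,p_D')\in G_i$. $z_i^*(p_G,p_D)$ denotes a minimizer of $c^\top z$ over $z\in\mathbb R^{n_L}_+$ with $(p_G,p_D-z)\in G_i$. **Demand.** On a probability space carrying an $n_L$-dimensional Brownian motion $W$, $X_t=m(t)+Z_t$, $t\in[0,T]$, where $m:[0,T]\to\mathbb R^{n_L}_+$ is smooth with $\|m(t)-m(s)\|\le C^m|t-s|$, and $dZ_t=-\gamma Z_tdt+\sigma dW_t$, $Z_0=x_0-m(0)$, with scalar $\gamma\ge0$ and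 nonsingular $\sigma\in\mathbb R^{n_L\times n_L}$. $\mathcal F_t=\sigma(X_s:s\le t)$. $X^{t,x}$ is $X$ conditioned on $X_t=x$, i.e. $X^{t,x}_s=m(s)+Z_s$ with $Z$ solving the same SDE on $[t,T]$ from $Z_t=x-m(t)$. **Controls.** For $t\in[0,T]$, $a\in\Gamma$, $r\in H(a)$, $\mathcal V_{t,a,r}$ is the set of $v=(\tau_1,\dots,\tau_N;\beta_1,\dots,\beta_N)$ ($N$ finite, possibly random) with $\mathcal F$-stopping times $t\le\tau_1\le\dots\le\tau_N\le T$, $\beta_j$ $\mathcal F_{\tau_j}$-measurable with $\beta_j\in\Lambda(\alpha^{t,a,r}(\tau_j^-,v))$, and for each $k$ the times $\tau_1^k,\dots,\tau^k_{N_k}$ of the requests $\beta_{k,1},\dots,\beta_{k,N_k}$ with $\beta_j^{\mathcal N}=k$ strictly increasing. Here the mode $\alpha=\alpha^{t,a,r}(\cdot,v)$ and transition progression $\xi=\xi^{t,a,r}(\cdot,v)$ are: $\alpha(t^-)=a$, $\xi(t^-)=r$; with $\tau^k_{N_k+1}=\infty$, for $s\in[\tau_j^k,\tau_j^k+\delta_{\beta_{k,j}})$, $j\ge1$: $\alpha_k(s)=(\beta_{k,j}^f,\beta_{k,j}^t)$, $\xi_k(s)=s-\tau_j^k$; for $s\in[\tau_j^k+\delta_{\beta_{k,j}},\tau_{j+1}^k)$: $\alpha_k(s)=\beta_{k,j}^t$, $\xi_k(s)=0$; for $s\in[t,\tau_1^k)$: if $a_k\in\Theta_k$ then $\alpha_k(s)=a_k$,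 $\xi_k(s)=0$; if $a_k=(l,m)\in\Lambda_k$ then $\alpha_k(s)=(l,m)$, $\xi_k(s)=s-t+r_k$ while $s-t+r_k<\delta_{k,a_k}$, and $\alpha_k(s)=m$, $\xi_k(s)=0$ afterwards. **Costs.** $C_G:D_G\to\mathbb R$ is continuous, $q_i\ge0$, and $f(x,a,r)=C_G(\zeta(a,r))+\sum_{i=0}^{n_c}q_i\,c^\top z_i^*(\zeta(a,r),x^+)$. For $v\in\mathcal V_{t,a,r}$, $J(t,x,a,r;v)=\mathbb E\big[\int_t^Tf(X_s^{t,x},\alpha^{t,a,r}(s,v),\xi^{t,a,r}(s,v))ds+\sum_{\tau_i\le T}K_{\beta_i}\big]$, and $V(t,x,a,r)=\inf_{v\in\mathcal V_{t,a,r}}J(t,x,a,r;v)$. **Upper-bound running cost.** For $t\in[0,T]$, $p_G\in D_G$ let $\tilde d_i(t,p_G)=\min\{\|\sigma^{-1}(p_D-m(t))\|: p_D\in\mathbb R^{n_L},\ (p_G,p_D)\in\partial G_i\}$, and $d_i(t,p_G)=\tilde d_i(t,p_G)$ if $m(t)\in G_i(p_G)$, $d_i(t,p_G)=-\tilde d_i(t,p_G)$ otherwise. For $y\ge0$: $C_i^B(t,p_G,y)=\max(0,y-d_i(t,p_G))\max_{\|\xi\|=1}c^\top(\sigma\xi)^+$ and $f_1^B(t,p_G,y)=C_G(p_G)+\sum_{i=0}^{n_c}q_iC_i^B(t,p_G,y)$. With $\delta_{k,a_k}:=0$ if $a_k\in\Theta_k$, let $\psi(a,r)=\max_{k\in\mathcal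 N_G}(\delta_{k,a_k}-r_k)$ for $r\in H(a)$ (the time until all ongoing transitions are completed). For $w\in\psi(a,H(a))$ let $D_G(a,w)$ be the closure of $\{\zeta(a,r): r\in H(a),\ \psi(a,r)=w\}$ and $f_2^B(t,y,a,w)=\max_{p_G\in D_G(a,w)}f_1^B(t,p_G,y)$. **Upper-bound problem.** $X^B_t=\|\sigma^{-1}Z_t\|$ is a Markov process; $\mathcal F^B$ is the filtration it generates; $X^{B,t,y}$ is $X^B$ conditioned on $X^B_t=y\geq 0$ (equivalently in law, $(X^{B,t,y})^2$ solves $dR_s=(n_L-2\gamma R_s)ds+2\sqrt{R_s}\,dW^1_s$, $R_t=y^2$, $W^1$ a one-dimensional Brownian motion). For $a\in\Gamma$, $w\in\psi(a,H(a))$, $\mathcal V^B_{t,a,w}$ is the set of $v=(\tau_1,\dots,\tau_N;\beta_1,\dots,\beta_N)$ with $\mathcal F^B$-stopping times $\tau_1\le\dots\le\tau_N\le T$, $\tau_1\ge t+w$, $\beta_j$ $\mathcal F^B_{\tau_j}$-measurable, $\beta_j\in\Lambda(\alpha^{B,t,a,w}(\tau_j^-,v))$, request times for the same generator strictly increasing, and for each $j<N$ either $\tau_j=\tau_{j+1}$ or $\tau_j+\max_{i:\tau_i=\tau_j}\delta_{\beta_i}\le\tau_{j+1}$. The mode $\alpha^{B,t,a,w}(\cdot,v)$ starts from $a$ (also at $t^-$): component $k$ equals $a_k$ on $[t,t+w)$; from $t+w$ until generator $k$'s first request it equals $a_k^t$, where $a_k^t=a_k$ if $a_k\in\Theta_k$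 and $a_k^t=m$ if $a_k=(l,m)$; after a request $\beta_j$ with $\beta_j^{\mathcal N}=k$ at time $\tau_j$ it equals $(\beta_j^f,\beta_j^t)$ on $[\tau_j,\tau_j+\max_{j':\tau_{j'}=\tau_j}\delta_{\beta_{j'}})$ and then $\beta_j^t$ until generator $k$'s next request. The remaining transition time is $\varrho^{t,a,w}(s,v)=(w-(s-t))^++\sum_{j=1}^N1_{[\tau_j,\tau_{j+1})}(s)\big(\max_{j':\tau_{j'}=\tau_j}\delta_{\beta_{j'}}-(s-\tau_j)\big)^+$, with $\tau_{N+1}=\infty$. Finally $J^B(t,y,a,w;v)=\mathbb E\big[\int_t^Tf_2^B(s,X^{B,t,y}_s,\alpha^{B,t,a,w}(s,v),\varrho^{t,a,w}(s,v))ds+\sum_{t\le\tau_i\le T}K_{\beta_i}\big]$ and $V^{\mathrm{UB}}(t,y,a,w)=\inf_{v\in\mathcal V^B_{t,a,w}}J^B(t,y,a,w;v)$. *)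

(* Defs.v *)
From HB Require Import structures.
From mathcomp Require Import all_boot all_order all_algebra.
From mathcomp Require Import all_classical all_reals all_analysis.
Set Implicit Arguments.
Unset Strict Implicit.
Unset Printing Implicit Defensive.
Import Order.TTheory GRing.Theory Num.Theory.
Import numFieldNormedType.Exports.
Local Open Scope classical_set_scope.
Local Open Scope ring_scope.

(* The library norm on matrices is the sup norm; the Euclidean one is needed. *)
Definition enorm (R : realType) n (v : 'cV[R]_n) : R :=
  Num.sqrt (\sum_i v i 0 ^+ 2).

Definition dotp (R : realType) n (u v : 'cV[R]_n) : R := \sum_i u i 0 * v i 0.

Definition vpos (R : realType) n (v : 'cV[R]_n) : 'cV[R]_n :=
  \col_i Num.max (v i 0) 0.

Definition vge0 (R : realType) n (v : 'cV[R]_n) : Prop :=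
  forall i, 0 <= v i 0.

Definition vle (R : realType) n (u v : 'cV[R]_n) : Prop :=
  forall i, u i 0 <= v i 0.

Definition boundary (X : topologicalType) (A : set X) : set X :=
  closure A `\` A°.

(* Component of an operation mode: a production level, or an ongoing switch
   between two levels. Levels of generator k are referred to by their index
   (counted from 0) in theta_{k,0} < ... < theta_{k,nlev k - 1}. *)
Inductive cmode := Lvl of nat | Sw of nat & nat.

Definition mode nG := 'I_nG -> cmode.

(* A request (k, (l, m)): generator k is asked to switch from l to m. *)
Definition request nG := ('I_nG * (nat * nat))%type.

Record market (R : realType) (nG nL nc : nat) := Market {
  nlev : 'I_nG -> nat;
  theta : 'I_nG -> nat -> R;
  Lam : 'I_nG -> {pred nat * nat};
  delay : 'I_nG -> nat * nat -> R;
  swcost : 'I_nG -> nat * nat -> R;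
  ramp : 'I_nG -> nat * nat -> R -> R;
  CRR : R;
  cvec : 'cV[R]_nL;
  G : 'I_nc.+1 -> set ('cV[R]_nG * 'cV[R]_nL);
  zstar : 'I_nc.+1 -> 'cV[R]_nG -> 'cV[R]_nL -> 'cV[R]_nL;
  q : 'I_nc.+1 -> R;
  CG : 'cV[R]_nG -> R;
  T : R;
  m : R -> 'cV[R]_nL;
  Cm : R;
  gamma : R;
  sigma : 'M[R]_nL;
  x0 : 'cV[R]_nL }.

Definition DG (R : realType) nG nL nc (M : market R nG nL nc) :
    set 'cV[R]_nG :=
  [set p | forall k, theta M k 0 <= p k 0 <= theta M k (nlev M k).-1].

Definition is_mode (R : realType) nG nL nc (M : market R nG nL nc)
    (a : mode nG) : Prop :=
  forall k, match a k with
            | Lvl l => (l < nlev M k)%N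
            | Sw l l' => (l, l') \in Lam M k
            end.

Definition allowed (R : realType) nG nL nc (M : market R nG nL nc)
    (a : mode nG) (b : request nG) : Prop :=
  b.2 \in Lam M b.1 /\ a b.1 = Lvl b.2.1.

Definition H (R : realType) nG nL nc (M : market R nG nL nc) (a : mode nG) :
    set 'cV[R]_nG :=
  [set r | forall k, match a k with
                     | Lvl _ => r k 0 = 0
                     | Sw l l' => 0 <= r k 0 < delay M k (l, l')
                     end].

Definition zeta (R : realType) nG nL nc (M : market R nG nL nc)
    (a : mode nG) (r : 'cV[R]_nG) : 'cV[R]_nG :=
  \col_k match a k with
         | Lvl l => theta M k l
         | Sw l l' => ramp M k (l, l') (r k 0)
         end.

Definition mode_delay (R : realType) nG nL nc (M : market R nG nL nc)
    (a : mode nG) (k : 'I_nG) : R :=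
  if a k is Sw l l' then delay M k (l, l') else 0.

(* On H(a) all the terms are nonnegative: the initial value 0 is harmless. *)
Definition psi (R : realType) nG nL nc (M : market R nG nL nc)
    (a : mode nG) (r : 'cV[R]_nG) : R :=
  \big[Num.max/0]_(k < nG) (mode_delay M a k - r k 0).

(* Smoothness of m on the closed interval [0, T] is understood as agreement
   on [0, T] with a C^infinity function on the line. *)
Definition smooth_on (R : realType) n (T : R) (f : R -> 'cV[R]_n) : Prop :=
  exists2 g : R -> 'cV[R]_n,
    (forall i j s, derivable (derive1n j (fun u => g u i 0)) s 1) &
    {in `[0, T], f =1 g}.

Definition modes_ok (R : realType) nG nL nc (M : market R nG nL nc) : Prop :=
  (forall k, (0 < nlev M k)%N) /\
  (forall k l, (l < nlev M k)%N -> 0 <= theta M k l) /\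
  (forall k l l', (l < l')%N -> (l' < nlev M k)%N ->
     theta M k l < theta M k l') /\
  (forall k l l', (l, l') \in Lam M k -> (l < nlev M k)%N /\ (l' < nlev M k)%N) /\
  (forall k l l', (l, l') \in Lam M k ->
     let D := delay M k (l, l') in
     let th := ramp M k (l, l') in
     [/\ 0 < D, 0 <= swcost M k (l, l'),
         {in `[0, D] &, {homo th : u v / u <= v}} \/
         {in `[0, D] &, {homo th : u v /~ u <= v}},
         {within `[0, D], continuous th} &
         [/\ th 0 = theta M k l, th D = theta M k l' &
         {in `[0, D] &, forall u v, `|th u - th v| <= CRR M * `|u - v| }]]).

Definition feasible_ok (R : realType) nG nL nc (M : market R nG nL nc)
    (Gi : set ('cV[R]_nG * 'cV[R]_nL)) : Prop :=
  [/\ (forall pG pD, Gi (pG, pD) -> vge0 pD) /\ closed Gi,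
      convex_set (Gi : set (convex_lmodType ('cV[R]_nG * 'cV[R]_nL)%type)) /\
        compact Gi,
      forall pG pD, DG M pG -> vge0 pD ->
        exists2 z, vge0 z & Gi (pG, pD - z),
      forall pG, DG M pG -> exists2 pD, Gi (pG, pD) & Gi° (pG, pD) &
      forall pG pD pD', Gi (pG, pD) -> vge0 pD' -> vle pD' pD ->
        Gi (pG, pD')].

Definition is_zstar (R : realType) nG nL nc (M : market R nG nL nc) i pG pD
    (z : 'cV[R]_nL) : Prop :=
  [/\ vge0 z, G M i (pG, pD - z) &
      forall z', vge0 z' -> G M i (pG, pD - z') ->
        dotp (cvec M) z <= dotp (cvec M) z'].

Definition market_ok (R : realType) nG nL nc (M : market R nG nL nc) : Prop :=
  [/\ (0 < nG)%N /\ (0 < nL)%N,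
      modes_ok M,
      [/\ forall i, 0 < cvec M i 0,
          forall i, feasible_ok M (G M i) &
          forall i pG pD, DG M pG -> vge0 pD ->
            is_zstar M i pG pD (zstar M i pG pD)],
      {within DG M, continuous (CG M)} /\ (forall i, 0 <= q M i) &
      [/\ smooth_on (T M) (m M),
          {in `[0, T M], forall s, vge0 (m M s)},
          {in `[0, T M] &, forall s u,
             enorm (m M s - m M u) <= Cm M * `|s - u| },
          0 <= gamma M &
          sigma M \in unitmx]].

(* Gaussian increments are independent over disjoint time intervals and over
   coordinates; normal_prob takes a standard deviation. *)
Definition brownian (R : realType) nL d (Om : measurableType d)
    (P : probability Om R) (W : R -> Om -> 'cV[R]_nL) : Prop :=
  [/\ forall s i, 0 <= s ->
        measurable_fun [set: Om] (fun w => W s w i 0),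
      forall w, W 0 w = 0,
      forall w i, {within `[0, +oo[, continuous (fun s => W s w i 0)} &
      forall (n : nat) (s : nat -> R) (A : nat -> 'I_nL -> set R),
        0 <= s 0 -> (forall j, (j < n)%N -> s j < s j.+1) ->
        (forall j i, measurable (A j i)) ->
        P [set w | forall j i, (j < n)%N ->
                     A j i (W (s j.+1) w i 0 - W (s j) w i 0)] =
        (\prod_(j < n) \prod_(i < nL)
           normal_prob 0 (Num.sqrt (s j.+1 - s j)) (A j i))%E].

(* dZ = - gamma Z ds + sigma dW on [t, T], Z_t = z. The noise being additive,
   the equation is a pathwise integral equation. *)
Definition OU_solution (R : realType) nG nL nc (M : market R nG nL nc)
    (Om : Type) (W : R -> Om -> 'cV[R]_nL) (t : R) (z : 'cV[R]_nL)
    (Z : R -> Om -> 'cV[R]_nL) : Prop :=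
  forall w,
    (forall i, {within `[t, T M], continuous (fun s => Z s w i 0)}) /\
    {in `[t, T M], forall s,
      Z s w = z
        - gamma M *: (\col_i \int[lebesgue_measure]_(u in `[t, s]) Z u w i 0)
        + sigma M *m (W s w - W t w)}.

(* Generators of sigma(Y_i(u) : i, 0 <= u <= s). *)
Definition past_events (R : realType) (I Om : Type) (Y : I -> R -> Om -> R)
    (s : R) : set (set Om) :=
  [set A | exists i u (B : set R),
     [/\ 0 <= u <= s, measurable B & A = Y i u @^-1` B]].

Definition filtration_of (R : realType) (I Om : Type) (Y : I -> R -> Om -> R)
    (s : R) : set (set Om) := <<s past_events Y s >>.

(* A realized control is the finite list of its (tau_j, beta_j). *)
Definition rcontrol (R : realType) nG := seq (R * request nG).

Definition times (R : realType) nG (v : rcontrol R nG) : seq R :=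
  [seq e.1 | e <- v].

Definition req_of (R : realType) nG (k : 'I_nG) (v : rcontrol R nG) :
    rcontrol R nG :=
  [seq e <- v | e.2.1 == k].

Definition last_req (R : realType) nG (k : 'I_nG) (v : rcontrol R nG)
    (s : R) : option (R * request nG) :=
  ohead (rev [seq e <- req_of k v | e.1 <= s]).

(* tau_j is a stopping time (infinite when there are fewer than j requests)
   and beta_j, which is discrete, is measurable at tau_j. *)
Definition adapted (R : realType) nG (T : R) (Om : Type)
    (F : R -> set (set Om)) (v : Om -> rcontrol R nG) : Prop :=
  forall (j : nat) (s : R), s \in `[0, T] ->
    F s [set w | exists2 e, onth (v w) j = Some e & e.1 <= s] /\
    forall b : request nG,
      F s [set w | exists2 e, onth (v w) j = Some e & e.1 <= s /\ e.2 = b].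

(* Conditions on one realization, given the mode process al: ordering of the
   times, and beta_j in Lambda(al(tau_j^-)). *)
Definition realization_ok (R : realType) nG nL nc (M : market R nG nL nc)
    (t : R) (al : R -> mode nG) (v : rcontrol R nG) : Prop :=
  [/\ sorted <=%R (times v),
      forall e, e \in v -> t <= e.1 <= T M,
      forall k, sorted <%R (times (req_of k v)) &
      forall e, e \in v -> exists a' : mode nG,
        (\forall u \near e.1^'-, al u = a') /\ allowed M a' e.2].

Definition switching_costs (R : realType) nG nL nc (M : market R nG nL nc)
    (v : rcontrol R nG) : \bar R :=
  (\sum_(e <- v | (e.1 <= T M)%R) (swcost M e.2.1 e.2.2)%:E)%E.

(* For s < t the values are the initial ones, which gives the values at t^-. *)
Definition alpha (R : realType) nG nL nc (M : market R nG nL nc)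
    (t : R) (a : mode nG) (r : 'cV[R]_nG) (v : rcontrol R nG) (s : R) :
    mode nG :=
  fun k =>
  if last_req k v s is Some (tau, (_, (l, l'))) then
    if s < tau + delay M k (l, l') then Sw l l' else Lvl l'
  else if s < t then a k
  else match a k with
       | Lvl l => Lvl l
       | Sw l l' =>
         if s - t + r k 0 < delay M k (l, l') then Sw l l' else Lvl l'
       end.

Definition xi (R : realType) nG nL nc (M : market R nG nL nc)
    (t : R) (a : mode nG) (r : 'cV[R]_nG) (v : rcontrol R nG) (s : R) :
    'cV[R]_nG :=
  \col_k
  if last_req k v s is Some (tau, (_, (l, l'))) then
    if s < tau + delay M k (l, l') then s - tau else 0
  else if s < t then r k 0
  else match a k with
       | Lvl l => 0
       | Sw l l' =>
         if s - t + r k 0 < delay M k (l, l') then s - t + r k 0 else 0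
       end.

Definition running_cost (R : realType) nG nL nc (M : market R nG nL nc)
    (x : 'cV[R]_nL) (a : mode nG) (r : 'cV[R]_nG) : R :=
  CG M (zeta M a r) +
  \sum_(i < nc.+1) q M i * dotp (cvec M) (zstar M i (zeta M a r) (vpos x)).

(* Below, Z t z is the solution started from z at time t. *)
Definition Xfrom (R : realType) nG nL nc (M : market R nG nL nc) (Om : Type)
    (Z : R -> 'cV[R]_nL -> R -> Om -> 'cV[R]_nL) (t : R) (x : 'cV[R]_nL)
    (s : R) (w : Om) : 'cV[R]_nL :=
  m M s + Z t (x - m M t) s w.

Definition FX (R : realType) nG nL nc (M : market R nG nL nc) (Om : Type)
    (Z : R -> 'cV[R]_nL -> R -> Om -> 'cV[R]_nL) : R -> set (set Om) :=
  filtration_of (fun (i : 'I_nL) s w => Xfrom M Z 0 (x0 M) s w i 0).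

Definition controls (R : realType) nG nL nc (M : market R nG nL nc)
    (Om : Type) (Z : R -> 'cV[R]_nL -> R -> Om -> 'cV[R]_nL)
    (t : R) (a : mode nG) (r : 'cV[R]_nG) : set (Om -> rcontrol R nG) :=
  [set v | adapted (T M) (FX M Z) v /\
           forall w, realization_ok M t (alpha M t a r (v w)) (v w)].

Definition J (R : realType) nG nL nc (M : market R nG nL nc)
    d (Om : measurableType d) (P : probability Om R)
    (Z : R -> 'cV[R]_nL -> R -> Om -> 'cV[R]_nL)
    (t : R) (x : 'cV[R]_nL) (a : mode nG) (r : 'cV[R]_nG)
    (v : Om -> rcontrol R nG) : \bar R :=
  (\int[P]_w
     (\int[lebesgue_measure]_(s in `[t, T M])
        (running_cost M (Xfrom M Z t x s w)
           (alpha M t a r (v w) s) (xi M t a r (v w) s))%:E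
      + switching_costs M (v w)))%E.

Definition V (R : realType) nG nL nc (M : market R nG nL nc)
    d (Om : measurableType d) (P : probability Om R)
    (Z : R -> 'cV[R]_nL -> R -> Om -> 'cV[R]_nL)
    (t : R) (x : 'cV[R]_nL) (a : mode nG) (r : 'cV[R]_nG) : \bar R :=
  ereal_inf [set J M P Z t x a r v | v in controls M Z t a r].

(* The minima and maxima below are over compact sets and are written with
   inf and sup. *)
Definition dtilde (R : realType) nG nL nc (M : market R nG nL nc)
    i (t : R) (pG : 'cV[R]_nG) : R :=
  inf [set enorm (invmx (sigma M) *m (pD - m M t)) |
        pD in [set pD | boundary (G M i) (pG, pD)]].

Definition dsigned (R : realType) nG nL nc (M : market R nG nL nc)
    i (t : R) (pG : 'cV[R]_nG) : R :=
  if `[< G M i (pG, m M t) >] then dtilde M i t pG else - dtilde M i t pG.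

Definition CB (R : realType) nG nL nc (M : market R nG nL nc)
    i (t : R) (pG : 'cV[R]_nG) (y : R) : R :=
  Num.max 0 (y - dsigned M i t pG) *
  sup [set dotp (cvec M) (vpos (sigma M *m e)) |
        e in [set e : 'cV[R]_nL | enorm e = 1]].

Definition f1B (R : realType) nG nL nc (M : market R nG nL nc)
    (t : R) (pG : 'cV[R]_nG) (y : R) : R :=
  CG M pG + \sum_(i < nc.+1) q M i * CB M i t pG y.

Definition DGaw (R : realType) nG nL nc (M : market R nG nL nc)
    (a : mode nG) (w : R) : set 'cV[R]_nG :=
  closure [set zeta M a r | r in [set r | H M a r /\ psi M a r = w]].

Definition f2B (R : realType) nG nL nc (M : market R nG nL nc)
    (t y : R) (a : mode nG) (w : R) : R :=
  sup [set f1B M t pG y | pG in DGaw M a w].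

(* X^B is realized as the coordinate process on the space of nonnegative
   continuous paths, so that the filtration it generates, its stopping times
   and the controls make sense under each of its conditional laws. *)
Record radial_path (R : realType) (T : R) := RadialPath {
  path_fun :> R -> R;
  path_cont : {within `[0, T], continuous path_fun};
  path_ge0 : {in `[0, T], forall s, 0 <= path_fun s} }.

Lemma cst0_cont (R : realType) (T : R) :
  {within `[0, T], continuous (fun _ : R => 0 : R)}.
Proof. by apply: continuous_subspaceT => x; exact: cvg_cst. Qed.

Lemma cst0_ge0 (R : realType) (T : R) :
  {in `[0, T], forall s : R, 0 <= (fun _ : R => 0 : R) s}.
Proof. by move=> s _ /=. Qed.

HB.instance Definition _ (R : realType) (T : R) := gen_eqMixin (radial_path T).
HB.instance Definition _ (R : realType) (T : R) := gen_choiceMixin (radial_path T).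
HB.instance Definition _ (R : realType) (T : R) :=
  isPointed.Build (radial_path T) (RadialPath (@cst0_cont R T) (@cst0_ge0 R T)).

Definition XB (R : realType) (T : R) (_ : unit) (s : R) (p : radial_path T) : R :=
  p s.

Definition FB (R : realType) (T : R) : R -> set (set (radial_path T)) :=
  filtration_of (@XB R T).

Notation path_space T := (g_sigma_algebraType (past_events (@XB _ T) T)).

(* Q is a law of X^B = |sigma^-1 Z| conditioned on X^B_t = y: from time t on,
   X^B has the law of |sigma^-1 Z| with Z started from a point z such that
   |sigma^-1 z| = y, and this future is independent of the past. In
   particular X^B_t = y almost surely. By rotation invariance of the Gaussian
   process sigma^-1 Z_s - e^{-gamma(s-t)} sigma^-1 z, the law of the future
   does not depend on the choice of z. The conditional law of the past is left unspecified. *)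
Definition conditional_law (R : realType) nG nL nc (M : market R nG nL nc)
    d (Om : measurableType d) (P : probability Om R)
    (Z : R -> 'cV[R]_nL -> R -> Om -> 'cV[R]_nL)
    (t y : R) (Q : probability (path_space (T M)) R) : Prop :=
  exists2 z : 'cV[R]_nL, enorm (invmx (sigma M) *m z) = y &
  forall (n n' : nat) (u s : nat -> R) (A B : nat -> set R),
    (forall j, 0 <= u j <= t) -> (forall j, t <= s j <= T M) ->
    (forall j, measurable (A j)) -> (forall j, measurable (B j)) ->
    let past :=
      [set p : path_space (T M) | forall j, (j < n)%N -> A j (XB tt (u j) p)] in
    let future :=
      [set p : path_space (T M) | forall j, (j < n')%N -> B j (XB tt (s j) p)] in
    (Q (past `&` future) =
     Q past *
     P [set w | forall j, (j < n')%N ->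
          B j (enorm (invmx (sigma M) *m Z t z (s j) w))])%E.

Arguments conditional_law {R nG nL nc} M {d Om} P Z t y Q.

Definition req_delay (R : realType) nG nL nc (M : market R nG nL nc)
    (b : request nG) : R := delay M b.1 b.2.

Definition batch_delay (R : realType) nG nL nc (M : market R nG nL nc)
    (v : rcontrol R nG) (tau : R) : R :=
  \big[Num.max/0]_(e <- v | e.1 == tau) req_delay M e.2.

Definition arrival (c : cmode) : cmode :=
  if c is Sw _ l' then Lvl l' else c.

Definition alphaB (R : realType) nG nL nc (M : market R nG nL nc)
    (t : R) (a : mode nG) (w : R) (v : rcontrol R nG) (s : R) : mode nG :=
  fun k =>
  if last_req k v s is Some (tau, (_, (l, l'))) then
    if s < tau + batch_delay M v tau then Sw l l' else Lvl l'
  else if s < t + w then a k else arrival (a k).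

Definition rho (R : realType) nG nL nc (M : market R nG nL nc)
    (t w : R) (v : rcontrol R nG) (s : R) : R :=
  let tau := nth 0 (times v) in
  Num.max (w - (s - t)) 0 +
  \sum_(j < size v | (tau j <= s) && ((j.+1 == size v) || (s < tau j.+1)))
    Num.max (batch_delay M v (tau j) - (s - tau j)) 0.

Definition controlsB (R : realType) nG nL nc (M : market R nG nL nc)
    (t : R) (a : mode nG) (w : R) : set (path_space (T M) -> rcontrol R nG) :=
  [set v | adapted (T M) (@FB R (T M)) v /\
     forall p,
       let tau := nth 0 (times (v p)) in
       [/\ realization_ok M t (alphaB M t a w (v p)) (v p),
           forall e, e \in v p -> t + w <= e.1 &
           forall j, (j.+1 < size (v p))%N ->
             tau j = tau j.+1 \/
             tau j + batch_delay M (v p) (tau j) <= tau j.+1]].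

Arguments controlsB {R nG nL nc} M t a w _.

Definition JB (R : realType) nG nL nc (M : market R nG nL nc)
    (Q : R -> R -> probability (path_space (T M)) R)
    (t y : R) (a : mode nG) (w : R)
    (v : path_space (T M) -> rcontrol R nG) : \bar R :=
  (\int[Q t y]_p
     (\int[lebesgue_measure]_(s in `[t, T M])
        (f2B M s (XB tt s p) (alphaB M t a w (v p) s) (rho M t w (v p) s))%:E
      + switching_costs M (v p)))%E.

Arguments JB {R nG nL nc} M Q t y a w v.

Definition VUB (R : realType) nG nL nc (M : market R nG nL nc)
    (Q : R -> R -> probability (path_space (T M)) R)
    (t y : R) (a : mode nG) (w : R) : \bar R :=
  ereal_inf [set JB M Q t y a w v | v in controlsB M t a w].

Arguments VUB {R nG nL nc} M Q t y a w.

(* Main.v *)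
(** Let [v] be a control of the upper-bound problem and [y] the radius
    [|sigma^-1 (x - m t)|]. Replace the future of a path drawn from [Q t y] by
    the radius [|sigma^-1 Z_s|], [s >= t], of the solution started from
    [x - m t]. Brownian motion being invariant under rotations, the law of this
    radius depends on the starting point only through [y], so the spliced path
    again has law [Q t y]. By Tonelli's theorem there is a past for which the
    expected cost of the spliced path is at most [JB v].

    With that past fixed, the spliced path is adapted to the filtration of [X],
    because all solutions are driven by the same noise, and [v] evaluated along
    it is a control of the original problem: generators in a batch are busy for
    longer in the upper-bound problem. Pointwise, the original production lies in
    [DGaw] of the upper-bound mode and remaining time, and the running cost is
    at most [f1B] there: moving the demand from [m s] towards [X_s], one stays
    in [G_i] up to the signed distance [d_i], and shedding the rest is feasible
    by (D). The cost in [JB] is a measurable function of the path because [f2B]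
    is upper semicontinuous in time, radius and remaining time. *)
Require Import Defs.
From HB Require Import structures.
From mathcomp Require Import all_boot all_order all_algebra.
From mathcomp Require Import all_classical all_reals all_analysis.
From mathcomp Require Import measurable_realfun ring lra.
Import Order.TTheory GRing.Theory Num.Theory.
Import numFieldNormedType.Exports.
Local Open Scope classical_set_scope.
Local Open Scope ring_scope.
Set Implicit Arguments.
Unset Strict Implicit.
Unset Printing Implicit Defensive.

(** * Rotation invariance of Brownian motion *)

(** A control of the original problem is adapted to X started from [x0 M] at time 0, while its cost
    is that of the solution restarted from x at t; moreover [v] may read the path before t, where
    its law is left open. Freezing the past removes the second difficulty. For the first, two
    solutions differ after t by a deterministic factor times their difference at t, so the restarted
    one is a function of X up to the current time.

    Only plane rotations and one reflection are used for the law of the radius: rotations annihilate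
    the coordinates of the starting point one by one, and the reflection fixes the sign of the last.
    A plane rotation preserves the Gaussian law because the density is radial and Lebesgue measure
    is invariant under shears.

    Tonelli's theorem is applied to the cost in [JB], which is therefore shown to be measurable and
    bounded below; the integrand of [J] is only compared with it pointwise. Lists of requests, and
    the positions of a time among the request times, are countable in number, which reduces
    measurability to a fixed mode. *)

Section gaussian_plane.
Context {R : realType}.
Notation mu := (@lebesgue_measure R).

Lemma ge0_integral_lebesgue_shift (h : R -> \bar R) (a : R) :
  measurable_fun setT h -> (forall x, 0 <= h x)%E ->
  (\int[mu]_x h (x + a)%R = \int[mu]_x h x)%E.
Proof.
move=> mh h0.
have mf : measurable_fun setT (fun x : measurableTypeR R => x + a : measurableTypeR R).
  exact: measurable_funD.
rewrite -(@ge0_integral_pushforward _ _ _ _ R _ mf mu setT h)//.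
apply: eq_measure_integral => A mA _; apply/esym; apply: lebesgue_measure_unique => // _ [[b c] _ <-] /=.
rewrite /pushforward.
have -> : (fun x => x + a) @^-1` `]b, c] = `]b - a, c - a]%classic.
  by apply/seteqP; split => x /=; rewrite !in_itv/= ltrBlDr lerBrDr.
rewrite !lebesgue_measure_itv/= !lte_fin ltrD2r.
by case: ifP => //; rewrite -!EFinB => _; congr EFin; ring.
Qed.

Lemma ge0_integral_lebesgue_opp (h : R -> \bar R) :
  measurable_fun setT h -> (forall x, 0 <= h x)%E ->
  (\int[mu]_x h (- x)%R = \int[mu]_x h x)%E.
Proof.
move=> mh h0.
have mf : measurable_fun setT (fun x : measurableTypeR R => - x : measurableTypeR R).
  exact: measurable_funN.
rewrite -(@ge0_integral_pushforward _ _ _ _ R _ mf mu setT h)//.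
apply: eq_measure_integral => A mA _; apply/esym; apply: lebesgue_measure_unique => // _ [[b c] _ <-] /=.
rewrite /pushforward.
have -> : (fun x => - x) @^-1` `]b, c] = `[- c, - b[%classic.
  by apply/seteqP; split => x /=; rewrite !in_itv/= andbC ltrNr lerNl.
rewrite !lebesgue_measure_itv/= !lte_fin ltrN2.
by case: ifP => //; rewrite -!EFinB => _; congr EFin; ring.
Qed.


Lemma normal_pdf_iso (s x y x' y' : R) : s != 0 -> x ^+ 2 + y ^+ 2 = x' ^+ 2 + y' ^+ 2 ->
  normal_pdf 0 s x * normal_pdf 0 s y = normal_pdf 0 s x' * normal_pdf 0 s y'.
Proof.
move=> s0 e; rewrite !/normal_pdf (negbTE s0) /normal_fun !subr0.
rewrite mulrACA [RHS]mulrACA -!expRD; congr (_ * expR _).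
by rewrite -!mulrDl -!opprD e.
Qed.

Lemma normal_probN (s : R) (A : set R) : s != 0 -> measurable A ->
  normal_prob 0 s ((fun x => - x) @^-1` A) = normal_prob 0 s A.
Proof.
move=> s0 mA; rewrite /normal_prob integral_mkcond [RHS]integral_mkcond.
rewrite -[RHS]ge0_integral_lebesgue_opp.
- apply: eq_integral => x _; rewrite /patch.
  have -> : (x \in (fun x => - x) @^-1` A) = (- x \in A) by apply/idP/idP; rewrite !inE.
  case: ifP => // _; congr EFin.
  by rewrite !/normal_pdf (negbTE s0) /normal_fun !subr0 sqrrN.
- apply/(measurable_restrictT _ _).1 => //; apply/measurable_EFinP; apply: measurable_funTS; exact: measurable_normal_pdf.
- by move=> x; rewrite /patch; case: ifP => // _; rewrite lee_fin normal_pdf_ge0.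
Qed.

(** With y fixed a shear is a translation of x; Tonelli's theorem puts the integral over x
    inside. *)
Lemma plane_shear (h : R * R -> \bar R) (a : R) :
  measurable_fun setT h -> (forall x, 0 <= h x)%E ->
  (\int[mu]_x \int[mu]_y h (x + a * y, y)%R = \int[mu]_x \int[mu]_y h (x, y))%E.
Proof.
move=> mh h0.
have mh' : measurable_fun setT (fun z : R * R => h (z.1 + a * z.2, z.2)).
  apply: measurableT_comp => //; apply: measurable_fun_pair => //.
  by apply: measurable_funD => //; apply: measurable_funM => //.
have h'0 (z : R * R) : (0 <= h (z.1 + a * z.2, z.2)%R)%E by exact: h0.
etransitivity; first exact: (@fubini_tonelli _ _ _ _ R mu mu _ mh' h'0).
etransitivity; last exact: (esym (@fubini_tonelli _ _ _ _ R mu mu h mh h0)).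
apply: eq_integral => y _.
rewrite (@ge0_integral_lebesgue_shift (fun x => h (x, y)) (a * y))//.
by apply: measurableT_comp => //; exact: measurable_pair1.
Qed.

Lemma plane_shear' (h : R * R -> \bar R) (a : R) :
  measurable_fun setT h -> (forall x, 0 <= h x)%E ->
  (\int[mu]_x \int[mu]_y h (x, y + a * x)%R = \int[mu]_x \int[mu]_y h (x, y))%E.
Proof.
move=> mh h0.
apply: eq_integral => x _.
rewrite (@ge0_integral_lebesgue_shift (fun y => h (x, y)) (a * x))//.
by apply: measurableT_comp => //; exact: measurable_pair2.
Qed.

(* A rotation with [s != 0] is a product of three shears. *)
Lemma plane_rotation (h : R * R -> \bar R) (c s : R) :
  s != 0 -> c ^+ 2 + s ^+ 2 = 1 ->
  measurable_fun setT h -> (forall x, 0 <= h x)%E ->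
  (\int[mu]_x \int[mu]_y h (c * x - s * y, s * x + c * y)%R = \int[mu]_x \int[mu]_y h (x, y))%E.
Proof.
move=> s0 cs mh h0.
(* For [c] and [s] the cosine and sine of an angle, [a] is minus the tangent of its half; the shears
   of parameters [a], [s], [a] compose to the rotation. *)
pose a := (c - 1) / s.
pose h1 z := h (z.1 + a * z.2, z.2).
pose h2 z := h1 (z.1, z.2 + s * z.1).
have mh1 : measurable_fun setT h1.
  apply: measurableT_comp => //; apply: measurable_fun_pair => //.
  by apply: measurable_funD => //; apply: measurable_funM => //.
have mh2 : measurable_fun setT h2.
  apply: measurableT_comp => //; apply: measurable_fun_pair => //.
  by apply: measurable_funD => //; apply: measurable_funM => //.
have h10 z : (0 <= h1 z)%E by exact: h0.
have h20 z : (0 <= h2 z)%E by exact: h0.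
etransitivity; last exact: (@plane_shear h a mh h0).
etransitivity; last exact: (@plane_shear' h1 s mh1 h10).
etransitivity; last exact: (@plane_shear h2 a mh2 h20).
apply: eq_integral => x _; apply: eq_integral => y _; rewrite /h2 /h1 /=.
have e : c * c = 1 - s * s by rewrite -cs; ring.
congr (h (_, _)); rewrite /a; field: e => //.
Qed.

Definition rot (c s : R) (z : R * R) : R * R := (c * z.1 - s * z.2, s * z.1 + c * z.2).

Lemma measurable_rot (c s : R) : measurable_fun setT (rot c s).
Proof.
by apply: measurable_fun_pair; [apply: measurable_funB|apply: measurable_funD];
  apply: measurable_funM.
Qed.

Section density.
Context d (T : measurableType d) (m : {measure set T -> \bar R}) (f : T -> \bar R).
Hypotheses (mf : measurable_fun setT f) (f0 : forall x, (0 <= f x)%E).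

Definition density (A : set T) : \bar R := (\int[m]_(x in A) f x)%E.

Let density_set0 : density set0 = 0%E. Proof. exact: integral_set0. Qed.

Let density_ge0 A : (0 <= density A)%E. Proof. exact: integral_ge0. Qed.

Let density_sigma_additive : semi_sigma_additive density.
Proof.
move=> /= A mA tA mUA; rewrite /density ge0_integral_bigcup//=; last exact: measurable_funTS.
by apply: is_cvg_ereal_nneg_natsum_cond => n _ _; exact: integral_ge0.
Qed.

HB.instance Definition _ := isMeasure.Build _ _ _
  density density_set0 density_ge0 density_sigma_additive.

Definition density_measure : {measure set T -> \bar R} := density.

End density.
Arguments density {d T}.
Arguments density_measure {d T} m {f}.

(** A product measure is determined by its values on rectangles, so it is enough that the measure of
    density [f] factorizes there. *)
Lemma gaussian_plane_density (sd : R) (C : set (R * R)) : measurable C ->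
  (normal_prob 0 sd \x normal_prob 0 sd)%E C =
  (\int[mu]_x \int[mu]_y
    (normal_pdf 0 sd x * normal_pdf 0 sd y * \1_C (x, y))%:E)%E.
Proof.
move=> mC.
pose f (z : R * R) := (normal_pdf 0 sd z.1 * normal_pdf 0 sd z.2)%:E.
have mf : measurable_fun setT f.
  apply/measurable_EFinP.
  by apply: measurable_funM; apply: measurableT_comp => //; exact: measurable_normal_pdf.
have f0 z : (0 <= f z)%E by rewrite lee_fin mulr_ge0// normal_pdf_ge0.
have E (A : set (R * R)) : measurable A -> density (mu \x mu)%E f A = (\int[mu]_x \int[mu]_y
    (normal_pdf 0 sd x * normal_pdf 0 sd y * \1_A (x, y))%:E)%E.
  move=> mA; rewrite /density integral_mkcond fubini_tonelli1.
  - apply: eq_integral => x _; apply: eq_integral => y _; rewrite /patch indicE.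
    by case: ifP => _; rewrite ?mulr1 ?mulr0.
  - by apply/(measurable_restrictT _ _).1 => //; exact: measurable_funTS.
  - by move=> z; rewrite /patch; case: ifP.
rewrite -E//.
suff H A B : measurable A -> measurable B ->
    density (mu \x mu)%E f (A `*` B) = (normal_prob 0 sd A * normal_prob 0 sd B)%E.
  exact: (@product_measure_unique _ _ _ _ R (normal_prob 0 sd) (normal_prob 0 sd)
    (density_measure (mu \x mu)%E mf f0) H C mC).
move=> mA mB.
rewrite E; last exact: measurableX.
rewrite /normal_prob (integral_mkcond A) (integral_mkcond B).
rewrite -ge0_integralZr//; last 3 first.
- apply/(measurable_restrictT _ _).1 => //; apply: measurable_funTS; apply/measurable_EFinP.
  exact: measurable_normal_pdf.
- by move=> x _; rewrite /patch; case: ifP => // _; rewrite lee_fin normal_pdf_ge0.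
- by apply: integral_ge0 => x _; rewrite /patch; case: ifP => // _; rewrite lee_fin normal_pdf_ge0.
apply: eq_integral => x _.
rewrite -ge0_integralZl//; last 3 first.
- apply/(measurable_restrictT _ _).1 => //; apply: measurable_funTS; apply/measurable_EFinP.
  exact: measurable_normal_pdf.
- by move=> y _; rewrite /patch; case: ifP => // _; rewrite lee_fin normal_pdf_ge0.
- by rewrite /patch; case: ifP => // _; rewrite lee_fin normal_pdf_ge0.
apply: eq_integral => y _; rewrite /patch indicE.
rewrite in_setX /=; case: (x \in A); case: (y \in B); rewrite /= ?mulr1 ?mulr0 ?mule0 ?mul0e//.
Qed.

Lemma gaussian_rotation (sd c s : R) (C : set (R * R)) :
  sd != 0 -> s != 0 -> c ^+ 2 + s ^+ 2 = 1 -> measurable C ->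
  (normal_prob 0 sd \x normal_prob 0 sd)%E (rot c s @^-1` C) =
  (normal_prob 0 sd \x normal_prob 0 sd)%E C.
Proof.
move=> sd0 s0 cs mC.
pose phi (z : R * R) := ((normal_pdf 0 sd z.1 * normal_pdf 0 sd z.2) * \1_C z)%:E.
have mphi : measurable_fun setT phi.
  apply/measurable_EFinP; apply: measurable_funM; last exact: measurable_indic.
  by apply: measurable_funM; apply: measurableT_comp => //; exact: measurable_normal_pdf.
have mrC : measurable (rot c s @^-1` C).
  by rewrite -[_ @^-1` _]setTI; apply: measurable_rot.
rewrite (gaussian_plane_density sd mrC) (gaussian_plane_density sd mC).
have phi0 (z : R * R) : (0 <= phi z)%E.
  by rewrite /phi lee_fin !mulr_ge0// ?normal_pdf_ge0//.
etransitivity; last exact: (@plane_rotation phi c s s0 cs mphi phi0).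
apply: eq_integral => x _; apply: eq_integral => y _; rewrite /phi/=; congr EFin.
congr (_ * _); apply: normal_pdf_iso => //.
have e : s ^+ 2 = 1 - c ^+ 2 by rewrite -cs; ring.
have -> : (c * x - s * y) ^+ 2 + (s * x + c * y) ^+ 2 = (c ^+ 2 + s ^+ 2) * (x ^+ 2 + y ^+ 2) by ring.
by rewrite cs mul1r.
Qed.

End gaussian_plane.

(** * Laws determined by cylinder events *)

Section cylinders.
Context {R : realType} {I : Type} {E : pointedType}.
Variables (Y : I -> R -> E -> R) (T : R).

Definition cylinder (n : nat) (i : nat -> I) (u : nat -> R) (B : nat -> set R) : set E :=
  [set w | forall j, (j < n)%N -> B j (Y (i j) (u j) w)].

Definition cylinders : set (set E) :=
  [set A | exists n i u B, [/\ forall j, 0 <= u j <= T,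
     forall j, measurable (B j) & A = cylinder n i u B]].

Lemma cylinders_setI : setI_closed cylinders.
Proof.
move=> _ _ [n [i [u [B [hu mB ->]]]]] [n' [i' [u' [B' [hu' mB' ->]]]]].
pose cc A (f g : nat -> A) j := if (j < n)%N then f j else g (j - n)%N.
exists (n + n')%N, (cc _ i i'), (cc _ u u'), (cc _ B B'); split.
- by move=> j; rewrite /cc; case: ifP.
- by move=> j; rewrite /cc; case: ifP.
apply/seteqP; split => w /=.
  move=> [h h'] j jn; rewrite /cc; case: ifPn => [/h//|]; rewrite -leqNgt => nj.
  by apply: h'; rewrite ltn_subLR.
move=> h; split => j jn.
  by have := h j; rewrite /cc jn; apply; rewrite ltn_addr.
have := h (n + j)%N; have nj : (n + j < n)%N = false by rewrite ltnNge leq_addr.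
by rewrite /cc nj addKn; apply; rewrite ltn_add2l.
Qed.

Lemma preimage_cylinder d (Om : measurableType d) (X : Om -> E) n i u B :
  X @^-1` cylinder n i u B = \big[setI/setT]_(j < n) X @^-1` (Y (i j) (u j) @^-1` B j).
Proof.
rewrite -(bigcap_mkord _ (fun j => X @^-1` (Y (i j) (u j) @^-1` B j))).
by apply/seteqP; split.
Qed.

(** Dynkin's argument: cylinders are stable under intersection and generate the sigma-algebra. The
    index [i0] serves to write the whole space as a cylinder without constraints. *)
Lemma cylinder_law_unique d1 (O1 : measurableType d1) (P1 : probability O1 R)
    d2 (O2 : measurableType d2) (P2 : probability O2 R) (X1 : O1 -> E) (X2 : O2 -> E)
    (i0 : I) :
  0 <= T ->
  (forall A, past_events Y T A -> measurable (X1 @^-1` A)) ->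
  (forall A, past_events Y T A -> measurable (X2 @^-1` A)) ->
  (forall n i u B, (forall j, 0 <= u j <= T) -> (forall j, measurable (B j)) ->
     P1 (X1 @^-1` cylinder n i u B) = P2 (X2 @^-1` cylinder n i u B)) ->
  forall A, <<s past_events Y T >> A ->
    [/\ measurable (X1 @^-1` A), measurable (X2 @^-1` A) &
      P1 (X1 @^-1` A) = P2 (X2 @^-1` A)].
Proof.
move=> T0 mX1 mX2 PE A hA.
have mX d (Om : measurableType d) (X : Om -> E) :
    (forall A, past_events Y T A -> measurable (X @^-1` A)) ->
    measurable_fun setT (X : Om -> g_sigma_algebraType cylinders).
  move=> mX; apply: (@measurability _ _ Om (g_sigma_algebraType cylinders) setT X cylinders) => //.
  move=> _ [_ [n [i [u [B [hu mB ->]]]]] <-]; rewrite setTI preimage_cylinder.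
  apply: bigsetI_measurable => j _; apply: mX.
  by exists (i j), (u j), (B j); split.
have cA : <<s cylinders >> A.
  move: A hA; apply: smallest_sub; first exact: smallest_sigma_algebra.
  move=> _ [i [u [B [hu mB ->]]]]; apply: sub_sigma_algebra.
  exists 1%N, (fun=> i), (fun=> u), (fun=> B); split => //.
  by apply/seteqP; split => w /=; [move=> h [|]|move=> /(_ 0%N)]; rewrite //=; apply.
have m1 := mX _ _ _ mX1; have m2 := mX _ _ _ mX2.
split.
- by rewrite -[X in measurable X]setTI; exact: m1.
- by rewrite -[X in measurable X]setTI; exact: m2.
apply: (@measure_unique _ _ (g_sigma_algebraType cylinders) cylinders (fun=> setT) _ _ _ _
  (pushforward P1 (X1 : O1 -> g_sigma_algebraType cylinders))
  (pushforward P2 (X2 : O2 -> g_sigma_algebraType cylinders))) => //.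
- exact: cylinders_setI.
- move=> _; exists 0%N, (fun=> i0), (fun=> 0), (fun=> setT); split => //.
  + by move=> _; rewrite lexx.
  + by apply/seteqP; split.
- by rewrite bigcup_const//; exists 0%N.
- by move=> _ [n [i [u [B [hu mB ->]]]]]; exact: PE.
- by move=> _; rewrite /= /pushforward [_ @^-1` _]preimage_setT probability_setT ltry.
Qed.

End cylinders.

(** * Reflections and plane rotations of Brownian motion *)

Section brownian_isometries.
Context {R : realType} {nL : nat} {d : measure_display} {Om : measurableType d}.
Variable P : probability Om R.
Implicit Types W : R -> Om -> 'cV[R]_nL.

Definition flip_coord (i1 : 'I_nL) (v : 'cV[R]_nL) : 'cV[R]_nL :=
  \col_i if i == i1 then - v i 0 else v i 0.

Definition rot_coords (i1 i2 : 'I_nL) (c s : R) (v : 'cV[R]_nL) : 'cV[R]_nL :=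
  \col_i if i == i1 then c * v i1 0 - s * v i2 0
         else if i == i2 then s * v i1 0 + c * v i2 0 else v i 0.

Lemma prode_split2 n (f : 'I_n -> 'I_nL -> \bar R) m i1 i2 : i1 != i2 ->
  (\prod_j \prod_i f j i = (f m i1 * f m i2) *
   ((\prod_(i | (i != i1) && (i != i2)) f m i) * \prod_(j | j != m) \prod_i f j i))%E.
Proof.
move=> i12; rewrite (bigD1 m)// (bigD1 i1)// (bigD1 i2) 1?eq_sym//.
by rewrite /= !muleA.
Qed.

Lemma flip_coordE i1 v i :
  flip_coord i1 v i 0 = if i == i1 then - v i 0 else v i 0.
Proof. by rewrite mxE. Qed.

Lemma rot_coordsE i1 i2 c s v i : rot_coords i1 i2 c s v i 0 =
  if i == i1 then c * v i1 0 - s * v i2 0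
  else if i == i2 then s * v i1 0 + c * v i2 0 else v i 0.
Proof. by rewrite mxE. Qed.

Lemma rot_coordsB i1 i2 c s u v :
  rot_coords i1 i2 c s (u - v) = rot_coords i1 i2 c s u - rot_coords i1 i2 c s v.
Proof.
apply/matrixP => i j; rewrite !mxE.
by case: (i == i1); [|case: (i == i2)]; rewrite ?mxE; ring.
Qed.

Lemma brownian_flip W i1 : brownian P W -> brownian P (fun t w => flip_coord i1 (W t w)).
Proof.
move=> [mW W0 cW law]; split.
- move=> t i t0; under eq_fun do rewrite ?flip_coordE ?rot_coordsE.
  by case: eqP => _; [apply: measurable_funN|]; exact: mW.
- by move=> w; apply/matrixP => i j; rewrite !mxE !W0 !mxE oppr0 if_same.
- move=> w i; rewrite (_ : (fun t => _) = fun t => if i == i1 then - W t w i 0 else W t w i 0).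
    2: by apply/funext => t; rewrite flip_coordE.
  by case: (i == i1); [move=> x; apply: cvgN|]; exact: cW.
move=> n s A s0 sn mA.
pose A' j i := if i == i1 then (fun x => - x) @^-1` A j i else A j i.
have mA' j i : measurable (A' j i).
  rewrite /A'; case: eqP => // _; rewrite -[X in measurable X]setTI.
  exact: (@measurable_funN _ _ _ setT id).
transitivity (\prod_(j < n) \prod_(i < nL)
    normal_prob 0 (Num.sqrt (s j.+1 - s j)) (A' j i))%E.
  rewrite -law//; congr (P _); apply/seteqP; split => w h j i jn; have := h j i jn;
  by rewrite /A' !mxE; case: eqP => _ //=; rewrite opprB addrC opprK.
apply: eq_bigr => j _; apply: eq_bigr => i _; rewrite /A'; case: eqP => // _.
by rewrite normal_probN// gt_eqF// sqrtr_gt0 subr_gt0 sn.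
Qed.

(** The increments are rotated one at a time. Given all the other constraints, the coordinates [i1]
    and [i2] of the next increment are independent Gaussians of equal variance, and
    [gaussian_rotation] applies to this pair. *)
Lemma brownian_rot W i1 i2 c s : i1 != i2 -> s != 0 -> c ^+ 2 + s ^+ 2 = 1 ->
  brownian P W -> brownian P (fun t w => rot_coords i1 i2 c s (W t w)).
Proof.
move=> i12 s0 cs [mW W0 cW law]; split.
- move=> t i t0; under eq_fun do rewrite ?flip_coordE ?rot_coordsE.
  case: eqP => _; [apply: measurable_funB|case: eqP => _; [apply: measurable_funD|exact: mW]];
  by apply: measurable_funM => //; exact: mW.
- move=> w; apply/matrixP => i j; rewrite !mxE !W0 !mxE !mulr0 subr0 addr0.
  by rewrite !if_same.
- move=> w i; rewrite (_ : (fun t => _) = fun t => if i == i1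
    then c * W t w i1 0 - s * W t w i2 0
    else if i == i2 then s * W t w i1 0 + c * W t w i2 0 else W t w i 0).
    2: by apply/funext => t; rewrite rot_coordsE.
  case: (i == i1); [move=> x; apply: cvgB|case: (i == i2); [move=> x; apply: cvgD|exact: cW]];
  by apply: cvgM; [exact: cvg_cst|exact: cW].
move=> n u A u0 un mA.
pose D j w := W (u j.+1) w - W (u j) w.
have u_ge0 k : (k <= n)%N -> 0 <= u k.
  by elim: k => // k IH kn; rewrite (le_trans (IH (ltnW kn)))// ltW// un.
have mD j i : (j < n)%N -> measurable_fun setT (fun w => D j w i 0).
  move=> jn; under eq_fun do rewrite !mxE.
  by apply: measurable_funB; apply: mW; apply: u_ge0 => //; exact: ltnW.
(* The induction is on the number [m] of increments already rotated. *)
pose S m := forall A : nat -> 'I_nL -> set R, (forall j i, measurable (A j i)) ->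
  P [set w | forall j i, (j < n)%N ->
     A j i ((if (j < m)%N then rot_coords i1 i2 c s (D j w) else D j w) i 0)] =
  (\prod_(j < n) \prod_(i < nL) normal_prob 0 (Num.sqrt (u j.+1 - u j)) (A j i))%E.
suff Sn : S n.
  have E j i w : rot_coords i1 i2 c s (D j w) i 0 =
      rot_coords i1 i2 c s (W (u j.+1) w) i 0 - rot_coords i1 i2 c s (W (u j) w) i 0.
    by rewrite /D rot_coordsB !mxE.
  rewrite -(Sn A mA); congr (P _); apply/seteqP; split => w h j i jn; have := h j i jn;
  by rewrite jn E.
suff: forall m, (m <= n)%N -> S m by exact.
elim=> [_|m IH mn].
  move=> A' mA'; rewrite -law//; congr (P _).
  by apply/seteqP; split => w h j i jn; have := h j i jn; rewrite /= /D !mxE.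
have {}IH := IH (ltnW mn).
move=> {mA}A mA.
pose R' := measurableTypeR R.
pose N : probability R' R := normal_prob 0 (Num.sqrt (u m.+1 - u m)).
have sd0 : Num.sqrt (u m.+1 - u m) != 0 by rewrite gt_eqF// sqrtr_gt0 subr_gt0 un.
pose m' := Ordinal mn.
(* [AC X Y] constrains the pair of interest by [X] and [Y] and everything else by [A]; below, [K] is
   the probability of the constraints outside the pair. *)
pose AC X Y j i : set R := if (j == m) && (i == i1) then X else
  if (j == m) && (i == i2) then Y else A j i.
have mAC X Y j i : measurable X -> measurable Y -> measurable (AC X Y j i).
  by move=> mX mY; rewrite /AC; case: ifP => // _; case: ifP.
pose K : \bar R := ((\prod_(i < nL | (i != i1) && (i != i2)) N (A m i)) *
  (\prod_(j < n | j != m') \prod_(i < nL)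
    normal_prob 0 (Num.sqrt (u j.+1 - u j)) (A j i)))%E.
have KE X Y : (\prod_(j < n) \prod_(i < nL)
    normal_prob 0 (Num.sqrt (u j.+1 - u j)) (AC X Y j i) = (N X * N Y) * K)%E.
  have AC1 : AC X Y m i1 = X by rewrite /AC !eqxx.
  have AC2 : AC X Y m i2 = Y by rewrite /AC !eqxx eq_sym (negbTE i12).
  rewrite (prode_split2 _ m' i12); lazy beta; rewrite [AC X Y m' i1]AC1 [AC X Y m' i2]AC2.
  rewrite /K; congr (_ * (_ * _))%E.
    apply: eq_bigr => i /andP[/negbTE ii1 /negbTE ii2].
    by rewrite /AC ii1 ii2 !andbF.
  apply: eq_bigr => j jm; apply: eq_bigr => i _.
  by rewrite /AC; have -> : (j == m :> nat) = false by apply/negbTE.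
pose F := [set w | forall j i, (j < n)%N -> AC setT setT j i
  ((if (j < m)%N then rot_coords i1 i2 c s (D j w) else D j w) i 0)].
pose pr w : (R' * R')%type := (D m w i1 0, D m w i2 0).
have mG j i : (j < n)%N -> measurable_fun setT (fun w =>
    (if (j < m)%N then rot_coords i1 i2 c s (D j w) else D j w) i 0).
  move=> jn; case: (j < m)%N; last exact: mD.
  under eq_fun do rewrite rot_coordsE.
  case: (i == i1); [apply: measurable_funB|case: (i == i2); [apply: measurable_funD|exact: mD]];
  by apply: measurable_funM => //; exact: mD.
have mF : measurable F.
  rewrite [X in measurable X](_ : _ = \bigcap_(j in `I_n) \bigcap_(i in [set: 'I_nL])
    [set w | AC setT setT j i
      ((if (j < m)%N then rot_coords i1 i2 c s (D j w) else D j w) i 0)]).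
    apply: bigcap_measurable => [|j jn]; [by exists m|]; apply: fin_bigcap_measurable => // i _.
    have := mG j i jn measurableT _ (mAC setT setT j i measurableT measurableT).
    by rewrite setTI.
  apply/seteqP; split => w; first by move=> h j jn i _; exact: h.
  by move=> h j i jn; exact: (h j jn i).
have mpr : measurable_fun setT pr by apply: measurable_fun_pair; exact: mD.
have FE X Y : F `&` pr @^-1` (X `*` Y) = [set w | forall j i, (j < n)%N -> AC X Y j i
  ((if (j < m)%N then rot_coords i1 i2 c s (D j w) else D j w) i 0)].
  apply/seteqP; split => w /=.
    move=> [Fw [Xw Yw]] j i jn; have := Fw j i jn; rewrite /AC.
    by case: ifP => [/andP[/eqP-> /eqP->]|_]; [rewrite ltnn|
      case: ifP => [/andP[/eqP-> /eqP->]|_]]; rewrite ?ltnn.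
  move=> h; split.
    by move=> j i jn; have := h j i jn; rewrite /AC; case: ifP => // _; case: ifP.
  split; [have := h m i1 mn|have := h m i2 mn]; rewrite /AC ltnn !eqxx//=.
  by rewrite eq_sym (negbTE i12).
have FR X Y : measurable X -> measurable Y ->
    P (F `&` pr @^-1` (X `*` Y)) = ((N X * N Y) * K)%E.
  by move=> mX mY; rewrite FE -KE IH// => j i; exact: mAC.
(* Independence of the pair from [F] extends from rectangles to Borel sets of the plane by
   uniqueness of product measures, applied to the conditional law [m2] of the pair given [F]. *)
have FC (C : set (R' * R')%type) : measurable C -> P (F `&` pr @^-1` C) = ((N \x N) C * K)%E.
  move=> mC.
  pose m1 : {measure set (R' * R')%type -> \bar R} := measure_function_pushforward__canonical__measure_function_Measure (mrestr P mF) mpr.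
  have m1E C' : m1 C' = P (F `&` pr @^-1` C') by rewrite /m1/= /pushforward /mrestr setIC.
  have NT : (N setT = 1)%E by exact: probability_setT.
  have PFK : P F = K.
    by rewrite -[F]setIT -(preimage_setT pr) -setXTT FR// NT !mul1e.
  have K0 : (0 <= K)%E by rewrite -PFK.
  have Kfin : K \is a fin_num by rewrite -PFK fin_num_measure.
  (* There is no conditional law when [F] is negligible, but both sides then vanish. *)
  have [K_eq0|K_neq0] := eqVneq K 0%E.
    rewrite K_eq0 mule0; apply/eqP; rewrite -measure_le0 -K_eq0 -PFK.
    have mFC : measurable (F `&` pr @^-1` C).
      by apply: measurableI => //; rewrite -[X in measurable X]setTI; exact: (mpr measurableT C mC).
    by apply: (le_measure P); rewrite ?inE// => w [].
  have k0 : 0 < fine K by rewrite fine_gt0// lt_neqAle eq_sym K_neq0 K0 ltey_eq Kfin.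
  have k0' : 0 <= (fine K)^-1 by rewrite invr_ge0 ltW.
  have KV : (K * (fine K)^-1%:E = 1)%E.
    by rewrite -{1}[K]fineK// -EFinM divff// gt_eqF.
  pose m2 : {measure set (R' * R')%type -> \bar R} := mscale (NngNum k0') m1.
  have m2E : forall X Y, measurable X -> measurable Y -> m2 (X `*` Y) = (N X * N Y)%E.
    by move=> X Y mX mY; rewrite /m2/= /mscale m1E FR// muleC -muleA KV mule1.
  transitivity (m2 C * K)%E.
    by rewrite /m2/= /mscale m1E [RHS]muleC muleA KV mul1e.
  congr (_ * _)%E; apply/esym.
  exact: (@product_measure_unique _ _ _ _ R N N m2 m2E C mC).
transitivity (P (F `&` pr @^-1` (rot c s @^-1` (A m i1 `*` A m i2)))).
  have jmE j : j != m -> (j < m.+1)%N = (j < m)%N.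
    by move=> jm; rewrite ltnS leq_eqVlt (negbTE jm).
  congr (P _); apply/seteqP; split => w.
    move=> h; split => [j i jn|].
      have := h j i jn; rewrite /AC; case: (eqVneq j m) => [->|/jmE->//].
      rewrite ltnSn ltnn rot_coordsE /=.
      by case: (i == i1) => //; case: (i == i2).
    have := h m i1 mn; have := h m i2 mn.
    by rewrite ltnSn !rot_coordsE !eqxx eq_sym (negbTE i12); split.
  move=> [Fw []]; rewrite /rot /= => h1 h2 j i jn.
  have := Fw j i jn; rewrite /AC; case: (eqVneq j m) => [->|/jmE->//].
  rewrite ltnSn ltnn rot_coordsE /=.
  by case: eqP => [->//|_]; case: eqP => [->//|_].
have mAA : measurable (A m i1 `*` A m i2) by exact: measurableX.
rewrite FC; last by rewrite -[X in measurable X]setTI; exact: (measurable_rot c s measurableT mAA).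
have -> : (N \x N)%E (rot c s @^-1` (A m i1 `*` A m i2)) = (N (A m i1) * N (A m i2))%E.
  etransitivity; first exact: (gaussian_rotation sd0 s0 cs mAA).
  exact: (product_measure1E N N (mA m i1) (mA m i2)).
rewrite -KE; apply: eq_bigr => j _; apply: eq_bigr => i _.
by rewrite /AC; case: ifP => [/andP[/eqP-> /eqP->]|_] //; case: ifP => [/andP[/eqP-> /eqP->]|_].
Qed.

End brownian_isometries.

(** * The law of Brownian paths *)

Section increasing_times.
Context {R : realType}.

(** The law of a Brownian motion is given along increasing times, whereas the times of a cylinder
    come in any order and may repeat. Time 0 is added because the path is recovered by summing
    increments from there. *)
Lemma exists_increasing_times n (u : nat -> R) : (forall j, 0 <= u j) ->
  exists s : nat -> R, [/\ s 0%N = 0, forall j, s j < s j.+1 &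
    forall j, (j < n)%N -> exists l, s l = u j].
Proof.
move=> u0.
pose L := sort <=%R (undup (0 :: [seq u j | j <- iota 0 n])).
pose M := \sum_(j < n) u j.
have ltL : sorted <%R L by rewrite sort_lt_sorted undup_uniq.
have memL x : (x \in L) = (x == 0) || (x \in [seq u j | j <- iota 0 n]).
  by rewrite mem_sort mem_undup inE.
have L0 x : x \in L -> 0 <= x.
  by rewrite memL => /orP[/eqP->//|/mapP[j _ ->]].
have LM x : x \in L -> x <= M.
  rewrite memL => /orP[/eqP->|/mapP[j]]; first exact: sumr_ge0.
  rewrite mem_iota add0n => /andP[_ jn] ->.
  rewrite /M (bigD1 (Ordinal jn))//= lerDl; exact: sumr_ge0.
have sL : (0 < size L)%N.
  by have := memL 0; rewrite eqxx /=; case: L {ltL memL L0 LM}.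
(* Beyond the end of the sorted list the default [M + l] takes over: [M] bounds the list, so the
   sequence goes on increasing. *)
exists (fun l => nth (M + l%:R) L l); split.
- have m0 : nth (M + 0%:R) L 0 \in L by exact: mem_nth.
  apply/eqP; rewrite eq_le L0// andbT.
  have /(nthP (M + 0%:R))[k kL <-] : 0 \in L by rewrite memL eqxx.
  case: k kL => // k kL.
  by apply/ltW; rewrite (sorted_ltn_nth lt_trans)// ?inE.
- move=> j; have [j1L|] := ltnP j.+1 (size L).
    rewrite (set_nth_default (M + j.+1%:R) (M + j%:R) (ltnW j1L)).
    by rewrite (sorted_ltn_nth lt_trans) ?inE// ltnW.
  move=> Lj1; rewrite [ltRHS]nth_default//.
  have [jL|Lj] := ltnP j (size L).
    by rewrite (le_lt_trans (LM _ (mem_nth _ jL)))// ltrDl.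
  by rewrite nth_default// ltrD2l ltr_nat.
- move=> j jn; have uL : u j \in L.
    by rewrite memL map_f ?orbT// mem_iota add0n.
  exists (index (u j) L); rewrite nth_index//.
Qed.
End increasing_times.

Lemma continuous_comp_within {R : realType} (f g : R -> R) (A : set R) :
  {within A, continuous f} -> continuous g -> (forall x, A (g x)) ->
  continuous (f \o g).
Proof.
move=> cf cg Ag x U fU.
have h : within A (nbhs (g x)) (f @^-1` U).
  by rewrite (nbhs_subspace_in (Ag x)); exact: cf.
have := cg x _ h; rewrite !nbhs_simpl/= => h'.
by apply: filterS h' => z /(_ (Ag z)).
Qed.

Section brownian_law.
Context {R : realType} {nL : nat}.

(** A common space for the paths of different Brownian motions, on which the probabilities of one
    event can be compared. *)
Record cpath := CPath {
  cpath_fun :> R -> 'cV[R]_nL;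
  cpath_cont : forall i, continuous (fun s => cpath_fun s i 0) }.

Lemma cst0_cpath_cont i : continuous (fun s : R => (fun=> 0 : 'cV[R]_nL) s i 0).
Proof. by move=> x; exact: cvg_cst. Qed.

HB.instance Definition _ := gen_eqMixin cpath.
HB.instance Definition _ := gen_choiceMixin cpath.
HB.instance Definition _ := isPointed.Build cpath (CPath cst0_cpath_cont).

Definition cpath_coord (i : 'I_nL) (s : R) (p : cpath) : R := p s i 0.

(** Increments carry no time parameter; the dummy argument lets [past_events] and [cylinder] apply
    to them, with horizon 0. *)
Let incr_coord (ji : nat * 'I_nL) (_ : R) (x : nat -> 'I_nL -> R) : R := x ji.1 ji.2.

Lemma brownian_incr_law d1 (O1 : measurableType d1) (P1 : probability O1 R) W1
    d2 (O2 : measurableType d2) (P2 : probability O2 R) W2 (s : nat -> R) (i0 : 'I_nL) :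
  brownian P1 W1 -> brownian P2 W2 -> 0 <= s 0%N -> (forall j, s j < s j.+1) ->
  forall A, <<s past_events incr_coord 0 >> A ->
    P1 [set w | A (fun j i => W1 (s j.+1) w i 0 - W1 (s j) w i 0)] =
    P2 [set w | A (fun j i => W2 (s j.+1) w i 0 - W2 (s j) w i 0)].
Proof.
move=> b1 b2 s0 ss A hA.
have s_ge0 k : 0 <= s k by elim: k => // k /le_trans -> //; exact/ltW.
have mX d (Om : measurableType d) (P : probability Om R) W : brownian P W ->
    forall A, past_events incr_coord 0 A ->
    measurable ((fun w j i => W (s j.+1) w i 0 - W (s j) w i 0) @^-1` A).
  move=> [mW _ _ _] _ [[j i] [u [B [_ mB ->]]]].
  rewrite -[X in measurable X]setTI; apply: (measurable_funB (mW (s j.+1) i (s_ge0 _)) (mW (s j) i (s_ge0 _))) => //.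
have law d (Om : measurableType d) (P : probability Om R) W : brownian P W ->
    forall n (i : nat -> nat * 'I_nL) (u : nat -> R) (B : nat -> set R),
    (forall j, measurable (B j)) ->
    P ((fun w j i => W (s j.+1) w i 0 - W (s j) w i 0) @^-1` (cylinder incr_coord n i u B)) =
    (\prod_(j < (\max_(k < n) (i k).1).+1) \prod_(i' < nL)
       normal_prob 0 (Num.sqrt (s j.+1 - s j))
         (\bigcap_k if (k < n)%N && (i k == (nat_of_ord j, i')) then B k else setT))%E.
  move=> [_ _ _ hl] n i u B mB.
  (* Several constraints may bear on the same increment and coordinate: they are intersected, and
     coordinates without constraint get the whole line. *)
  rewrite -(hl _ s (fun j i' => \bigcap_k if (k < n)%N && (i k == (j, i')) then B k else setT))//.
    congr (P _); apply/seteqP; split => w /=.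
      move=> h j i' _ k _; case: ifP => // /andP[kn /eqP ik].
      by have := h k kn; rewrite /incr_coord ik.
    move=> h k kn; have := h (i k).1 (i k).2; rewrite ltnS.
    move=> /(_ (leq_bigmax (F := fun k : 'I_n => (i k).1) (Ordinal kn))) /(_ k I).
    by rewrite kn -surjective_pairing eqxx.
  by move=> j i'; apply: bigcapT_measurable => k; case: ifP.
have [_ _] := cylinder_law_unique (0%N, i0) (lexx 0) (mX _ _ _ _ b1) (mX _ _ _ _ b2)
  (fun n i u B _ mB => etrans (law _ _ _ _ b1 n i u B mB) (esym (law _ _ _ _ b2 n i u B mB))) hA.
by [].
Qed.

Lemma brownian_cpath_cont d (Om : measurableType d) (P : probability Om R)
  (W : R -> Om -> 'cV[R]_nL) : brownian P W -> forall w,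
  forall i, continuous (fun s : R => W (Num.max 0 s) w i 0).
Proof.
move=> [_ _ cW _] w i; apply: (continuous_comp_within (cW w i)).
  by move=> x; apply: continuous_max; [exact: cvg_cst|exact: cvg_id].
by move=> x; rewrite /= in_itv/= andbT le_max lexx.
Qed.

(** [brownian] constrains W at nonnegative times only, so the path is frozen at [W 0] before 0. *)
Definition brownian_cpath d (Om : measurableType d) (P : probability Om R)
  (W : R -> Om -> 'cV[R]_nL) (b : brownian P W) (w : Om) : cpath :=
  CPath (@brownian_cpath_cont _ _ P W b w).

(** Along increasing times that start at 0 and contain those of the cylinder, the values of the path
    are partial sums of increments, whose joint law is known. *)
Lemma brownian_path_law d1 (O1 : measurableType d1) (P1 : probability O1 R) W1
    d2 (O2 : measurableType d2) (P2 : probability O2 R) W2 (T : R) (i0 : 'I_nL)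
    (b1 : brownian P1 W1) (b2 : brownian P2 W2) : 0 <= T ->
  forall A, <<s past_events cpath_coord T >> A ->
  [/\ measurable (brownian_cpath b1 @^-1` A), measurable (brownian_cpath b2 @^-1` A) &
    P1 (brownian_cpath b1 @^-1` A) = P2 (brownian_cpath b2 @^-1` A)].
Proof.
move=> T0.
have mX d (Om : measurableType d) (P : probability Om R) W (b : brownian P W) :
    forall A, past_events cpath_coord T A -> measurable (brownian_cpath b @^-1` A).
  move=> _ [i [u [B [/andP[u0 _] mB ->]]]]; have [mW _ _ _] := b.
  rewrite -[X in measurable X]setTI.
  have := mW u i u0 measurableT B mB; rewrite /brownian_cpath /cpath_coord/=.
  by rewrite /preimage/= max_r.
apply: (cylinder_law_unique i0) => // [||n i u B hu mB]; [exact: mX|exact: mX|].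
have u0 j : 0 <= u j by have /andP[] := hu j.
have [s [s0 ss su]] := exists_increasing_times n u0.
have s_ge0 k : 0 <= s k by elim: k => [|k /le_trans ->//]; [rewrite s0|exact/ltW].
pose l j := if pselect (exists l, s l = u j) is left e then projT1 (cid e) else 0%N.
have sl j : (j < n)%N -> s (l j) = u j.
  by move=> /su e; rewrite /l; case: pselect => // e'; case: cid.
pose A (x : nat -> 'I_nL -> R) := forall j, (j < n)%N -> B j (\sum_(k < l j) (x k (i j) : R)).
have hA : <<s past_events incr_coord 0 >> A.
  pose E := g_sigma_algebraType (past_events incr_coord 0).
  have mc k i' : measurable_fun setT (fun x : E => x k i').
    move=> _ C mC; rewrite setTI; apply: sub_sigma_algebra.
    by exists (k, i'), 0, C; rewrite lexx.
  suff : @measurable _ E A by [].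
  rewrite [A](_ : _ = \bigcap_j if (j < n)%N then
      (fun x : nat -> 'I_nL -> R => \sum_(k < l j) (x k (i j) : R)) @^-1` B j else setT).
    apply: bigcapT_measurable => j; case: ifP => // _.
    have ms : measurable_fun setT (fun x : E => \sum_(k < l j) (x k (i j) : R)).
      by apply: measurable_sum => k; exact: mc.
    by rewrite -[X in measurable X]setTI; exact: (ms measurableT _ (mB j)).
  apply/seteqP; split => x h; first by move=> j _; case: ifP => // /h.
  by move=> j jn; have := h j I; rewrite jn.
have AE d (Om : measurableType d) (P : probability Om R) W (b : brownian P W) :
    brownian_cpath b @^-1` cylinder cpath_coord n i u B =
    [set w | A (fun j i => W (s j.+1) w i 0 - W (s j) w i 0)].
  have [_ W0 _ _] := b.
  have E j w : (j < n)%N -> \sum_(k < l j) (W (s k.+1) w (i j) 0 - W (s k) w (i j) 0) =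
      cpath_coord (i j) (u j) (brownian_cpath b w).
    move=> jn; rewrite -(big_mkord xpredT (fun k => W (s k.+1) w (i j) 0 - W (s k) w (i j) 0)).
    rewrite telescope_sumr// s0 W0 mxE subr0 sl// /cpath_coord/= max_r//.
  by apply/seteqP; split => w h j jn; have := h j jn; rewrite E.
rewrite !AE; apply: brownian_incr_law => //; by rewrite s0.
Qed.

End brownian_law.

(** * The radial part of the Ornstein-Uhlenbeck process *)

Section caratheodory.
Context {R : realType} d (X : measurableType d).

(** Rounding the first variable down to a multiple of 1 / (n + 1) gives functions that are
    measurable on each of countably many strips; by continuity they converge to [f]. *)
Lemma measurable_caratheodory (f : R -> X -> R) :
  (forall u, measurable_fun setT (f u)) -> (forall x, continuous (f ^~ x)) ->
  measurable_fun setT (fun z : R * X => f z.1 z.2).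
Proof.
move=> mf cf.
pose r n (u : R) := (Num.floor (u * n.+1%:R))%:~R / n.+1%:R : R.
apply: (@measurable_fun_cvg _ _ _ _ (fun n (z : R * X) => f (r n z.1) z.2)).
- move=> n _ B mB; rewrite setTI.
  rewrite [X in measurable X](_ : _ = \bigcup_(k : int)
    ([set u : R | Num.floor (u * n.+1%:R) = k] `*` f (k%:~R / n.+1%:R) @^-1` B)).
    apply: countable_bigcupT_measurable; first exact: countableP.
    move=> k; apply: measurableX; last by rewrite -[X in measurable X]setTI; exact: mf.
    rewrite [X in measurable X](_ : _ = `[k%:~R / n.+1%:R, (k + 1)%:~R / n.+1%:R[%classic)//.
    apply/seteqP; split => u /=; rewrite in_itv/= ler_pdivrMr// ltr_pdivlMr//.
      by move=> <-; rewrite floor_itv.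
    exact: floor_def.
  by apply/seteqP; split => [[u x] /= h|[u x] [k _ [/= <-]]//]; exists (Num.floor (u * n.+1%:R)).
- move=> [u x] _ /=; apply: (@cvg_comp _ _ _ (r ^~ u) (f ^~ x) _ (nbhs u)); last exact: cf.
  apply: (squeeze_cvgr (f := fun n => u - harmonic n) (h := fun=> u)).
  + near=> n; rewrite /r /harmonic/= lerBlDr ler_pdivrMr// floor_le andbT.
    rewrite -[X in _ + X]mul1r -mulrDl ler_pdivlMr// -[1 in X in _ <= X]/(1%:~R) -intrD.
    by have /andP[_ /ltW] := floor_itv (u * n.+1%:R).
  + by rewrite -[X in _ --> X]subr0; apply: cvgB; [exact: cvg_cst|exact: cvg_harmonic].
  + exact: cvg_cst.
Unshelve. all: end_near. Qed.

Definition clamp (a b u : R) : R := Num.max a (Num.min b u).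

Lemma clampP a b u : a <= b -> a <= clamp a b u <= b.
Proof. by move=> ab; rewrite /clamp le_max lexx ge_max ab ge_min lexx. Qed.

Lemma clamp_id a b u : a <= u <= b -> clamp a b u = u.
Proof. by move=> /andP[au ub]; rewrite /clamp min_r// max_r. Qed.

Lemma continuous_clamp a b : continuous (clamp a b).
Proof.
move=> x; apply: continuous_max; first exact: cvg_cst.
by apply: continuous_min; [exact: cvg_cst|exact: cvg_id].
Qed.

Lemma measurable_integral_caratheodory (f : R -> X -> R) a b :
  (forall u, a <= u <= b -> measurable_fun setT (f u)) ->
  (forall x, {within `[a, b], continuous (f ^~ x)}) ->
  measurable_fun setT (fun x => \int[lebesgue_measure]_(u in `[a, b]) f u x).
Proof.
move=> mf cf.
have [ba|ab] := ltP b a.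
  under eq_fun do rewrite set_itv_ge ?Rintegral_set0// -?leNgt ?bnd_simp//.
  exact: measurable_cst.
(* Clamping extends [f] continuously to all times without changing the integral over [a, b]. *)
pose g (z : X * R) := f (clamp a b z.2) z.1.
have mg : measurable_fun setT g.
  have := @measurable_caratheodory (fun u x => f (clamp a b u) x).
  have h1 u : measurable_fun setT (f (clamp a b u)) by apply: mf; exact: clampP.
  have h2 x : continuous (fun u => f (clamp a b u) x).
    apply: (continuous_comp_within (cf x) (@continuous_clamp a b)) => u /=.
    by rewrite in_itv; exact: clampP.
  move=> /(_ h1 h2) h3.
  apply: (@measurableT_comp _ _ _ _ _ _ _ _ (fun z : X * R => (z.2, z.1)) h3).
  exact: measurable_swap.
have mint (h : X * R -> \bar R) : measurable_fun setT h -> (forall z, 0 <= h z)%E ->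
    measurable_fun setT (fun x => \int[lebesgue_measure]_(u in `[a, b]) h (x, u))%E.
  move=> mh h0; under eq_fun do rewrite integral_mkcond.
  pose h' := (h \_ (setT `*` `[a, b]))%E.
  have mh' : measurable_fun setT h'.
    apply/(measurable_restrictT _ _).1; first exact: measurableX.
    exact: measurable_funTS.
  have h'0 z : (0 <= h' z)%E by rewrite /h' /patch; case: ifP.
  apply: (@eq_measurable_fun _ _ _ _ setT (fun x => \int[lebesgue_measure]_u h' (x, u))%E).
    move=> x _; apply: eq_integral => u _; rewrite /h' /patch /=.
    by rewrite in_setX in_setT.
  exact: (@measurable_fun_fubini_tonelli_F _ _ X (measurableTypeR R) R lebesgue_measure h' mh' h'0).
rewrite /Rintegral; apply: (measurableT_comp (@fine_measurable R setT measurableT)).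
under eq_fun do rewrite integralE.
have mEg : measurable_fun setT (EFin \o g) by exact/measurable_EFinP.
apply: emeasurable_funB.
- apply: (@eq_measurable_fun _ _ _ _ setT (fun x => \int[lebesgue_measure]_(u in `[a, b]) (EFin \o g)^\+ (x, u))%E).
    move=> x _; apply: eq_integral => u; rewrite inE /= in_itv /= => uab.
    by rewrite !funeposE /g/= clamp_id.
  by apply: mint; [exact: measurable_funepos|].
- apply: (@eq_measurable_fun _ _ _ _ setT (fun x => \int[lebesgue_measure]_(u in `[a, b]) (EFin \o g)^\- (x, u))%E).
    move=> x _; apply: eq_integral => u; rewrite inE /= in_itv /= => uab.
    by rewrite !funenegE /g/= clamp_id.
  by apply: mint; [exact: measurable_funeneg|].
Qed.

End caratheodory.

(** * A linear integral equation *)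

Section linear_integral_equation.
Context {R : realType}.
Notation mu := (@lebesgue_measure R).
Implicit Types (f h : R -> R) (g t s : R).

(* The solution of [f s = h s - g * \int_t^s f], by the integrating factor e^{gs}. *)
Definition damped g t h s : R :=
  h s - g * (expR (- (g * s)) * \int[mu]_(u in `[t, s]) (expR (g * u) * h u)).

Lemma continuous_integrable_itv f a b :
  {within `[a, b], continuous f} -> mu.-integrable `[a, b] (EFin \o f).
Proof. by move=> cf; apply: continuous_compact_integrable => //; exact: segment_compact. Qed.

Lemma within_subitv f a b c d : a <= c -> d <= b ->
  {within `[a, b], continuous f} -> {within `[c, d], continuous f}.
Proof.
move=> ac db; apply: continuous_subspaceW => x /=; rewrite !in_itv/=.
by move=> /andP[cx xd]; rewrite (le_trans ac)//= (le_trans xd).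
Qed.

(** The integrand on the right is the derivative of e^{gu} times the integral of [f] over [t, u],
    which vanishes at u = t. *)
Lemma integrating_factor g t s f : t <= s -> {within `[t, s], continuous f} ->
  expR (g * s) * \int[mu]_(u in `[t, s]) f u =
  \int[mu]_(u in `[t, s]) (expR (g * u) * (f u + g * \int[mu]_(v in `[t, u]) f v)).
Proof.
rewrite le_eqVlt => /orP[/eqP<- _|ts cf]; first by rewrite set_itv1 !Rintegral_set1 mulr0.
have fi : mu.-integrable `[t, s] (EFin \o f) by exact: continuous_integrable_itv.
pose F u := \int[mu]_(v in `[t, u]) f v.
have cF : {within `[t, s], continuous F}.
  exact: (parameterized_integral_continuous (ltW ts) fi).
have cE : continuous (fun u : R => expR (g * u)).
  move=> u; apply: (@continuous_comp _ _ _ ( *%R g) expR); last exact: continuous_expR.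
  exact: mulrl_continuous.
have cEF : {within `[t, s], continuous (fun u => expR (g * u) * F u)}.
  move=> x; apply: cvgM; [exact: (continuous_subspaceT cE)|exact: cF].
have dF x : x \in `]t, s[ -> derivable F x 1 /\ F^`()%classic x = f x.
  rewrite in_itv/= => /andP[tx xs].
  apply: (continuous_FTC1_closed xs fi tx).
  by apply: (within_continuous_continuous ts cf); rewrite in_itv/= tx.
have dEF x : x \in `]t, s[ -> is_derive x 1 (fun u => expR (g * u) * F u)
    (expR (g * x) * (f x + g * F x)).
  move=> /dF[dFx F'x].
  have dFx' : is_derive x 1 F (f x) := DeriveDef dFx (etrans (esym (derive1E F x)) F'x).
  have dg : is_derive x 1 ( *%R g) g.
    by have := is_deriveZ g (is_derive_id (x : R^o) (1 : R^o)); rewrite /GRing.scale/= mulr1.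
  have dE : is_derive x 1 (expR \o ( *%R g)) (expR (g * x) * g).
    exact: is_derive1_comp.
  have := is_deriveM dE dFx'; rewrite /GRing.scale/=.
  by congr is_derive; ring.
rewrite [RHS]/Rintegral.
rewrite (@continuous_FTC2 _ _ (fun u => expR (g * u) * F u) _ _ ts).
- by rewrite -EFinB/= /F set_itv1 Rintegral_set1 mulr0 subr0.
- move=> x; apply: cvgM; first exact: (continuous_subspaceT cE).
  apply: cvgD; first exact: cf.
  by apply: cvgM; [exact: cvg_cst|exact: cF].
- have [_ ? ?] := (continuous_within_itvP _ ts).1 cEF.
  by split => // x /dEF[].
- by move=> x /dEF[? <-]; rewrite derive1E.
Qed.

(** In [integrating_factor] the bracket is [h] by the equation, so the integral of [f] is expressed
    through [h] alone. *)
Lemma damped_solution g t T f h : {within `[t, T], continuous f} ->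
  {in `[t, T], forall s, f s = h s - g * \int[mu]_(u in `[t, s]) f u} ->
  {in `[t, T], forall s, f s = damped g t h s}.
Proof.
move=> cf fE s sT; rewrite fE// /damped; congr (_ - _ * _).
have /andP[ts sT'] : t <= s <= T by move: sT; rewrite in_itv.
have := @integrating_factor g t s f ts (within_subitv (lexx t) sT' cf).
move=> e; apply: (@mulfI _ (expR (g * s))); first by rewrite gt_eqF ?expR_gt0.
rewrite {}e mulrA -expRD subrr expR0 mul1r.
apply: eq_Rintegral => u; rewrite inE/= in_itv/= => /andP[tu us].
by rewrite (fE u) ?subrK// in_itv/= tu (le_trans us).
Qed.

End linear_integral_equation.

Section radial_law.
Context {R : realType} {nL : nat}.
Notation mu := (@lebesgue_measure R).
Implicit Types (e : R -> 'cV[R]_nL) (z : 'cV[R]_nL).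

Lemma within_cst_add (A : set R) (f : R -> R) c :
  {within A, continuous f} -> {within A, continuous (fun u => c + f u)}.
Proof. by move=> cf x; apply: cvgD; [exact: cvg_cst|exact: cf]. Qed.

Lemma within_exp_mul (A : set R) (f : R -> R) g :
  {within A, continuous f} -> {within A, continuous (fun u => expR (g * u) * f u)}.
Proof.
move=> cf x; apply: cvgM; last exact: cf.
apply: (@continuous_subspaceT _ _ A (fun u : R => expR (g * u))) => u.
apply: (@continuous_comp _ _ _ ( *%R g) expR); last exact: continuous_expR.
exact: mulrl_continuous.
Qed.

Lemma damped_lin (g t s a b : R) (f h : R -> R) :
  {within `[t, s], continuous f} -> {within `[t, s], continuous h} ->
  damped g t (fun u => a * f u + b * h u) s = a * damped g t f s + b * damped g t h s.
Proof.
move=> cf ch; rewrite /damped.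
have mI : measurable (`[t, s]%classic : set (measurableTypeR R)) by [].
have i1 : mu.-integrable `[t, s] (EFin \o (fun u => expR (g * u) * f u)).
  exact/continuous_integrable_itv/within_exp_mul.
have i2 : mu.-integrable `[t, s] (EFin \o (fun u => expR (g * u) * h u)).
  exact/continuous_integrable_itv/within_exp_mul.
rewrite (_ : \int[mu]_(u in `[t, s]) (expR (g * u) * (a * f u + b * h u)) =
  a * \int[mu]_(u in `[t, s]) (expR (g * u) * f u) +
  b * \int[mu]_(u in `[t, s]) (expR (g * u) * h u)); first by ring.
rewrite -(RintegralZl a mI i1) -(RintegralZl b mI i2) -RintegralD//.
- by apply: eq_Rintegral => u _; ring.
- by have := integrableZl mI a i1.
- by have := integrableZl mI b i2.
Qed.

(* The path of the process started from [z] at time [t] and driven by [e]. *)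
Definition driven g t z e s : 'cV[R]_nL :=
  \col_i damped g t (fun u => z i 0 + (e u i 0 - e t i 0)) s.

Definition radius g t z e s : R := enorm (driven g t z e s).

Lemma enorm_ge0 z : 0 <= enorm z. Proof. exact: sqrtr_ge0. Qed.

Lemma enorm_flip i z : enorm (flip_coord i z) = enorm z.
Proof.
rewrite /enorm; congr Num.sqrt; apply: eq_bigr => j _; rewrite flip_coordE.
by case: ifP => // _; rewrite sqrrN.
Qed.

Lemma enorm_rot i j c s z : i != j -> c ^+ 2 + s ^+ 2 = 1 ->
  enorm (rot_coords i j c s z) = enorm z.
Proof.
move=> ij cs; rewrite /enorm; congr Num.sqrt.
rewrite (bigD1 i)// [RHS](bigD1 i)//= (bigD1 j) 1?eq_sym// [X in _ = _ + X](bigD1 j) 1?eq_sym//=.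
rewrite !addrA; congr (_ + _).
  rewrite !rot_coordsE !eqxx eq_sym (negbTE ij).
  transitivity ((c ^+ 2 + s ^+ 2) * (z i 0 ^+ 2 + z j 0 ^+ 2)); first by ring.
  by rewrite cs mul1r.
by apply: eq_bigr => k /andP[/negbTE ki /negbTE kj]; rewrite rot_coordsE ki kj.
Qed.

Section isometry.
Variables (g t s : R) (z : 'cV[R]_nL) (e : R -> 'cV[R]_nL).
Hypothesis ce : forall i, {within `[t, s], continuous (fun u => e u i 0)}.

Let cz i : {within `[t, s], continuous (fun u => z i 0 + (e u i 0 - e t i 0))}.
Proof.
apply: within_cst_add => x; apply: cvgB; [exact: ce|exact: cvg_cst].
Qed.

(** The damping is the same in all coordinates and linear in the forcing, so it commutes with linear
    maps, in particular with the reflections and rotations used here. *)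
Lemma driven_flip i : driven g t (flip_coord i z) (flip_coord i \o e) s =
  flip_coord i (driven g t z e s).
Proof.
apply/matrixP => k l; rewrite ord1 flip_coordE !mxE /=; case: eqP => [->|ki]; last first.
  by congr damped; apply/funext => u; rewrite !flip_coordE; case: eqP.
rewrite (_ : (fun u => _) = fun u => -1 * (z i 0 + (e u i 0 - e t i 0)) + 0 * (z i 0 + (e u i 0 - e t i 0))).
  by rewrite damped_lin//; ring.
by apply/funext => u; rewrite !flip_coordE eqxx; ring.
Qed.

Lemma driven_rot i j c r : driven g t (rot_coords i j c r z) (rot_coords i j c r \o e) s =
  rot_coords i j c r (driven g t z e s).
Proof.
apply/matrixP => k l; rewrite ord1 rot_coordsE !mxE /=; case: eqP => [->|ki].
  rewrite (_ : (fun u => _) = fun u => c * (z i 0 + (e u i 0 - e t i 0)) + (- r) * (z j 0 + (e u j 0 - e t j 0))).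
    by rewrite damped_lin//; ring.
  by apply/funext => u; rewrite !rot_coordsE eqxx; ring.
case: eqP => [kj|kj].
  subst k; rewrite (_ : (fun u => _) = fun u => r * (z i 0 + (e u i 0 - e t i 0)) + c * (z j 0 + (e u j 0 - e t j 0))).
    by rewrite damped_lin//; ring.
  apply/funext => u; rewrite !rot_coordsE eqxx; case: eqP => [ji|_]; last by ring.
  by case: ki.
by congr damped; apply/funext => u; rewrite !rot_coordsE; case: eqP => // _; case: eqP.
Qed.
End isometry.

End radial_law.

(** * The law of the radius depends only on the initial radius *)

Section rotation_invariance.
Context {R : realType} {nL : nat}.
Implicit Types (z : 'cV[R]_nL).

Lemma measurable_enorm d (X : measurableType d) (D : set X) (v : X -> 'cV[R]_nL) :
  (forall i, measurable_fun D (fun x => v x i 0)) -> measurable_fun D (fun x => enorm (v x)).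
Proof.
move=> mv; rewrite /enorm.
apply: (@measurableT_comp _ _ _ _ _ _ (@Num.sqrt R)).
  by apply: continuous_measurable_fun => x; exact: sqrt_continuous.
by apply: measurable_sum => i; exact: measurable_funX.
Qed.

Variables (g t T : R).
Hypotheses (t0 : 0 <= t) (tT : t <= T).

Definition radius_cylinder z n (s : nat -> R) (B : nat -> set R) : set (@cpath R nL) :=
  [set e | forall j, (j < n)%N -> B j (radius g t z e (s j))].

Notation path_sigma := (g_sigma_algebraType (past_events (@cpath_coord R nL) T)).

Lemma measurable_cpath_coord i u : 0 <= u <= T ->
  measurable_fun setT (fun e : path_sigma => e u i 0).
Proof.
move=> uT _ B mB; rewrite setTI; apply: sub_sigma_algebra.
by exists i, u, B.
Qed.

Lemma measurable_radius z s : t <= s <= T ->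
  measurable_fun setT (fun e : path_sigma => radius g t z e s).
Proof.
move=> /andP[ts sT]; apply: measurable_enorm => i.
under eq_fun do rewrite mxE.
have mc u : t <= u <= T -> measurable_fun setT (fun e : path_sigma => z i 0 + (e u i 0 - e t i 0)).
  move=> /andP[tu uT]; apply: measurable_funD => //.
  apply: measurable_funB; apply: measurable_cpath_coord; first by rewrite (le_trans t0).
  by rewrite t0.
apply: measurable_funB; first by apply: mc; rewrite ts.
apply: measurable_funM => //; apply: measurable_funM => //.
apply: (@measurable_integral_caratheodory R _ path_sigma
  (fun u e => expR (g * u) * (z i 0 + (e u i 0 - e t i 0)))).
  move=> u /andP[tu us]; apply: measurable_funM => //; apply: mc.
  by rewrite tu (le_trans us).
move=> e; apply/within_exp_mul/within_cst_add/continuous_subspaceT => u.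
by apply: cvgB; [exact: cpath_cont|exact: cvg_cst].
Qed.

Lemma measurable_radius_cylinder z n s B : (forall j, t <= s j <= T) ->
  (forall j, measurable (B j)) ->
  <<s past_events (@cpath_coord R nL) T >> (radius_cylinder z n s B).
Proof.
move=> sT mB; suff : @measurable _ path_sigma (radius_cylinder z n s B) by [].
rewrite [radius_cylinder _ _ _ _](_ : _ = \bigcap_j if (j < n)%N then
    (fun e : path_sigma => radius g t z e (s j)) @^-1` B j else setT).
  apply: bigcapT_measurable => j; case: ifP => // _.
  by rewrite -[X in measurable X]setTI; exact: (measurable_radius z (sT j) measurableT (mB j)).
apply/seteqP; split => e h; first by move=> j _; case: ifP => // /h.
by move=> j jn; have := h j I; rewrite jn.
Qed.

Context d (Om : measurableType d) (P : probability Om R) (W : R -> Om -> 'cV[R]_nL).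
Variables (b : brownian P W) (i0 : 'I_nL).

Definition same_radial_law z z' := forall n s B, (forall j, t <= s j <= T) ->
  (forall j, measurable (B j)) ->
  P (brownian_cpath b @^-1` radius_cylinder z n s B) =
  P (brownian_cpath b @^-1` radius_cylinder z' n s B).

(** Starting from [f z] with the noise transformed by [f] gives the same radius as starting from [z]
    with the original noise, and the transformed noise has the same law. *)
Lemma same_radial_law_iso (f : 'cV[R]_nL -> 'cV[R]_nL) z :
  brownian P (fun s w => f (W s w)) ->
  (forall v, enorm (f v) = enorm v) ->
  (forall s (e : R -> 'cV[R]_nL), (forall i, {within `[t, s], continuous (fun u => e u i 0)}) ->
    driven g t (f z) (f \o e) s = f (driven g t z e s)) ->
  same_radial_law z (f z).
Proof.
move=> bf fn fd n s B sT mB.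
have T0 : 0 <= T by rewrite (le_trans t0).
have [_ _ <-] := brownian_path_law i0 bf b T0
  (measurable_radius_cylinder (f z) n sT mB).
congr (P _); apply/seteqP; split => w h j jn; have := h j jn;
rewrite /radius (fd (s j) (brownian_cpath b w)) ?fn// => i;
by apply: continuous_subspaceT; exact: cpath_cont.
Qed.

Lemma same_radial_law_trans y x z :
  same_radial_law x y -> same_radial_law y z -> same_radial_law x z.
Proof. by move=> h1 h2 n s B sT mB; exact: (etrans (h1 n s B sT mB) (h2 n s B sT mB)). Qed.

Definition axis (r : R) : 'cV[R]_nL := \col_i if i == i0 then r else 0.

Lemma enorm_axis r : 0 <= r -> enorm (axis r) = r.
Proof.
move=> r0; rewrite /enorm (bigD1 i0)//= big1 ?mxE ?eqxx ?addr0 ?sqrtr_sqr ?ger0_norm//.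
by move=> i /negbTE ii0; rewrite mxE ii0 expr0n.
Qed.

(** Induction on the number of nonzero coordinates other than [i0]: a plane rotation annihilates one
    of them. What remains lies on the axis, up to a reflection. *)
Lemma same_radial_law_axis z : same_radial_law z (axis (enorm z)).
Proof.
have [n] := ubnP #|[pred i | (i != i0) && (z i 0 != 0)]|.
elim: n z => // n IH z; rewrite ltnS => zn.
have [/existsP[i /andP[ii0 zi0]]|] := boolP [exists i, (i != i0) && (z i 0 != 0)].
  pose h := Num.sqrt (z i0 0 ^+ 2 + z i 0 ^+ 2).
  have h2 : h ^+ 2 = z i0 0 ^+ 2 + z i 0 ^+ 2 by rewrite sqr_sqrtr// addr_ge0// sqr_ge0.
  have h0 : h != 0.
    by rewrite gt_eqF// sqrtr_gt0 ltr_wpDl ?sqr_ge0// lt_neqAle eq_sym sqrf_eq0 zi0 sqr_ge0.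
  (* This rotation carries the coordinates ([i0], [i]) to (h, 0); its sine is nonzero because the
     coordinate [i] of [z] is. *)
  pose c := z i0 0 / h; pose s := - z i 0 / h.
  have s0 : s != 0 by rewrite mulf_neq0 ?oppr_eq0 ?invr_eq0.
  have cs : c ^+ 2 + s ^+ 2 = 1.
    by rewrite /c /s mulNr sqrrN !expr_div_n -mulrDl -h2 divff// sqrf_eq0.
  have i0i : i0 != i by rewrite eq_sym.
  apply: (@same_radial_law_trans (rot_coords i0 i c s z)).
    apply: same_radial_law_iso => [|v|u e ce].
    - exact: brownian_rot.
    - exact: enorm_rot.
    - exact: driven_rot.
  rewrite -(enorm_rot z i0i cs); apply: IH; apply: leq_trans zn.
  apply: proper_card; apply/properP; split.
    apply/fintype.subsetP => k; rewrite !inE rot_coordsE => /andP[ki0 H]; rewrite ki0 /=.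
    by move: H; rewrite (negbTE ki0); case: (eqVneq k i) => [->|].
  exists i; rewrite !inE ?ii0// rot_coordsE (negbTE ii0) eqxx /=.
  have -> : s * z i0 0 + c * z i 0 = 0 by rewrite /s /c; ring.
  by rewrite eqxx.
rewrite negb_exists => /forallP z0.
have zE i : i != i0 -> z i 0 = 0.
  by move=> ii0; have := z0 i; rewrite ii0 negbK => /eqP.
have nz : enorm z = `|z i0 0|.
  rewrite /enorm (bigD1 i0)//= big1 ?addr0 ?sqrtr_sqr// => i /zE ->.
  by rewrite expr0n.
have [zp|zn0] := leP 0 (z i0 0).
  rewrite (_ : axis _ = z)//; apply/matrixP => i j; rewrite ord1 mxE nz ger0_norm//.
  by case: eqP => [->//|/eqP /zE].
rewrite (_ : axis _ = flip_coord i0 z); last first.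
  apply/matrixP => i j; rewrite ord1 flip_coordE mxE nz ltr0_norm//.
  by case: eqP => [->//|/eqP /zE].
apply: same_radial_law_iso => [|v|u e ce].
- exact: brownian_flip.
- exact: enorm_flip.
- exact: driven_flip.
Qed.

Lemma radial_law z z' : enorm z = enorm z' -> same_radial_law z z'.
Proof.
move=> zz'; apply: (same_radial_law_trans (same_radial_law_axis z)).
by rewrite zz' => n s B sT mB; exact: (esym (same_radial_law_axis z' n sT mB)).
Qed.

End rotation_invariance.

(** * Solutions of the Ornstein-Uhlenbeck equation *)

Section ornstein_uhlenbeck.
Context {R : realType} {nG nL nc : nat} (M : market R nG nL nc).
Notation mu := (@lebesgue_measure R).
Hypothesis sigma_unit : sigma M \in unitmx.

Lemma within_lincomb (A : set R) n (r : seq 'I_n) (c : 'I_n -> R) (f : 'I_n -> R -> R) :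
  (forall k, {within A, continuous (f k)}) ->
  {within A, continuous (fun u => \sum_(k <- r) c k * f k u)}.
Proof.
move=> cf; elim: r => [|k s IH].
  rewrite (_ : (fun u => _) = cst 0); first by move=> x; exact: cvg_cst.
  by apply/funext => u; rewrite big_nil.
rewrite (_ : (fun u => _) = fun u => c k * f k u + \sum_(k <- s) c k * f k u).
  by move=> x; apply: cvgD; [apply: cvgM; [exact: cvg_cst|exact: cf]|exact: IH].
by apply/funext => u; rewrite big_cons.
Qed.

Lemma Rintegral_lincomb a b n (c : 'I_n -> R) (f : 'I_n -> R -> R) :
  (forall k, {within `[a, b], continuous (f k)}) ->
  \int[mu]_(u in `[a, b]) (\sum_k c k * f k u) =
  \sum_k c k * \int[mu]_(u in `[a, b]) f k u.
Proof.
move=> cf.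
have mI : measurable (`[a, b]%classic : set (measurableTypeR R)) by [].
elim: (index_enum _) => [|k s IH].
  rewrite big_nil; have -> : (fun u => \sum_(k <- [::]) c k * f k u) = cst 0.
    by apply/funext => u; rewrite big_nil.
  by rewrite Rintegral_cst// mul0r.
rewrite big_cons -IH -(RintegralZl _ mI); last exact: continuous_integrable_itv.
rewrite -RintegralD//.
- by apply: eq_Rintegral => u _; rewrite big_cons.
- apply: continuous_integrable_itv => x; apply: cvgM; [exact: cvg_cst|exact: cf].
- exact/continuous_integrable_itv/within_lincomb.
Qed.

Lemma driven_eq g t z (e e' : R -> 'cV[R]_nL) s : t <= s ->
  {in `[t, s], e =1 e'} -> driven g t z e s = driven g t z e' s.
Proof.
move=> ts ee'; apply/matrixP => i j; rewrite !mxE /damped !ee' ?in_itv/= ?lexx ?ts//.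
congr (_ - _ * (_ * _)); apply: eq_Rintegral => u; rewrite inE => us.
by rewrite !ee' ?in_itv/= ?lexx ?ts.
Qed.

(** As gamma is a scalar, applying sigma^-1 decouples the system into one linear integral equation
    per coordinate. *)
Lemma ou_path (z : 'cV[R]_nL) (t : R) (Zp Wp : R -> 'cV[R]_nL) :
  (forall i, {within `[t, T M], continuous (fun s => Zp s i 0)}) ->
  {in `[t, T M], forall s, Zp s = z
        - gamma M *: (\col_i \int[mu]_(u in `[t, s]) Zp u i 0)
        + sigma M *m (Wp s - Wp t)} ->
  {in `[t, T M], forall s, invmx (sigma M) *m Zp s =
     driven (gamma M) t (invmx (sigma M) *m z) Wp s}.
Proof.
move=> cZ Ze s sT; apply/matrixP => i j; rewrite ord1 [RHS]mxE.
have UE u : (invmx (sigma M) *m Zp u) i 0 = \sum_k invmx (sigma M) i k * Zp u k 0.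
  by rewrite mxE.
apply: (@damped_solution _ (gamma M) t (T M) (fun u => (invmx (sigma M) *m Zp u) i 0)) => //.
  rewrite (_ : (fun u => _) = fun u => \sum_k invmx (sigma M) i k * Zp u k 0).
    exact: within_lincomb.
  by apply/funext.
move=> {sT}u uT; rewrite {1}Ze//.
have /andP[tu uT'] : t <= u <= T M by move: uT; rewrite in_itv.
rewrite mulmxDr mulmxBr mulKmx// -scalemxAr !mxE addrAC; congr (_ - _ * _).
under [RHS]eq_Rintegral do rewrite UE.
rewrite Rintegral_lincomb => [|k]; first by apply: eq_bigr => k _; rewrite mxE.
exact: (within_subitv (lexx t) uT' (cZ k)).
Qed.

Context d (Om : measurableType d) (P : probability Om R) (W : R -> Om -> 'cV[R]_nL).
Variable Z : R -> 'cV[R]_nL -> R -> Om -> 'cV[R]_nL.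
Hypothesis hZ : forall t z, 0 <= t <= T M -> OU_solution M W t z (Z t z).

Lemma ou_driven t z s w : 0 <= t <= T M -> t <= s <= T M ->
  invmx (sigma M) *m Z t z s w = driven (gamma M) t (invmx (sigma M) *m z) (W ^~ w) s.
Proof.
move=> tT sT; have [cZ Ze] := hZ z tT w.
by apply: (ou_path cZ Ze); rewrite in_itv.
Qed.

Lemma ou_radius (b : brownian P W) t z s w : 0 <= t <= T M -> t <= s <= T M ->
  enorm (invmx (sigma M) *m Z t z s w) =
  radius (gamma M) t (invmx (sigma M) *m z) (brownian_cpath b w) s.
Proof.
move=> tT /andP[ts sT]; rewrite ou_driven ?ts// /radius; congr enorm.
apply: driven_eq => // u; rewrite in_itv/= => /andP[tu _].
by rewrite max_r// (le_trans _ tu)//; case/andP: tT.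
Qed.

(* All the solutions are driven by the same noise, so the one restarted at [t]
   is an affine function of the one started at time 0. *)
Lemma ou_restart (b : brownian P W) t z z0 s w : 0 <= t <= T M -> t <= s <= T M ->
  invmx (sigma M) *m Z t z s w = invmx (sigma M) *m Z 0 z0 s w +
  damped (gamma M) t (fun=> 1) s *: (invmx (sigma M) *m z - invmx (sigma M) *m Z 0 z0 t w).
Proof.
move=> tT sT; rewrite ou_driven//.
have /andP[t0 tT'] := tT; have /andP[ts sT'] := sT.
have T0 : 0 <= T M by exact: le_trans tT'.
have [cZ Ze] := hZ z0 (introT andP (conj (lexx 0) T0)) w.
have cW i : {within `[t, s], continuous (fun u => W u w i 0)}.
  have [_ _ cW _] := b; apply: continuous_subspaceW (cW w i) => u /=.
  by rewrite !in_itv/= andbT => /andP[tu _]; rewrite (le_trans t0).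
(* Flow property: from t on, the solution started at time 0 solves the equation with its value at t
   as initial condition. *)
have -> : invmx (sigma M) *m Z 0 z0 s w =
    driven (gamma M) t (invmx (sigma M) *m Z 0 z0 t w) (W ^~ w) s.
  apply: (@ou_path (Z 0 z0 t w) t (Z 0 z0 ^~ w) (W ^~ w)); rewrite ?in_itv//.
    by move=> i; exact: (within_subitv t0 (lexx _) (cZ i)).
  move=> u; rewrite in_itv/= => /andP[tu uT].
  rewrite Ze ?in_itv/= ?(le_trans t0)// [in RHS]Ze ?in_itv/= ?t0//.
  rewrite (_ : W u w - W 0 w = (W u w - W t w) + (W t w - W 0 w)); last by rewrite addrA subrK.
  rewrite [sigma M *m (_ + (W t w - _))]mulmxDr; apply/matrixP => i j; rewrite !mxE.
  have -> : \int[mu]_(v in `[0, u]) Z 0 z0 v w i 0 =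
      \int[mu]_(v in `[0, t]) Z 0 z0 v w i 0 + \int[mu]_(v in `[t, u]) Z 0 z0 v w i 0.
    have ci : mu.-integrable `[0, u] (EFin \o (fun v => Z 0 z0 v w i 0)).
      by apply: continuous_integrable_itv; apply: (within_subitv (lexx _) uT (cZ i)).
    rewrite -[X in _ + X]Rintegral_itv_obnd_cbnd; last first.
      apply: (integrableS _ _ _ ci) => // v /=; rewrite !in_itv/= => /andP[tv ->].
      by rewrite (le_trans t0)//ltW.
    by rewrite -(Rintegral_itvB ci) ?bnd_simp// addrC subrK.
  ring.
(* Both sides now have the same noise and the initial values enter linearly; the factor
   [damped (gamma M) t (fun=> 1) s] is e^{-gamma (s - t)}. *)
move: (invmx (sigma M) *m z) (invmx (sigma M) *m Z 0 z0 t w) => v v0.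
apply/matrixP => i j; rewrite ord1 !mxE.
have c1 : {within `[t, s], continuous (fun u => v0 i 0 + (W u w i 0 - W t w i 0))}.
  by apply: within_cst_add => x; apply: cvgB; [exact: cW|exact: cvg_cst].
have c2 : {within `[t, s], continuous (fun _ : R => 1 : R)} by move=> x; exact: cvg_cst.
rewrite (_ : (fun u => v i 0 + _) =
    fun u => 1 * (v0 i 0 + (W u w i 0 - W t w i 0)) + (v i 0 - v0 i 0) * 1); last first.
  by apply/funext => u; ring.
by rewrite (damped_lin _ _ _ c1 c2); ring.
Qed.

End ornstein_uhlenbeck.

(** * Radial bound on the cost of load shedding *)

Section euclidean_norm.
Context {R : realType}.

Lemma sum_sqr_ge0 n (v : 'cV[R]_n) : 0 <= \sum_i v i 0 ^+ 2.
Proof. by apply: sumr_ge0 => i _; exact: sqr_ge0. Qed.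

Lemma enorm_sqr n (v : 'cV[R]_n) : enorm v ^+ 2 = \sum_i v i 0 ^+ 2.
Proof. by rewrite sqr_sqrtr// sum_sqr_ge0. Qed.

Lemma enormZ n a (v : 'cV[R]_n) : enorm (a *: v) = `|a| * enorm v.
Proof.
rewrite /enorm -sqrtr_sqr -sqrtrM ?sqr_ge0//; congr Num.sqrt.
by rewrite mulr_sumr; apply: eq_bigr => i _; rewrite mxE exprMn.
Qed.

Lemma enorm_eq0 n (v : 'cV[R]_n) : enorm v = 0 -> v = 0.
Proof.
move=> /eqP; rewrite sqrtr_eq0 => v0; apply/matrixP => i j; rewrite ord1 mxE.
apply/eqP; rewrite -sqrf_eq0 eq_le sqr_ge0 andbT (le_trans _ v0)//.
by rewrite (bigD1 i)//= lerDl sumr_ge0// => k _; exact: sqr_ge0.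
Qed.

Lemma enorm0 n : enorm (0 : 'cV[R]_n) = 0.
Proof. by rewrite -[0](scale0r 0) enormZ normr0 mul0r. Qed.

Lemma enormN n (v : 'cV[R]_n) : enorm (- v) = enorm v.
Proof. by rewrite -scaleN1r enormZ normrN1 mul1r. Qed.

(** Cauchy-Schwarz, from the nonnegativity of the squared norm of |v| u - |u| v. *)
Lemma dotp_le_enorm n (u v : 'cV[R]_n) : dotp u v <= enorm u * enorm v.
Proof.
have [u0|u0] := eqVneq (enorm u) 0.
  rewrite u0 mul0r (enorm_eq0 u0) /dotp big1// => i _; by rewrite mxE mul0r.
have [v0|v0] := eqVneq (enorm v) 0.
  rewrite v0 mulr0 (enorm_eq0 v0) /dotp big1// => i _; by rewrite mxE mulr0.
have up : 0 < enorm u by rewrite lt_neqAle eq_sym u0 enorm_ge0.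
have vp : 0 < enorm v by rewrite lt_neqAle eq_sym v0 enorm_ge0.
have : 0 <= \sum_i (enorm v * u i 0 - enorm u * v i 0) ^+ 2.
  by apply: sumr_ge0 => i _; exact: sqr_ge0.
have -> : \sum_i (enorm v * u i 0 - enorm u * v i 0) ^+ 2 =
    enorm v ^+ 2 * enorm u ^+ 2 + enorm u ^+ 2 * enorm v ^+ 2
    - 2 * enorm u * enorm v * dotp u v.
  rewrite [X in _ * X + _]enorm_sqr [X in _ + _ * X]enorm_sqr /dotp !mulr_sumr.
  by rewrite -big_split -sumrB; apply: eq_bigr => i _ /=; ring.
move=> h; rewrite -(ler_pM2l (mulr_gt0 up vp)).
by move: h; set a := enorm u; set b := enorm v; set c := dotp u v; nra.
Qed.

Lemma enorm_triangle n (u v : 'cV[R]_n) : enorm (u + v) <= enorm u + enorm v.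
Proof.
rewrite -(@ler_pXn2r _ 2)// ?nnegrE ?addr_ge0 ?enorm_ge0//.
have -> : enorm (u + v) ^+ 2 = enorm u ^+ 2 + enorm v ^+ 2 + 2 * dotp u v.
  rewrite !enorm_sqr /dotp mulr_sumr -!big_split; apply: eq_bigr => i _ /=.
  by rewrite mxE; ring.
by rewrite sqrrD; have := dotp_le_enorm u v; nra.
Qed.

Lemma coord_le_enorm n (v : 'cV[R]_n) i : `|v i 0| <= enorm v.
Proof.
rewrite -sqrtr_sqr ler_sqrt ?sum_sqr_ge0// (bigD1 i)//= lerDl sumr_ge0// => k _.
exact: sqr_ge0.
Qed.

Lemma cvg_mxP (T : Type) (F : set_system T) {FF : Filter F} m n (f : T -> 'M[R]_(m, n)) (l : 'M[R]_(m, n)) :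
  (forall i j, f x i j @[x --> F] --> l i j) -> f x @[x --> F] --> l.
Proof.
move=> h; apply/cvg_ballP => e e0.
have : \forall x \near F, forall i j, ball (l i j) e (f x i j).
  apply: filter_forall => i; apply: filter_forall => j.
  by have /cvg_ballP/(_ e e0) := h i j.
by apply: filterS => x hx; split.
Qed.

Lemma cvg_sumr (T : Type) (F : set_system T) {FF : Filter F} n (f : 'I_n -> T -> R) (l : 'I_n -> R) :
  (forall i, f i x @[x --> F] --> l i) ->
  \sum_i f i x @[x --> F] --> \sum_i l i.
Proof. by move=> h; apply: (cvg_big (op := +%R)) => // x; exact: add_continuous. Qed.

Lemma cvg_mulcr (T : Type) (F : set_system T) {FF : Filter F} (f : T -> R) (l c : R) :
  f x @[x --> F] --> l -> c * f x @[x --> F] --> c * l.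
Proof. by move=> h; apply: cvgM => //; exact: cvg_cst. Qed.

Lemma cvg_sqr (T : Type) (F : set_system T) {FF : Filter F} (f : T -> R) (l : R) :
  f x @[x --> F] --> l -> f x ^+ 2 @[x --> F] --> l ^+ 2.
Proof. by move=> h; under eq_fun do rewrite expr2; rewrite expr2; exact: cvgM. Qed.

Section cvg_vector.
Context (T : Type) (F : set_system T) {FF : Filter F}.

Lemma cvg_enorm n (f : T -> 'cV[R]_n) (l : 'cV[R]_n) :
  (forall i, f x i 0 @[x --> F] --> l i 0) -> enorm (f x) @[x --> F] --> enorm l.
Proof.
move=> h; have h2 : \sum_i f x i 0 ^+ 2 @[x --> F] --> \sum_i l i 0 ^+ 2.
  by apply: cvg_sumr => i; exact: cvg_sqr.
apply: (cvg_comp _ _ h2); exact: sqrt_continuous.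
Qed.

Lemma cvg_mulmxl m n p (A : 'M[R]_(m, n)) (f : T -> 'M[R]_(n, p)) (l : 'M[R]_(n, p)) :
  (forall i j, f x i j @[x --> F] --> l i j) -> A *m f x @[x --> F] --> A *m l.
Proof.
move=> h; apply: cvg_mxP => i j; under eq_fun do rewrite mxE; rewrite mxE.
by apply: cvg_sumr => k; exact: cvg_mulcr.
Qed.
End cvg_vector.

Lemma continuous_enorm n : continuous (@enorm R n).
Proof.
move=> x; have h i : v i 0 @[v --> x] --> x i 0 by exact: coord_continuous.
exact: (@cvg_enorm _ (nbhs x) (nbhs_filter x) n id x h).
Qed.

Lemma continuous_mulmxl m n p (A : 'M[R]_(m, n)) :
  continuous (fun v : 'M[R]_(n, p) => A *m v).
Proof.
move=> x; have h i j : v i j @[v --> x] --> x i j by exact: coord_continuous.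
exact: (@cvg_mulmxl _ (nbhs x) (nbhs_filter x) m n p A id x h).
Qed.

Lemma cV_compact n (A : 'I_n -> set R) : (forall i, compact (A i)) ->
  compact [set v : 'cV[R]_n | forall i, A i (v i 0)].
Proof.
move=> cA.
rewrite (_ : [set v | _] = (@trmx R 1 n) @` [set v : 'rV[R]_n | forall i, A i (v ord0 i)]).
  apply: continuous_compact; last exact: rV_compact.
  apply: continuous_subspaceT => x.
  have h i j : v^T i j @[v --> x] --> x^T i j.
    under eq_fun do rewrite mxE; rewrite mxE.
    have : v j i @[v --> x] --> x j i by exact: coord_continuous.
    by [].
  exact: (@cvg_mxP _ (nbhs x) (nbhs_filter x) _ _ (fun v : 'rV[R]_n => v^T) _ h).
apply/seteqP; split => v.
  move=> h; exists v^T; last by rewrite trmxK.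
  by move=> i /=; rewrite mxE; exact: h.
by move=> [u hu <-] i /=; rewrite mxE.
Qed.

Lemma compact_enorm_ball n (r : R) : compact [set v : 'cV[R]_n | enorm v <= r].
Proof.
apply: (@subclosed_compact _ _ [set v : 'cV[R]_n | forall i, `[- r, r]%classic (v i 0)]).
- rewrite [X in closed X](_ : _ = (@enorm R n) @^-1` [set x | x <= r])//.
  exact: (@preimage_closed _ _ (@enorm R n) _ (fun x _ => @continuous_enorm n x) (@closed_le R r)).
- exact: (@cV_compact n (fun=> `[- r, r]%classic) (fun=> @segment_compact R (- r) r)).
- move=> v vr i /=; rewrite in_itv/= -ler_norml.
  exact: le_trans (coord_le_enorm v i) vr.
Qed.

Lemma compact_bounded_above (X : topologicalType) (A : set X) (f : X -> R) :
  compact A -> {within A, continuous f} -> exists B, forall x, A x -> f x <= B.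
Proof.
move=> cA cf; have /compact_bounded[B [_ hB]] := continuous_compact cf cA.
exists (B + 1) => x Ax; apply: le_trans (ler_norm _) _.
by apply: (hB (B + 1)); [rewrite ltrDl|exists x].
Qed.

(** If the path avoided the boundary, the times at which it lies in [G] would be both open and
    closed in [0, 1], hence fill it. *)
Lemma boundary_crossing (X : topologicalType) (G : set X) (p : R -> X) :
  closed G -> continuous p -> G (p 0) -> ~ (G° (p 1)) ->
  exists2 l, 0 <= l <= 1 & boundary G (p l).
Proof.
move=> cG cp G0 G1; apply: contrapT => nb.
have Gint l : 0 <= l <= 1 -> G (p l) -> G° (p l).
  move=> l01 Gl; apply: contrapT => nG; apply: nb; exists l => //.
  by split => //; exact: subset_closure.
pose A := p @^-1` G.
have E : `[0, 1]%classic `&` A = `[0, 1]%classic.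
  apply: (@segment_connected R 0 1).
  - by exists 0; split => //=; rewrite in_itv/= lexx ler01.
  - exists (p @^-1` G°).
      by apply: open_comp; [move=> x _; exact: cp|exact: open_interior].
    apply/seteqP; split => l [] l01; rewrite /A/= => h; split => //.
      by apply: Gint => //; move: l01; rewrite /= in_itv.
    exact: interior_subset.
  - by exists A => //; apply: (preimage_closed _ cG) => x _; exact: cp.
have [_ A1] : (`[0, 1]%classic `&` A) 1 by rewrite E /= in_itv/= ler01 lexx.
by apply: G1; apply: Gint => //; rewrite ler01 lexx.
Qed.

End euclidean_norm.

Section convex_interior.
Context {R : realType} {V : normedModType R}.

Lemma convex_setP (G : set V) : convex_set (G : set (convex_lmodType V)) ->
  forall x y l, 0 <= l <= 1 -> G x -> G y -> G (l *: x + (1 - l) *: y).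
Proof.
move=> cG x y l /andP[l0 l1] Gx Gy.
have := cG x y (Itv01 l0 l1); rewrite !inE => /(_ Gx Gy).
by [].
Qed.

Lemma convex_interior (G : set V) x y l :
  (forall x y l, 0 <= l <= 1 -> G x -> G y -> G (l *: x + (1 - l) *: y)) ->
  G x -> G° y -> 0 < l <= 1 -> G° (l *: y + (1 - l) *: x).
Proof.
move=> cG Gx Gy /andP[l0 l1].
(* The inverse of the homothety of centre [x] and ratio [l]: the preimage of a neighbourhood of [y]
   is a neighbourhood of the given point. *)
pose h z := l^-1 *: (z - (1 - l) *: x).
have ch : continuous h.
  by move=> z; apply: cvgZr; apply: cvgB; [exact: cvg_id|exact: cvg_cst].
have hy : h (l *: y + (1 - l) *: x) = y.
  by rewrite /h addrK scalerA mulVf ?scale1r// gt_eqF.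
rewrite /interior/=; have := ch (l *: y + (1 - l) *: x) G; rewrite hy => /(_ Gy).
rewrite nbhs_simpl /=; apply: filterS => z hz.
have -> : z = l *: h z + (1 - l) *: x.
  by rewrite /h scalerA mulfV ?gt_eqF// scale1r subrK.
by apply: cG => //; rewrite ltW.
Qed.
End convex_interior.

Lemma cvg_pair_nbhs (T : Type) (F : set_system T) {FF : Filter F} (U V : topologicalType)
    (f : T -> U) (h : T -> V) (a : U) (b : V) :
  f x @[x --> F] --> a -> h x @[x --> F] --> b -> (f x, h x) @[x --> F] --> (a, b).
Proof. by move=> fa hb; exact: cvg_pair. Qed.

(** * Signed distance to the boundary of a feasible set *)

Section signed_distance.
Context {R : realType} {nG nL : nat} (S : 'M[R]_nL) (G : set ('cV[R]_nG * 'cV[R]_nL)).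
Implicit Types (u p : 'cV[R]_nL) (g : 'cV[R]_nG).

Definition sdist0 u p := enorm (invmx S *m (p - u)).

Definition bdist u g : R :=
  inf [set sdist0 u p | p in [set p | boundary G (g, p)]].

Definition sdist u g : R := if `[< G (g, u) >] then bdist u g else - bdist u g.

Hypotheses (cG : closed G) (kG : compact G) (Su : S \in unitmx).
Hypothesis (nL0 : (0 < nL)%N).
Hypothesis cvG : forall x y l, 0 <= l <= 1 -> G x -> G y -> G (l *: x + (1 - l) *: y).

Lemma sdist0_ge0 u p : 0 <= sdist0 u p. Proof. exact: enorm_ge0. Qed.

Lemma sdist0_line u p l : sdist0 u (u + l *: (p - u)) = `|l| * sdist0 u p.
Proof. by rewrite /sdist0 addrAC subrr add0r -scalemxAr enormZ. Qed.

Lemma sdist0C u p : sdist0 u p = sdist0 p u.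
Proof. by rewrite /sdist0 -opprB mulmxN enormN. Qed.

Lemma sdist0_triangle p u v : sdist0 u v <= sdist0 u p + sdist0 p v.
Proof.
rewrite /sdist0 (_ : v - u = (p - u) + (v - p)); last by rewrite [RHS]addrC addrA subrK.
by rewrite mulmxDr enorm_triangle.
Qed.

Lemma boundary_sub x : boundary G x -> G x.
Proof. by move=> [/cG]. Qed.

Lemma slice_crossing g p1 p2 : G (g, p1) -> ~ G° (g, p2) ->
  exists2 l, 0 <= l <= 1 & boundary G (g, p1 + l *: (p2 - p1)).
Proof.
move=> G1 G2; apply: (@boundary_crossing _ _ G (fun l => (g, p1 + l *: (p2 - p1)))) => //.
- move=> l.
  have h : p1 + l' *: (p2 - p1) @[l' --> l] --> p1 + l *: (p2 - p1).
    by apply: cvgD; [exact: cvg_cst|apply: cvgZr_tmp; exact: cvg_id].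
  have h0 : g @[_ --> l] --> g by exact: cvg_cst.
  exact: (cvg_pair_nbhs h0 h).
- by rewrite scale0r addr0.
- by rewrite scale1r addrC subrK.
Qed.

(** Compactness bounds a coordinate on [G], so some segment inside the slice leaves [G] and has to
    cross its boundary. *)
Lemma boundary_slice_nonempty g p1 : G (g, p1) -> exists p, boundary G (g, p).
Proof.
move=> G1; pose i0 := Ordinal nL0.
have [B hB] : exists B, forall x, G x -> x.2 i0 0 <= B.
  apply: compact_bounded_above => //; apply: continuous_subspaceT => x.
  apply: (@continuous_comp _ _ _ snd (fun v : 'cV[R]_nL => v i0 0)); first exact: cvg_snd.
  exact: coord_continuous.
have G2 : ~ G° (g, const_mx (B + 1)).
  by move=> /interior_subset/hB /=; rewrite mxE gerDl ler10.
by have [l _ b] := slice_crossing G1 G2; eexists; exact: b.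
Qed.

Lemma bdist_lb u g : has_lbound [set sdist0 u p | p in [set p | boundary G (g, p)]].
Proof. by exists 0 => _ [p _ <-]; exact: sdist0_ge0. Qed.

Lemma bdist_le u g p : boundary G (g, p) -> bdist u g <= sdist0 u p.
Proof. by move=> b; apply: (ge_inf (bdist_lb u g)); exists p. Qed.

Lemma bdist_ge0 u g : 0 <= bdist u g.
Proof.
rewrite /bdist; set E := [set _ | _ in _].
have [->|/set0P E0] := eqVneq E set0; first by rewrite inf0.
by apply: lb_le_inf => // _ [p _ <-]; exact: sdist0_ge0.
Qed.

Lemma interior_within_bdist u g p : G (g, u) -> sdist0 u p < bdist u g -> G° (g, p).
Proof.
move=> Gu up; apply: contrapT => np.
have [l /andP[l0 l1] /(bdist_le u)] := slice_crossing Gu np.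
rewrite sdist0_line ger0_norm// leNgt => /negP; apply; apply: le_lt_trans up.
by rewrite ler_piMl// sdist0_ge0.
Qed.

(** If [u] is feasible, so is every point of the slice that is closer to [u] than the boundary, and
    one goes from [u] towards [x] almost that far. Otherwise one takes an almost nearest boundary
    point; the negative sign of [sdist] pays for the detour through it. *)
Lemma slice_reach u g p1 x e : G (g, p1) -> 0 < e ->
  exists2 p, G (g, p) & sdist0 p x <= Num.max 0 (sdist0 u x - sdist u g) + e.
Proof.
move=> G1 e0; rewrite /sdist; case: asboolP => [Gu|nGu].
  set b := bdist u g; set y := sdist0 u x.
  have [yb|by_] := ltP y b.
    exists x; first exact: (interior_subset (interior_within_bdist Gu yb)).
    by rewrite {1}/sdist0 subrr mulmx0 enorm0; apply: addr_ge0; [rewrite le_max lexx|exact: ltW].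
  have b0 := bdist_ge0 u g; rewrite -/b in b0.
  rewrite max_r ?subr_ge0//.
  have [b_le0|b_gt0] := leP b 0.
    by exists u => //; rewrite -/y; lra.
  (* Only points strictly closer than [b] are known to be feasible, hence a step of length [b - e'];
     [e' <= b] keeps it nonnegative. *)
  pose e' := Num.min e b.
  have e'0 : 0 < e' by rewrite lt_min e0.
  have e'b : e' <= b by rewrite ge_min lexx orbT.
  have e'e : e' <= e by rewrite ge_min lexx.
  have y0 : 0 < y by exact: lt_le_trans by_.
  pose l := (b - e') / y.
  have l0 : 0 <= l by rewrite divr_ge0 ?subr_ge0// ltW.
  have ly : l * y = b - e' by rewrite divfK// gt_eqF.
  have l1 : l <= 1 by rewrite ler_pdivrMr// mul1r; lra.
  exists (u + l *: (x - u)).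
    apply: interior_subset; apply: (interior_within_bdist Gu).
    by rewrite sdist0_line ger0_norm// -/y -/b ly; lra.
  rewrite sdist0C (_ : u + l *: (x - u) = x + (1 - l) *: (u - x)); last first.
    by apply/matrixP => i j; rewrite !mxE; ring.
  rewrite sdist0_line ger0_norm ?subr_ge0// sdist0C -/y mulrBl mul1r ly; lra.
have [q bq] := boundary_slice_nonempty G1.
have hi : has_inf [set sdist0 u p | p in [set p | boundary G (g, p)]].
  by split; [exists (sdist0 u q), q|exact: bdist_lb].
have [_ [p bp <-]] := inf_adherent e0 hi; rewrite -/(bdist u g) => pe.
exists p; first exact: boundary_sub.
have := sdist0_triangle u p x; have := bdist_ge0 u g; have := sdist0_ge0 u x.
rewrite (sdist0C p u) opprK max_r; last by have := bdist_ge0 u g; have := sdist0_ge0 u x; lra.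
lra.
Qed.

(** For [r >= 0] a closed ball of the slice of radius larger than [r] lies in the interior of [G],
    and by compactness still does after small changes of centre and slice. For [r < 0] one interior
    point closer than [- r] survives such changes and bounds the distance to the boundary. *)
Lemma sdist_lsc u0 g0 r : (exists2 p, G (g0, p) & G° (g0, p)) -> r < sdist u0 g0 ->
  \forall x \near nbhs (u0, g0), r < sdist x.1 x.2.
Proof.
move=> [pi Gpi intpi] rd.
have cpt (y : 'cV[R]_nL * ('cV[R]_nL * 'cV[R]_nG)) :
    (z.2.2, z.2.1 + S *m z.1) @[z --> y] --> (y.2.2, y.2.1 + S *m y.1).
  have h1 : z.2.2 @[z --> y] --> y.2.2.
    by apply: (@cvg_comp _ _ _ snd snd _ (nbhs y.2)); exact: cvg_snd.
  have h2 : z.2.1 @[z --> y] --> y.2.1.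
    by apply: (@cvg_comp _ _ _ snd fst _ (nbhs y.2)); [exact: cvg_snd|exact: cvg_fst].
  have h3 : S *m z.1 @[z --> y] --> S *m y.1.
    by apply: (@cvg_comp _ _ _ fst (mulmx S) _ (nbhs y.1)); [exact: cvg_fst|exact: continuous_mulmxl].
  exact: (cvg_pair_nbhs h1 (cvgD h2 h3)).
have [r0|r0] := leP 0 r.
  have Gu : G (g0, u0).
    apply: contrapT => nGu; move: rd; rewrite /sdist asboolF// ltNge => /negP; apply.
    by rewrite (le_trans _ r0)// oppr_le0 bdist_ge0.
  have rb : r < bdist u0 g0 by move: rd; rewrite /sdist asboolT.
  pose r' := (r + bdist u0 g0) / 2.
  have rr' : r < r' by rewrite /r'; lra.
  have r'b : r' < bdist u0 g0 by rewrite /r'; lra.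
  have kB := @compact_enorm_ball R nL r'.
  have := (compact_near_coveringP _).1 kB _ (nbhs (u0, g0))
    (fun x e => G° (x.2, x.1 + S *m e)) _.
  have hc e : enorm e <= r' -> \forall e' \near e & x \near (u0, g0), G° (x.2, x.1 + S *m e').
    move=> er'; apply: (cpt (e, (u0, g0)) G°); apply: nbhs_interior => /=.
    apply: (interior_within_bdist Gu).
    by rewrite /sdist0 addrAC subrr add0r mulKmx// (le_lt_trans er').
  move=> /(_ _ hc); apply: filterS => -[u g] /= hK.
  have Gug : G (g, u).
    by apply: interior_subset; have := hK 0; rewrite /= enorm0 mulmx0 addr0; apply; lra.
  rewrite /sdist asboolT; last exact: Gug.
  apply: (lt_le_trans rr').
  have [q bq] := boundary_slice_nonempty Gug.
  apply: lb_le_inf => [|_ [p bp <-]]; first by exists (sdist0 u q), q.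
  rewrite leNgt; apply/negP => pr'; case: bp => _; apply.
  have := hK (invmx S *m (p - u)); rewrite /= mulKVmx// (addrC u) subrK; apply.
  exact: ltW.
have [p Gp pe] : exists2 p, G (g0, p) & sdist0 u0 p < - r.
  have [Gu|nGu] := pselect (G (g0, u0)).
    by exists u0; rewrite // /sdist0 subrr mulmx0 enorm0; lra.
  have [q bq] := boundary_slice_nonempty Gpi.
  move: rd; rewrite /sdist asboolF// ltrNr => rd.
  have ne : [set sdist0 u0 p | p in [set p | boundary G (g0, p)]] !=set0.
    by exists (sdist0 u0 q), q.
  have [_ [p bp <-] pr] := inf_lt ne rd.
  by exists p => //; exact: boundary_sub.
(* By convexity a small move of [p] towards the interior point [pi] of the slice makes it interior;
   the move is short enough to keep the strict bound. *)
have [p' ip' pe'] : exists2 p, G° (g0, p) & sdist0 u0 p < - r.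
  have k0 := sdist0_ge0 p pi.
  pose k := (- r - sdist0 u0 p) / (sdist0 p pi + 1).
  have kp : 0 < k by rewrite divr_gt0//; lra.
  pose l := Num.min 1 k.
  have l01 : 0 < l <= 1 by rewrite lt_min ltr01 kp ge_min lexx.
  exists (l *: pi + (1 - l) *: p).
    have := convex_interior cvG Gp intpi l01.
    have -> // : l *: (g0, pi) + (1 - l) *: (g0, p) = (g0, l *: pi + (1 - l) *: p).
    by congr pair; apply/matrixP => i j; rewrite !mxE; ring.
  apply: le_lt_trans (sdist0_triangle p _ _) _.
  rewrite (_ : l *: pi + _ = p + l *: (pi - p)); last first.
    by apply/matrixP => i j; rewrite !mxE; ring.
  rewrite sdist0_line ger0_norm; last by case/andP: l01 => /ltW.
  have lk : l <= k by rewrite ge_min lexx orbT.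
  have kk : k * (sdist0 p pi + 1) = - r - sdist0 u0 p by rewrite divfK// gt_eqF//; lra.
  nra.
have h1 : \forall x \near (u0, g0), G° (x.2, p').
  have c1 : x.2 @[x --> (u0, g0)] --> g0 by exact: cvg_snd.
  have c2 : p' @[x --> (u0, g0)] --> p' by exact: cvg_cst.
  have c3 : (x.2, p') @[x --> (u0, g0)] --> (g0, p') by exact: (cvg_pair_nbhs c1 c2).
  have i2 : nbhs (g0, p') G° by exact: nbhs_interior.
  by have := c3 _ i2; rewrite nbhs_simpl.
have h2 : \forall x \near (u0, g0), sdist0 x.1 p' < - r.
  have c1 : p' - x.1 @[x --> (u0, g0)] --> p' - u0.
    by apply: cvgB; [exact: cvg_cst|exact: cvg_fst].
  have c2 : sdist0 x.1 p' @[x --> (u0, g0)] --> sdist0 u0 p'.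
    apply: (@cvg_comp _ _ _ (fun x => p' - x.1) (fun v => enorm (invmx S *m v)) _ (nbhs (p' - u0))) => //.
    apply: (@cvg_comp _ _ _ (mulmx (invmx S)) (@enorm R nL) _ (nbhs (invmx S *m (p' - u0)))).
      exact: continuous_mulmxl.
    exact: continuous_enorm.
  exact: (cvgr_lt _ c2).
near=> x.
have G1 : G (x.2, p') by apply: interior_subset; near: x.
have G2 : sdist0 x.1 p' < - r by near: x.
rewrite /sdist; case: asboolP => nGx; first by rewrite (lt_le_trans r0)// bdist_ge0.
(* The segment from [p'] to an infeasible [x.1] meets the boundary at a point no farther from [x.1]
   than [p']. *)
have [l /andP[l0 l1] /(bdist_le x.1) hb] := slice_crossing G1 (fun i => nGx (interior_subset i)).
rewrite ltrNr; apply: le_lt_trans hb _; apply: le_lt_trans G2.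
rewrite sdist0C (_ : p' + l *: (x.1 - p') = x.1 + (1 - l) *: (p' - x.1)); last first.
  by apply/matrixP => i j; rewrite !mxE; ring.
rewrite -sdist0C sdist0_line ger0_norm ?subr_ge0// ler_piMl ?sdist0_ge0//; lra.
Unshelve. all: end_near. Qed.

End signed_distance.

Lemma vposE {R : realType} n (u : 'cV[R]_n) i : vpos u i 0 = Num.max (u i 0) 0.
Proof. by rewrite mxE. Qed.

Lemma cvg_sdist0 {R : realType} n (S : 'M[R]_n) u (T : Type) (F : set_system T)
    {FF : Filter F} (f : T -> 'cV[R]_n) (l : 'cV[R]_n) :
  f x @[x --> F] --> l -> sdist0 S u (f x) @[x --> F] --> sdist0 S u l.
Proof.
move=> fl; have h : f x - u @[x --> F] --> l - u by apply: cvgB => //; exact: cvg_cst.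
apply: (@cvg_comp _ _ _ (fun x => f x - u) (fun v => enorm (invmx S *m v)) _ (nbhs (l - u))) => //.
apply: (@cvg_comp _ _ _ (mulmx (invmx S)) (@enorm R n) _ (nbhs (invmx S *m (l - u)))).
  exact: continuous_mulmxl.
exact: continuous_enorm.
Qed.

(** * Bound of the running cost by a function of the radius *)

Section cost_bounds.
Context {R : realType} {nG nL nc : nat} (M : market R nG nL nc) (hM : market_ok M).

Let nL0 : (0 < nL)%N. Proof. by case: hM => -[]. Qed.
Let c0 i : 0 < cvec M i 0. Proof. by case: hM => _ _ [h _ _] _ _; exact: h. Qed.
Let Su : sigma M \in unitmx. Proof. by case: hM => _ _ _ _ []. Qed.
Let fG i : feasible_ok M (G M i). Proof. by case: hM => _ _ [_ h _] _ _; exact: h. Qed.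
Let q0 i : 0 <= q M i. Proof. by case: hM => _ _ _ [_ h] _; exact: h. Qed.
Let cG i : closed (G M i). Proof. by case: (fG i) => -[]. Qed.
Let kG i : compact (G M i). Proof. by case: (fG i) => _ []. Qed.

Lemma dotp_mono (u v : 'cV[R]_nL) : vle u v -> dotp (cvec M) u <= dotp (cvec M) v.
Proof. by move=> uv; apply: ler_sum => i _; rewrite ler_wpM2l// ltW. Qed.

Lemma dotp_vpos_ge0 (u : 'cV[R]_nL) : 0 <= dotp (cvec M) (vpos u).
Proof. by apply: sumr_ge0 => i _; rewrite mulr_ge0 ?(ltW (c0 _))// mxE le_max lexx orbT. Qed.

Definition unit_cost_sup : R := sup [set dotp (cvec M) (vpos (sigma M *m e)) |
        e in [set e : 'cV[R]_nL | enorm e = 1]].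

(** By homogeneity only unit vectors matter; the supremum over them is a true upper bound because
    the unit ball is compact. *)
Lemma dotp_vpos_le (v : 'cV[R]_nL) :
  dotp (cvec M) (vpos (sigma M *m v)) <= enorm v * unit_cost_sup.
Proof.
have [v0|v0] := eqVneq (enorm v) 0.
  rewrite v0 mul0r (enorm_eq0 v0) mulmx0 /dotp big1// => i _.
  by rewrite !mxE maxxx mulr0.
have vp : 0 < enorm v by rewrite lt_neqAle eq_sym v0 enorm_ge0.
have [B hB] : exists B, forall e : 'cV[R]_nL, enorm e <= 1 -> enorm (sigma M *m e) <= B.
  apply: (compact_bounded_above (@compact_enorm_ball R nL 1)).
  apply: continuous_subspaceT => x.
  apply: (@continuous_comp _ _ _ (mulmx (sigma M)) (@enorm R nL)).
    exact: continuous_mulmxl.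
  exact: continuous_enorm.
have ub : has_ubound [set dotp (cvec M) (vpos (sigma M *m e)) |
    e in [set e : 'cV[R]_nL | enorm e = 1]].
  exists (enorm (cvec M) * B) => _ [e /= e1 <-].
  apply: le_trans (dotp_le_enorm _ _) _; apply: ler_wpM2l; first exact: enorm_ge0.
  apply: le_trans (hB e _); last by rewrite e1.
  rewrite /enorm ler_sqrt ?sum_sqr_ge0//; apply: ler_sum => i _.
  rewrite [vpos _ i 0]mxE; case: (leP ((sigma M *m e) i 0) 0) => // _.
  by rewrite expr0n sqr_ge0.
pose e := (enorm v)^-1 *: v.
have e1 : enorm e = 1 by rewrite enormZ ger0_norm ?invr_ge0 ?enorm_ge0// mulVf.
have ve : v = enorm v *: e by rewrite scalerA mulfV// scale1r.
have -> : dotp (cvec M) (vpos (sigma M *m v)) =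
    enorm v * dotp (cvec M) (vpos (sigma M *m e)).
  rewrite /dotp mulr_sumr; apply: eq_bigr => i _.
  have -> : vpos (sigma M *m v) i 0 = enorm v * vpos (sigma M *m e) i 0.
    rewrite !vposE {1}ve -scalemxAr [(enorm v *: (sigma M *m e)) i 0]mxE.
    by rewrite (maxr_pMr _ _ (ltW vp)) mulr0.
  by rewrite mulrCA.
by rewrite ler_wpM2l ?enorm_ge0//; apply: (ub_le_sup ub); exists e.
Qed.

Lemma unit_cost_sup_ge0 : 0 <= unit_cost_sup.
Proof.
have e1 : enorm (axis (Ordinal nL0) (1 : R)) = 1 by rewrite enorm_axis.
by have := dotp_vpos_le (axis (Ordinal nL0) (1 : R)); rewrite e1 mul1r; apply: le_trans; exact: dotp_vpos_ge0.
Qed.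

Lemma dsignedE i t g : dsigned M i t g = sdist (sigma M) (G M i) (m M t) g.
Proof. by []. Qed.

(** Let p be a feasible demand near x. Shedding (x^+ - p)^+ leaves min(x^+, p), feasible by (D). As
    p >= 0, what is shed is at most (x - p)^+, whose cost is controlled by the norm of sigma^-1 (x -
    p). *)
Lemma shedding_cost_le i g t (x : 'cV[R]_nL) : DG M g ->
  dotp (cvec M) (zstar M i g (vpos x)) <= CB M i t g (enorm (invmx (sigma M) *m (x - m M t))).
Proof.
move=> gD; have [[Gpos _] _ _ hC hD] := fG i.
have [p1 Gp1 _] := hC g gD.
have k0 := unit_cost_sup_ge0.
rewrite /CB -/unit_cost_sup; set A := Num.max 0 _.
apply/ler_addgt0Pr => e e0.
(* The tolerance is multiplied by [unit_cost_sup] at the end; the added 1 keeps the divisor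
   positive. *)
have e'0 : 0 < e / (unit_cost_sup + 1) by rewrite divr_gt0//; lra.
have [p Gp pe] := slice_reach (sigma M) (@cG i) (@kG i) nL0 (m M t) x Gp1 e'0.
pose z := vpos (vpos x - p).
have p_ge0 j : 0 <= p j 0 by exact: (Gpos _ _ Gp).
have zE j : z j 0 = Num.max (Num.max (x j 0) 0 - p j 0) 0 by rewrite !mxE.
have z0 : vge0 z by move=> j; rewrite zE le_max lexx orbT.
have Gz : G M i (g, vpos x - z).
  apply: (hD g p) => // j; rewrite [(vpos x - z) j 0]mxE [(- z) j 0]mxE zE vposE;
  have a0 : 0 <= Num.max (x j 0) 0 by rewrite le_max lexx orbT.
    by have := p_ge0 j; case: (leP (Num.max (x j 0) 0 - p j 0) 0); lra.
  by have := p_ge0 j; case: (leP (Num.max (x j 0) 0 - p j 0) 0); lra.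
have zs : dotp (cvec M) (zstar M i g (vpos x)) <= dotp (cvec M) z.
  case: hM => _ _ [_ _ hz] _ _.
  have xp : vge0 (vpos x) by move=> j; rewrite vposE le_max lexx orbT.
  by have [_ _] := hz i g (vpos x) gD xp; apply.
apply: le_trans zs _.
have zx : dotp (cvec M) z <= dotp (cvec M) (vpos (x - p)).
  apply: dotp_mono => j; rewrite zE vposE [(x - p) j 0]mxE [(- p) j 0]mxE.
  have := p_ge0 j; case: (leP (x j 0) 0) => xj pj.
    by rewrite [leLHS]max_r ?le_max ?lexx ?orbT//; lra.
  by [].
apply: le_trans zx _.
rewrite -[x - p](mulKVmx Su); apply: le_trans (dotp_vpos_le _) _.
have := ler_wpM2r k0 pe; rewrite -/(sdist0 (sigma M) (m M t) x) /sdist0 -dsignedE -/A => h.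
apply: le_trans h _; rewrite mulrDl lerD2l mulrAC ler_pdivrMr; last lra.
by rewrite ler_pM2l//; lra.
Qed.

Lemma running_cost_le_f1B (x : 'cV[R]_nL) a r t : DG M (zeta M a r) ->
  running_cost M x a r <= f1B M t (zeta M a r) (enorm (invmx (sigma M) *m (x - m M t))).
Proof.
move=> zD; rewrite /running_cost /f1B lerD2l; apply: ler_sum => i _.
by rewrite ler_wpM2l// shedding_cost_le.
Qed.

Lemma DG_compact : compact (DG M).
Proof.
have := @cV_compact R nG (fun k => `[theta M k 0, theta M k (nlev M k).-1]%classic)
  (fun k => @segment_compact R _ _).
by congr compact; apply/seteqP; split => p h k; have := h k; rewrite /= in_itv.
Qed.

Lemma CG_bounded : exists2 C, 0 <= C & forall g, DG M g -> `|CG M g| <= C.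
Proof.
have cC : {within DG M, continuous (CG M)} by case: hM => _ _ _ [].
have [B hB] := compact_bounded_above DG_compact cC.
have cC' : {within DG M, continuous (fun g => - CG M g)} by move=> x; apply: cvgN; exact: cC.
have [B' hB'] := compact_bounded_above DG_compact cC'.
exists (Num.max 0 (Num.max B B')); first by rewrite le_max lexx.
by move=> g gD; rewrite ler_norml lerNl !le_max hB// hB'// !orbT.
Qed.

Lemma CB_ge0 i t g y : 0 <= CB M i t g y.
Proof. by rewrite /CB mulr_ge0 ?unit_cost_sup_ge0// le_max lexx. Qed.

Lemma f1B_ge C : (forall g, DG M g -> `|CG M g| <= C) ->
  forall t g y, DG M g -> - C <= f1B M t g y.
Proof.
move=> hC t g y gD; rewrite /f1B; have := hC g gD; rewrite ler_norml => /andP[h _].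
by rewrite (le_trans h)// lerDl sumr_ge0// => i _; rewrite mulr_ge0 ?CB_ge0.
Qed.

(** Makes [f2B] the supremum of a bounded set. The signed distance is bounded below because the
    boundary of a slice lies in the compact set [G M i]. *)
Lemma f1B_ub t y : exists B, forall g, DG M g -> f1B M t g y <= B.
Proof.
have [C C0 hC] := CG_bounded.
have h i : {D | forall g, DG M g -> - dsigned M i t g <= D}.
  apply: cid; have [D hD] : exists D, forall x, G M i x -> sdist0 (sigma M) (m M t) x.2 <= D.
    apply: (compact_bounded_above (@kG i)); apply: continuous_subspaceT => x.
    by apply: cvg_sdist0; exact: cvg_snd.
  exists (Num.max 0 D) => g gD; rewrite dsignedE /sdist; case: asboolP => [_|_].
    by rewrite le_max oppr_le0 bdist_ge0.
  have [_ _ _ /(_ g gD)[p1 Gp1 _] _] := fG i.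
  have [p bp] := boundary_slice_nonempty (@cG i) (@kG i) nL0 Gp1.
  rewrite opprK le_max; apply/orP; right; apply: le_trans (bdist_le _ _ bp) _.
  exact: (hD (g, p) (boundary_sub (@cG i) bp)).
exists (C + \sum_(i < nc.+1) q M i * (Num.max 0 (y + sval (h i)) * unit_cost_sup)) => g gD.
apply: lerD; first by have := hC g gD; rewrite ler_norml => /andP[].
apply: ler_sum => i _; rewrite ler_wpM2l// /CB -/unit_cost_sup ler_wpM2r ?unit_cost_sup_ge0//.
by rewrite ge_max !le_max lexx /= lerD2l (svalP (h i) g gD) orbT.
Qed.

End cost_bounds.

(** * Upper semicontinuity *)

Section upper_semicontinuity.
Context {R : realType}.

(** The sublevel set is relatively open in the arbitrary set [D], so it is the trace on [D] of a
    countable union of boxes with rational centres and radii 1 / (n + 1). *)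
Lemma usc_sublevel_measurable (D : set (R * R * R)) (f : R * R * R -> R) (c : R) :
  (forall x0, D x0 -> f x0 < c -> \forall x \near x0, D x -> f x < c) ->
  exists2 B : set (R * R * R), measurable B & forall x, D x -> (B x <-> f x < c).
Proof.
move=> h.
pose r (n : nat) : R := n.+1%:R^-1.
pose box (k : rat * rat * rat * nat) : set (R * R * R) :=
  (ball (ratr k.1.1.1 : R) (r k.2) `*` ball (ratr k.1.1.2 : R) (r k.2)) `*` ball (ratr k.1.2 : R) (r k.2).
exists (\bigcup_k if `[< box k `&` D `<=` [set x | f x < c] >] then box k else set0).
  apply: countable_bigcupT_measurable; first exact: countableP.
  move=> k; case: ifP => // _.
  by apply: measurableX; [apply: measurableX|]; exact: measurable_ball.
move=> x Dx; split; first by move=> [k _]; case: asboolP => // hk bx; exact: hk.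
move=> fx; have /nbhs_ballP[e /= e0 he] := h x Dx fx.
have [n ne] : exists n, r n < e / 2.
  have := @cvg_harmonic R; move=> /cvgrPdist_lt/(_ (e / 2)); rewrite divr_gt0// => /(_ isT)[n _ hn].
  exists n; have := hn n (leqnn n); rewrite /= sub0r normrN ger0_norm//.
have rn : 0 < r n by rewrite invr_gt0.
have rr (u : R) : exists q : rat, `|ratr q - u| < r n.
  have lt : u - r n < u + r n by lra.
  by have [q] := rat_in_itvoo lt; rewrite in_itv/= => qu; exists q; rewrite ltr_distl.
have [q1 h1] := rr x.1.1; have [q2 h2] := rr x.1.2; have [q3 h3] := rr x.2.
exists (q1, q2, q3, n) => //.
have bx : box (q1, q2, q3, n) x.
  by rewrite /box; split; [split|]; rewrite /ball/=.
case: asboolP => // nb; exfalso; apply: nb => y [[[/= y1 y2] y3] Dy].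
apply: he => //; split; [split|]; rewrite /ball/=.
- rewrite (_ : x.1.1 - y.1.1 = - (ratr q1 - x.1.1) + (ratr q1 - y.1.1)); last by ring.
  by rewrite (le_lt_trans (ler_normD _ _))// normrN; move: y1; rewrite /ball/=; lra.
- rewrite (_ : x.1.2 - y.1.2 = - (ratr q2 - x.1.2) + (ratr q2 - y.1.2)); last by ring.
  by rewrite (le_lt_trans (ler_normD _ _))// normrN; move: y2; rewrite /ball/=; lra.
- rewrite (_ : x.2 - y.2 = - (ratr q3 - x.2) + (ratr q3 - y.2)); last by ring.
  by rewrite (le_lt_trans (ler_normD _ _))// normrN; move: y3; rewrite /ball/=; lra.
Qed.

Section filter.
Context {T : Type} (F : set_system T) {FF : Filter F}.
Implicit Types (f g : T -> R) (v : R).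

Definition usc_at f v := forall c, v < c -> \forall x \near F, f x < c.

Lemma usc_at_cvg f v : f x @[x --> F] --> v -> usc_at f v.
Proof. by move=> fv c vc; exact: (cvgr_lt _ fv). Qed.

Lemma usc_at_add f g u v : usc_at f u -> usc_at g v -> usc_at (fun x => f x + g x) (u + v).
Proof.
move=> hf hg c uvc; pose e := (c - u - v) / 2.
have e0 : 0 < e by rewrite divr_gt0//; lra.
have := hf (u + e) _; rewrite ltrDl => /(_ e0) h1.
have := hg (v + e) _; rewrite ltrDl => /(_ e0) h2.
near=> x.
have x1 : f x < u + e by near: x.
have x2 : g x < v + e by near: x.
by rewrite /e in x1 x2; lra.
Unshelve. all: end_near. Qed.

Lemma usc_at_scale k f v : 0 <= k -> usc_at f v -> usc_at (fun x => k * f x) (k * v).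
Proof.
rewrite le_eqVlt => /orP[/eqP<- _ c|k0 hf c].
  by rewrite mul0r => c0; near=> x; rewrite mul0r.
rewrite -ltr_pdivlMl// => /hf; apply: filterS => x.
by rewrite ltr_pdivlMl.
Unshelve. all: end_near. Qed.

Lemma usc_at_max0 f v : usc_at f v -> usc_at (fun x => Num.max 0 (f x)) (Num.max 0 v).
Proof.
move=> hf c; rewrite gt_max => /andP[c0 /hf]; apply: filterS => x fx.
by rewrite gt_max c0.
Qed.

Lemma usc_at_sum n (f : 'I_n -> T -> R) (u : 'I_n -> R) : (forall i, usc_at (f i) (u i)) ->
  usc_at (fun x => \sum_i f i x) (\sum_i u i).
Proof.
move=> hf; elim: (index_enum _) => [|i s IH] c.
  by rewrite big_nil => c0; near=> x; rewrite big_nil.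
rewrite big_cons => /(usc_at_add (hf i) IH); apply: filterS => x.
by rewrite big_cons.
Unshelve. all: end_near. Qed.

End filter.
End upper_semicontinuity.

Section f1B_usc.
Context {R : realType} {nG nL nc : nat} (M : market R nG nL nc) (hM : market_ok M).

Lemma cvg_mean s0 : s0 \in `[0, T M] -> m M s @[s --> within `[0, T M] (nbhs s0)] --> m M s0.
Proof.
move=> s0T; apply: cvg_mxP => i j; rewrite ord1.
have [_ _ _ _ [_ _ mL _ _]] := hM.
apply/cvgrPdist_lt => e e0.
have C0 : 0 < `|Cm M| + 1 by rewrite ltr_pwDr.
rewrite near_withinE; near=> s => sT.
have h1 : `|s0 - s| < e / (`|Cm M| + 1).
  near: s; apply/nbhs_ballP; exists (e / (`|Cm M| + 1)) => //=; exact: divr_gt0.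
have := coord_le_enorm (m M s0 - m M s) i; rewrite !mxE => h2.
apply: le_lt_trans h2 _; apply: le_lt_trans (mL s0 s s0T _) _; first by rewrite inE.
apply: le_lt_trans (_ : _ <= (`|Cm M| + 1) * `|s0 - s|) _.
  by rewrite ler_wpM2r// (le_trans (ler_norm _))// lerDl.
by rewrite mulrC -ltr_pdivlMr.
Unshelve. all: end_near. Qed.

(** The only possibly discontinuous ingredient is the signed distance: it is lower semicontinuous,
    and it enters with a minus sign and nonnegative weights. *)
Lemma f1B_usc s0 g0 y0 c : s0 \in `[0, T M] -> DG M g0 -> f1B M s0 g0 y0 < c ->
  \forall x \near ((s0, y0), g0), x.1.1 \in `[0, T M] -> DG M x.2 ->
    f1B M x.1.1 x.2 x.1.2 < c.
Proof.
move=> s0T g0D.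
have [[_ nL0] _ [_ fG _] [cC q0] [_ _ _ _ Su]] := hM.
pose D : set ((R * R) * 'cV[R]_nG) := [set x | x.1.1 \in `[0, T M] /\ DG M x.2].
(* [m M] and [CG M] are regular only on [0, T] and on [DG M], so limits are taken along the trace of
   the neighbourhoods on [D]. *)
pose F := within D (nbhs ((s0, y0), g0)).
suff : usc_at F (fun x => f1B M x.1.1 x.2 x.1.2) (f1B M s0 g0 y0).
  move=> h /h; rewrite /F !near_withinE; apply: filterS => x hx sT gD.
  by apply: hx.
have FD : F D by apply: withinT; exact: nbhs_filter.
have Fn (A : set ((R * R) * 'cV[R]_nG)) : nbhs ((s0, y0), g0) A -> F A.
  by rewrite /F /within/=; apply: filterS => x Ax _.
have c11 (p : (R * R) * 'cV[R]_nG) : x.1.1 @[x --> p] --> p.1.1.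
  apply: (@cvg_comp _ _ _ fst fst _ (nbhs p.1)); first exact: cvg_fst.
  exact: (@cvg_fst _ _ (nbhs p.1.1) (nbhs p.1.2)).
have c12 (p : (R * R) * 'cV[R]_nG) : x.1.2 @[x --> p] --> p.1.2.
  apply: (@cvg_comp _ _ _ fst snd _ (nbhs p.1)); first exact: cvg_fst.
  exact: (@cvg_snd _ _ (nbhs p.1.1) (nbhs p.1.2)).
have c_s : x.1.1 @[x --> F] --> within `[0, T M] (nbhs s0).
  move=> A hA; have h : \forall x \near ((s0, y0), g0), x.1.1 \in `[0, T M] -> A x.1.1.
    by have := c11 ((s0, y0), g0) _ hA; rewrite nbhs_simpl.
  suff : F [set x | A x.1.1] by [].
  by apply: filterS (filterI FD (Fn _ h)) => x [[xT _] hx]; exact: hx.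
have c_g : x.2 @[x --> F] --> within (DG M) (nbhs g0).
  move=> A hA; have h : \forall x \near ((s0, y0), g0), DG M x.2 -> A x.2.
    have c1 : x.2 @[x --> ((s0, y0), g0)] --> g0 by exact: cvg_snd.
    by have := c1 _ hA; rewrite nbhs_simpl.
  suff : F [set x | A x.2] by [].
  by apply: filterS (filterI FD (Fn _ h)) => x [[_ xD] hx]; exact: hx.
have c_y : x.1.2 @[x --> F] --> y0.
  move=> A hA; suff : F [set x | A x.1.2] by [].
  by apply: Fn; have := c12 ((s0, y0), g0) _ hA; rewrite nbhs_simpl.
apply: usc_at_add.
  apply: usc_at_cvg; apply: (@cvg_comp _ _ _ snd (CG M) _ (within (DG M) (nbhs g0))) => //.
  exact: ((subspace_continuousP _ _).1 cC).
apply: usc_at_sum => i; apply: usc_at_scale => //.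
rewrite (_ : CB M i s0 g0 y0 = unit_cost_sup M * Num.max 0 (y0 - dsigned M i s0 g0)); last first.
  by rewrite /CB mulrC.
rewrite (_ : (fun x => _) = fun x => unit_cost_sup M * Num.max 0 (x.1.2 - dsigned M i x.1.1 x.2)); last first.
  by apply/funext => x; rewrite /CB mulrC.
apply: usc_at_scale; first exact: unit_cost_sup_ge0.
apply: usc_at_max0; apply: usc_at_add; first exact: usc_at_cvg.
move=> e; rewrite ltrNl dsignedE => ed.
have [[_ cG] [/convex_setP cvG kG] _ hC _] := fG i.
have c2 : (m M x.1.1, x.2) @[x --> F] --> (m M s0, g0).
  apply: cvg_pair_nbhs.
    by apply: (@cvg_comp _ _ _ (fun x => x.1.1) (m M) _ (within `[0, T M] (nbhs s0))); last exact: cvg_mean.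
  by apply: cvg_trans c_g _; exact: cvg_within.
have h := sdist_lsc cG kG Su nL0 cvG (hC g0 g0D) ed.
have h' : F [set x | - e < sdist (sigma M) (G M i) (m M x.1.1) x.2] by have := c2 _ h.
by apply: filterS h' => x /=; rewrite ltrNl.
Qed.

End f1B_usc.

(** * Comparison of the operation modes along a control *)

Definition is_level (c : cmode) : bool := if c is Lvl _ then true else false.

Section production.
Context {R : realType} {nG nL nc : nat} (M : market R nG nL nc) (hM : market_ok M).
Variables (a : mode nG) (ha : is_mode M a).
Implicit Types r : 'cV[R]_nG.

(** [H] excludes the completion times; with them the set becomes compact. *)
Definition closed_progress : set 'cV[R]_nG :=
  [set r | forall k, match a k with
                     | Lvl _ => r k 0 = 0
                     | Sw l l' => 0 <= r k 0 <= delay M k (l, l')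
                     end].

Let hmodes : modes_ok M. Proof. by case: hM. Qed.

Lemma closed_progressP r : closed_progress r <->
  forall k, 0 <= r k 0 <= mode_delay M a k.
Proof.
split => h k; have := h k; rewrite /mode_delay; case: (a k) => //.
  by move=> _ ->; rewrite lexx.
by move=> _ /andP[h1 h2]; apply/eqP; rewrite eq_le h1 h2.
Qed.

Lemma progress_closed r : H M a r -> closed_progress r.
Proof. by move=> h k; have := h k; case: (a k) => // l l' /andP[-> /ltW]. Qed.

Lemma theta_bounds k l : (l < nlev M k)%N ->
  theta M k 0 <= theta M k l <= theta M k (nlev M k).-1.
Proof.
have [_ [_ [hlt _]]] := hmodes.
move=> ln; apply/andP; split.
  by case: l ln => // l ln; apply/ltW; exact: hlt.
have n0 : (0 < nlev M k)%N by exact: leq_ltn_trans ln.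
have : (l <= (nlev M k).-1)%N by rewrite -ltnS prednK.
by rewrite leq_eqVlt => /orP[/eqP->//|h]; apply/ltW/hlt => //; rewrite prednK.
Qed.

Lemma zeta_DG r : closed_progress r -> DG M (zeta M a r).
Proof.
move=> hr k; rewrite mxE; have := ha k; have := hr k.
case ak : (a k) => [l|l l'] hrk hk; first exact: theta_bounds.
have [_ [_ [_ [hl h]]]] := hmodes.
have [lk l'k] := hl _ _ _ hk; have [D0 _ mono _ [r0 rD _]] := h _ _ _ hk.
have /andP[t1 t2] := theta_bounds lk; have /andP[t3 t4] := theta_bounds l'k.
have [rk0 rkD] := andP hrk.
have i0 : 0 \in `[0, delay M k (l, l')] by rewrite in_itv/= lexx ltW.
have iD : delay M k (l, l') \in `[0, delay M k (l, l')] by rewrite in_itv/= lexx ltW.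
have ir : r k 0 \in `[0, delay M k (l, l')] by rewrite in_itv.
case: mono => mono.
  have := mono _ _ i0 ir rk0; have := mono _ _ ir iD rkD; rewrite r0 rD => u1 u2.
  by rewrite (le_trans t1)//= (le_trans u1).
have := mono _ _ ir i0 rk0; have := mono _ _ iD ir rkD; rewrite r0 rD => u1 u2.
by rewrite (le_trans t3)//= (le_trans u2).
Qed.

Lemma psi_le r c : 0 <= c -> (forall k, mode_delay M a k - r k 0 <= c) -> psi M a r <= c.
Proof. by move=> c0 h; apply: bigmax_le. Qed.

Lemma le_psi r k : mode_delay M a k - r k 0 <= psi M a r.
Proof. exact: le_bigmax. Qed.

Lemma psi_ge0 r : 0 <= psi M a r.
Proof. by rewrite /psi bigmax_idl le_max lexx. Qed.

Lemma psi_attained r : 0 < psi M a r -> exists k, mode_delay M a k - r k 0 = psi M a r.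
Proof.
move=> h; apply: contrapT => nex; have : psi M a r < psi M a r; last by rewrite ltxx.
apply: bigmax_lt => // k _; rewrite lt_neqAle le_psi andbT; apply/eqP => e.
by apply: nex; exists k.
Qed.

Lemma cvg_psi (T : Type) (F : set_system T) {FF : Filter F} (f : T -> 'cV[R]_nG) (l : 'cV[R]_nG) :
  f x @[x --> F] --> l -> psi M a (f x) @[x --> F] --> psi M a l.
Proof.
move=> fl; apply: (cvg_big (op := Num.max)) => [x|k _].
  by apply: continuous_max; [exact: cvg_fst|exact: cvg_snd].
apply: cvgB; first exact: cvg_cst.
apply: (@cvg_comp _ _ _ f (fun v : 'cV[R]_nG => v k 0) _ (nbhs l)) => //.
exact: coord_continuous.
Qed.

Lemma zeta_lip r r' k : closed_progress r -> closed_progress r' ->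
  `|zeta M a r k 0 - zeta M a r' k 0| <= `|CRR M| * `|r k 0 - r' k 0|.
Proof.
move=> hr hr'; rewrite !mxE; have := ha k; have := hr k; have := hr' k.
case: (a k) => [l|l l'] h1 h2 hk; first by rewrite subrr normr0 mulr_ge0.
have [_ [_ [_ [_ h]]]] := hmodes; have [_ _ _ _ [_ _ lip]] := h _ _ _ hk.
apply: le_trans (lip _ _ _ _) _; rewrite ?in_itv//.
by rewrite ler_wpM2r// ler_norm.
Qed.

Lemma closed_progress_compact : compact closed_progress.
Proof.
have := @cV_compact R nG (fun k => `[0, mode_delay M a k]%classic)
  (fun k => @segment_compact R _ _).
by congr compact; apply/seteqP; split => r; rewrite closed_progressP => h k; have := h k; rewrite /= in_itv.
Qed.

Lemma cvg_zeta r0 : closed_progress r0 ->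
  zeta M a r @[r --> within closed_progress (nbhs r0)] --> zeta M a r0.
Proof.
move=> h0; apply: cvg_mxP => i j; rewrite ord1; apply/cvgrPdist_lt => e e0.
have C0 : 0 < `|CRR M| + 1 by rewrite ltr_pwDr.
have hb : nbhs r0 (ball r0 (e / (`|CRR M| + 1))).
  by apply: nbhsx_ballx; rewrite divr_gt0.
rewrite near_withinE; apply: filterS hb => r [_ hr] rc.
apply: le_lt_trans (zeta_lip i h0 rc) _.
apply: le_lt_trans (_ : _ <= (`|CRR M| + 1) * `|r0 i 0 - r i 0|) _.
  by rewrite ler_wpM2r// lerDl.
by rewrite mulrC -ltr_pdivlMr//; exact: hr.
Qed.

(** Necessary for [DGaw] to be nonempty: since [H] excludes completion times, a remaining time of 0
    means that nothing is in transition. *)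
Definition progress_time (w : R) : Prop := 0 < w \/ forall k, is_level (a k).

(** The closed progresses with remaining time [w] form a compact set, and so does their image under
    [zeta]; the closure in [DGaw] therefore stays inside this image. *)
Lemma DGaw_sub w g : DGaw M a w g ->
  exists r, [/\ closed_progress r, psi M a r = w & g = zeta M a r].
Proof.
pose K := [set r | closed_progress r /\ psi M a r = w].
have cK : compact K.
  apply: (@subclosed_compact _ _ closed_progress); last 2 first.
  - exact: closed_progress_compact.
  - by move=> r [].
  rewrite (_ : K = closed_progress `&` (psi M a) @^-1` [set w])//.
  apply: closedI; first by apply: compact_closed; [exact: norm_hausdorff|exact: closed_progress_compact].
  apply: preimage_closed; last exact: closed_eq.
  by move=> r _; exact: (@cvg_psi _ (nbhs r) _ id).
have czK : {within K, continuous (zeta M a)}.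
  apply: continuous_subspaceW (_ : {within closed_progress, continuous (zeta M a)}).
    by move=> r [].
  by apply/subspace_continuousP => r hr; exact: cvg_zeta.
have cl : closed (zeta M a @` K).
  by apply: compact_closed; [exact: norm_hausdorff|exact: continuous_compact].
have sub : [set zeta M a r | r in [set r | H M a r /\ psi M a r = w]] `<=` zeta M a @` K.
  by move=> _ [r [hr pr] <-]; exists r => //; split => //; exact: progress_closed.
move=> /(closure_subset sub)/cl[r [hr pr] <-].
by exists r.
Qed.

Lemma DGaw_DG w g : DGaw M a w g -> DG M g.
Proof. by move=> /DGaw_sub[r [hr _ ->]]; exact: zeta_DG. Qed.

(* A closed progress may sit at a completion time, which [H] excludes; it is
   approximated by progresses in [H] with the same remaining time. *)
Lemma zeta_DGaw w r : progress_time w -> closed_progress r -> psi M a r = w ->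
  DGaw M a w (zeta M a r).
Proof.
move=> pw hr pr.
have [w0|w0] := ltP 0 w; last first.
  have lv : forall k, is_level (a k).
    by case: pw => //; rewrite ltNge w0.
  apply: subset_closure; exists r => //; split => // k; have := hr k; have := lv k.
  by case: (a k).
(* Each transition is held at least [e] short of completion. If [e <= w], the one that realizes the
   remaining time is unaffected. The maximum with 0 is for delays shorter than [e]. *)
pose rr (e : R) : 'cV[R]_nG := \col_k Num.max 0 (Num.min (r k 0) (mode_delay M a k - e)).
have rrE e k : rr e k 0 = Num.max 0 (Num.min (r k 0) (mode_delay M a k - e)) by rewrite mxE.
have hr' := (closed_progressP r).1 hr.
have rr_ge e k : 0 <= rr e k 0 by rewrite rrE le_max lexx.
have rr_le e k : 0 <= e -> r k 0 - e <= rr e k 0 <= r k 0.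
  move=> e0; have /andP[h1 h2] := hr' k; rewrite rrE.
  case: (leP (r k 0) (mode_delay M a k - e)) => h3;
  [case: (leP 0 (r k 0)) => h4|case: (leP 0 (mode_delay M a k - e)) => h4];
  by apply/andP; split; lra.
have Hrr e : 0 < e -> H M a (rr e).
  move=> e0 k; have /andP[_ h1] := rr_le e k (ltW e0); have h2 := rr_ge e k.
  move: (rrE e k) (ha k) (hr k); rewrite /mode_delay.
  case: (a k) => [l _ _ h3|l l' hE h4 h3].
    by apply/eqP; rewrite eq_le h2 -h3 h1.
  have [_ [_ [_ [_ h]]]] := hmodes; have [D0 _ _ _ _] := h _ _ _ h4.
  by rewrite h2 /= hE gt_max D0 /= gt_min; apply/orP; right; lra.
have psirr e : 0 < e <= w -> psi M a (rr e) = w.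
  move=> /andP[e0 ew]; apply/eqP; rewrite eq_le; apply/andP; split.
    apply: psi_le => [|k]; first exact: ltW.
    have := le_psi r k; rewrite pr rrE; have /andP[h1 h2] := hr' k.
    by case: (leP (r k 0) (mode_delay M a k - e)) => h3;
      [case: (leP 0 (r k 0)) => h4|case: (leP 0 (mode_delay M a k - e)) => h4]; lra.
  have [k hk] : exists k, mode_delay M a k - r k 0 = psi M a r by apply: psi_attained; rewrite pr.
  apply: le_trans (le_psi (rr e) k); rewrite -{1}pr -hk lerD2l lerN2.
  by have /andP[] := rr_le e k (ltW e0).
move=> B /nbhs_ballP[e /= e0 eB].
have C0 : 0 < `|CRR M| + 1 by rewrite ltr_pwDr.
(* The first bound preserves the remaining time, the second makes the error of the production less
   than [e] by the Lipschitz bound on the ramps. *)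
pose d := Num.min w (e / (`|CRR M| + 1)).
have d0 : 0 < d by rewrite lt_min w0 divr_gt0.
have dw : d <= w by rewrite ge_min lexx.
have de : d * (`|CRR M| + 1) <= e by rewrite -ler_pdivlMr// ge_min lexx orbT.
exists (zeta M a (rr d)); split.
  by exists (rr d) => //; split; [exact: Hrr|apply: psirr; rewrite d0].
apply: eB; split => // k j; rewrite ord1 /ball/=.
apply: le_lt_trans (zeta_lip k hr (progress_closed (Hrr d d0))) _.
apply: le_lt_trans (_ : _ <= `|CRR M| * d) _.
  rewrite ler_wpM2l// ler_norml; have := rr_le d k (ltW d0); lra.
apply: lt_le_trans de; rewrite mulrDr mulr1 mulrC ltrDl//.
Qed.

Lemma DGaw_progress_time w g : DGaw M a w g -> progress_time w.
Proof.
move=> /(_ setT filterT)[_ [[r [hr pr] _] _]].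
have [w0|w0] := ltP 0 w; first by left.
right => k; have := hr k; have := le_psi r k; rewrite pr /mode_delay.
by case: (a k) => // l l' h1 /andP[_ h2]; lra.
Qed.

Lemma f1B_le_f2B s y w g : DGaw M a w g -> f1B M s g y <= f2B M s y a w.
Proof.
move=> hg; have [B hB] := f1B_ub hM s y.
apply: ub_le_sup; last by exists g.
by exists B => _ [g' /DGaw_DG hg' <-]; exact: hB.
Qed.

(** A supremum of a jointly upper semicontinuous function over a compact set, under a constraint
    that moves with the remaining time: near a progress whose remaining time is not [w0] the
    constraint fails, near the others [f1B_usc] applies. *)
Lemma f2B_usc s0 y0 w0 c : s0 \in `[0, T M] ->
  (exists g, DGaw M a w0 g) -> f2B M s0 y0 a w0 < c ->
  \forall x \near ((s0, y0), w0), x.1.1 \in `[0, T M] -> (exists g, DGaw M a x.2 g) ->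
    f2B M x.1.1 x.1.2 a x.2 < c.
Proof.
move=> s0T [g0 g0K] fc.
have pw0 := DGaw_progress_time g0K.
(* Taking the supremum at a nearby point only keeps a weak inequality, hence an intermediate
   bound. *)
pose c' := (c + f2B M s0 y0 a w0) / 2.
have c'c : c' < c by rewrite /c'; lra.
have fc' : f2B M s0 y0 a w0 < c' by rewrite /c'; lra.
have := (compact_near_coveringP _).1 closed_progress_compact _ (nbhs ((s0, y0), w0))
  (fun x r => closed_progress r -> x.1.1 \in `[0, T M] -> psi M a r = x.2 ->
     f1B M x.1.1 (zeta M a r) x.1.2 < c').
have hc r0 : closed_progress r0 -> \forall r \near r0 & x \near ((s0, y0), w0),
    closed_progress r -> x.1.1 \in `[0, T M] -> psi M a r = x.2 ->
     f1B M x.1.1 (zeta M a r) x.1.2 < c'.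
  move=> hr0; have [pr0|pr0] := eqVneq (psi M a r0) w0.
    have fr0 : f1B M s0 (zeta M a r0) y0 < c'.
      exact: le_lt_trans (f1B_le_f2B _ _ (zeta_DGaw pw0 hr0 pr0)) fc'.
    have [[A B] [/= nA nB] AB] := f1B_usc hM s0T (zeta_DG hr0) fr0.
    exists ([set r | closed_progress r -> B (zeta M a r)], [set x | A x.1]).
      split; first by have := cvg_zeta hr0 nB.
      by exists (A, setT); [split => //; exact: filterT|move=> x []].
    move=> [r x] /= [hr hx] cr xT _.
    by apply: (AB (x.1, zeta M a r)) => //=; [split => //; exact: hr|exact: zeta_DG].
  pose e := `|psi M a r0 - w0| / 2.
  have e0 : 0 < e by rewrite divr_gt0// normr_gt0 subr_eq0.
  exists ([set r | `|psi M a r0 - psi M a r| < e], [set x | `|w0 - x.2| < e]).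
    split.
      have : psi M a r @[r --> r0] --> psi M a r0 by exact: (@cvg_psi _ (nbhs r0) _ id).
      by move=> /cvgrPdist_lt/(_ e e0).
    exists (setT, ball w0 e); last by move=> x [_].
    by split; [exact: filterT|exact: nbhsx_ballx].
  move=> [r x] /= [hr hx] _ _ pr; exfalso.
  have := ler_normD (psi M a r0 - psi M a r) (psi M a r - w0).
  rewrite addrA subrK; rewrite pr in hr *; rewrite (distrC x.2).
  by move: hr hx; rewrite /e; lra.
move=> /(_ _ hc) near_all; apply: filterS near_all => x hx xT [g1 g1K].
apply: le_lt_trans c'c; apply: ge_sup; first by exists (f1B M x.1.1 g1 x.1.2), g1.
move=> _ [g /DGaw_sub[r [hr pr ->]] <-]; apply/ltW.
exact: (hx r hr hr xT pr).
Qed.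

Lemma f2B_ge C : 0 <= C -> (forall g, DG M g -> `|CG M g| <= C) ->
  forall s y w, - C <= f2B M s y a w.
Proof.
move=> C0 hC s y w; have [[g hg]|ne] := pselect (exists g, DGaw M a w g).
  by apply: le_trans (f1B_le_f2B s y hg); apply: (f1B_ge hM hC); exact: DGaw_DG hg.
(* The supremum of the empty set is 0 by default, at least [- C] because [C] is nonnegative. *)
rewrite /f2B; have -> : [set f1B M s pG y | pG in DGaw M a w] = set0; last by rewrite sup0 oppr_le0.
by rewrite -subset0 => x [g hg _]; apply: ne; exists g.
Qed.

End production.

(** * Lists of requests and their left limits *)

Section requests.
Context {R : realType} {nG : nat}.
Implicit Types (v : rcontrol R nG) (k : 'I_nG) (s : R).

Lemma last_req_Some v k s e : last_req k v s = Some e ->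
  [/\ e \in v, e.2.1 = k & e.1 <= s].
Proof.
rewrite /last_req; set f := [seq _ <- _ | _] => h.
have : e \in f by rewrite -mem_rev; case: (rev f) h => //= x l [->]; rewrite mem_head.
by rewrite !mem_filter => /and3P[? /eqP ? ?].
Qed.

Lemma last_req_None v k s e : last_req k v s = None -> e \in v -> e.2.1 = k -> s < e.1.
Proof.
rewrite /last_req; set f := [seq _ <- _ | _] => h ev ek.
have f0 : f = [::] by case: (lastP f) h => // f' x; rewrite rev_rcons.
rewrite ltNge; apply/negP => es.
have : e \in f by rewrite !mem_filter es ek eqxx.
by rewrite f0.
Qed.

Lemma last_req_max v k s e e' : sorted <%R (times (req_of k v)) ->
  last_req k v s = Some e -> e' \in v -> e'.2.1 = k -> e'.1 <= s -> e' = e \/ e'.1 < e.1.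
Proof.
rewrite /last_req /times sorted_map; set f := [seq _ <- _ | _] => so h ev ek es.
have sf : sorted (relpre fst <%R) f.
  by apply: sorted_filter so => x y z; exact: lt_trans.
have ef : e' \in f by rewrite !mem_filter es ek eqxx.
have tr : transitive (relpre (fst : R * request nG -> R) <%R) by move=> y x z; exact: lt_trans.
move: h sf ef; case: (lastP f) => // f' x; rewrite rev_rcons /= => -[->].
rewrite (sorted_pairwise tr) pairwise_rcons mem_rcons inE => /andP[/allP hall _].
by case/orP => [/eqP|/hall]; [left|right].
Qed.

Lemma near_left_lt (x c : R) : \forall u \near x^'-, (u < c) = (x <= c).
Proof.
have [xc|cx] := leP x c.
  by near=> u; apply: (lt_le_trans _ xc); near: u; exact: nbhs_left_lt.
near=> u; apply/negbTE; rewrite -leNgt; apply/ltW.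
by near: u; exact: nbhs_left_gt.
Unshelve. all: end_near. Qed.

Lemma near_left_ge (x c : R) : \forall u \near x^'-, (c <= u) = (c < x).
Proof.
apply: filterS (near_left_lt x c) => u h.
by rewrite leNgt h ltNge.
Qed.

(** The list is finite, so just before [x] no request time lies between the current time and [x]. *)
Lemma near_left_last_req v k x :
  \forall u \near x^'-, last_req k v u = ohead (rev [seq e <- req_of k v | e.1 < x]).
Proof.
have h : \forall u \near x^'-, forall i : 'I_(size v), ((tnth (in_tuple v) i).1 <= u) = ((tnth (in_tuple v) i).1 < x).
  by apply: filter_forall => i; exact: near_left_ge.
apply: filterS h => u hu; rewrite /last_req; congr (ohead (rev _)).
apply: eq_in_filter => e; rewrite mem_filter => /andP[_ ev].
by have /tnthP[i ->] : e \in in_tuple v by []; exact: hu.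
Qed.

End requests.

(** * One realization of a control in both problems *)

Section controls_deterministic.
Context {R : realType} {nG nL nc : nat} (M : market R nG nL nc) (hM : market_ok M).
Variables (t : R) (a : mode nG) (r : 'cV[R]_nG) (v : rcontrol R nG).
Hypotheses (ha : is_mode M a) (hr : H M a r).
Notation w := (psi M a r).
Hypothesis hok : realization_ok M t (alphaB M t a w v) v.
Hypothesis hstart : forall e, e \in v -> t + w <= e.1.
Hypothesis hbatch : forall j, (j.+1 < size v)%N ->
  nth 0 (times v) j = nth 0 (times v) j.+1 \/
  nth 0 (times v) j + batch_delay M v (nth 0 (times v) j) <= nth 0 (times v) j.+1.

Let hmodes : modes_ok M. Proof. by case: hM. Qed.

Lemma request_allowed e : e \in v -> e.2.2 \in Lam M e.2.1.
Proof. by case: hok => _ _ _ h /h[a' [_ []]]. Qed.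

Lemma req_delay_gt0 e : e \in v -> 0 < req_delay M e.2.
Proof.
move=> /request_allowed; have [_ [_ [_ [_ h]]]] := hmodes.
by rewrite /req_delay; case: e.2.2 => l l' /h[].
Qed.

Lemma le_batch_delay e : e \in v -> req_delay M e.2 <= batch_delay M v e.1.
Proof. by move=> ev; exact: (@le_bigmax_seq _ _ _ v 0 e (fun e' => e'.1 == e.1) (fun e' => req_delay M e'.2) ev (eqxx _)). Qed.

Lemma psi_start k : mode_delay M a k <= w + r k 0.
Proof. by have := le_psi M a r k; rewrite lerBlDr. Qed.

(** [hbatch] compares neighbours only: one advances through equal times up to the first strict
    jump. *)
Lemma batch_done e e' : e \in v -> e' \in v -> e.1 < e'.1 ->
  e.1 + batch_delay M v e.1 <= e'.1.
Proof.
have so : sorted <=%R (times v) by case: hok.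
have claim n i : (i + n < size v)%N -> nth 0 (times v) i < nth 0 (times v) (i + n)%N ->
    nth 0 (times v) i + batch_delay M v (nth 0 (times v) i) <= nth 0 (times v) (i + n)%N.
  elim: n i => [i|n IH i]; first by rewrite addn0 ltxx.
  rewrite addnS -addSn => ins lti.
  have i1 : (i.+1 < size v)%N by apply: leq_ltn_trans ins; rewrite leq_addr.
  have [e1|h] := hbatch i1; first by rewrite e1; apply: IH => //; rewrite -e1.
  apply: le_trans h _; apply: (sorted_leq_nth le_trans) => //; rewrite ?inE ?size_map//.
  exact: leq_addr.
move=> ev ev' ee.
have tv : e.1 \in times v by exact: map_f.
have tv' : e'.1 \in times v by exact: map_f.
have sv : size (times v) = size v by rewrite size_map.
move: tv => /(nthP 0)[i iv ei]; move: tv' => /(nthP 0)[j jv ej].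
have ij : (i < j)%N.
  rewrite ltnNge; apply/negP => ji; move: ee; rewrite -ei -ej ltNge => /negP; apply.
  by apply: (sorted_leq_nth le_trans).
have := claim (j - i)%N i; rewrite subnKC ?(ltnW ij)// ei ej; apply=> //.
by rewrite -sv.
Qed.

(** A generator at rest in the upper-bound problem has waited for its whole batch, or initially for
    the time [w], and this is at least what its own transition takes. *)
Lemma alphaB_level_alpha u k l : alphaB M t a w v u k = Lvl l -> alpha M t a r v u k = Lvl l.
Proof.
rewrite /alphaB /alpha; case h : last_req => [[tau [k' [l1 l2]]]|].
  have [ev /= ek eu] := last_req_Some h; have := le_batch_delay ev; rewrite /req_delay/= ek => d1.
  case: ifPn => // ; rewrite -leNgt => u1 [<-].
  by have -> : (u < tau + delay M k (l1, l2)) = false by apply/negbTE; rewrite -leNgt (le_trans _ u1)// lerD2l.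
case: ifPn => [u1 akl|]; first by rewrite akl if_same.
rewrite -leNgt => twu.
have w0 := psi_ge0 M a r.
have := psi_start k; rewrite /mode_delay.
rewrite ltNge (le_trans _ twu) ?lerDl//=.
case: (a k) => [l1|l1 l2] /=; first by move=> _ ->.
move=> hd [<-]; rewrite ltNge (_ : delay M k (l1, l2) <= u - t + r k 0)//; lra.
Qed.

Lemma alpha_left_constant x : exists a', \forall u \near x^'-, alpha M t a r v u = a'.
Proof.
have h k : {c | \forall u \near x^'-, alpha M t a r v u k = c}.
  apply: cid.
  case hL : (ohead (rev [seq e <- req_of k v | e.1 < x])) => [[tau [k' [l1 l2]]]|].
    exists (if x <= tau + delay M k (l1, l2) then Sw l1 l2 else Lvl l2).
    apply: filterS2 (near_left_last_req v k x) (near_left_lt x (tau + delay M k (l1, l2))) => u e1 e2.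
    by rewrite /alpha e1 hL e2.
  exists (if x <= t then a k else match a k with
       | Lvl l => Lvl l
       | Sw l l' => if x <= delay M k (l, l') + t - r k 0 then Sw l l' else Lvl l' end).
  case ak : (a k) => [l|l l'].
    apply: filterS2 (near_left_last_req v k x) (near_left_lt x t) => u e1 e2.
    by rewrite /alpha e1 hL e2 ak.
  apply: filterS3 (near_left_last_req v k x) (near_left_lt x t)
    (near_left_lt x (delay M k (l, l') + t - r k 0)) => u e1 e2 e3.
  rewrite /alpha e1 hL e2 ak -e3.
  suff -> : (u - t + r k 0 < delay M k (l, l')) = (u < delay M k (l, l') + t - r k 0) by [].
  by apply/idP/idP; lra.
exists (fun k => sval (h k)).
have : \forall u \near x^'-, forall k, alpha M t a r v u k = sval (h k).
  by apply: filter_forall => k; exact: svalP (h k).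
by apply: filterS => u hu; apply/funext.
Unshelve. all: end_near. Qed.

Lemma realization_ok_alpha : realization_ok M t (alpha M t a r v) v.
Proof.
have [h1 h2 h3 h4] := hok; split => // e ev.
have [a' [ha' [eL al]]] := h4 e ev.
have [a'' ha''] := alpha_left_constant e.1.
exists a''; split => //; split => //.
(* Both modes are constant just before [e.1], so they can be compared at one common time. *)
have [u [hB hA]] : exists u, alphaB M t a w v u = a' /\ alpha M t a r v u = a''.
  by apply: (@filter_ex _ (e.1^'-)); near=> u; split; near: u.
by rewrite -hA; apply: alphaB_level_alpha; rewrite hB.
Unshelve. all: end_near. Qed.

(** Among tied times only the last has a nonempty interval up to the next time, so a batch is
    counted once, at the index of the last request made so far. *)
Lemma rho_current s : t + w <= s -> rho M t w v s =
  \sum_(j < size v | j.+1 == count (<= s) (times v))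
    Num.max (batch_delay M v (nth 0 (times v) j) - (s - nth 0 (times v) j)) 0.
Proof.
move=> tws; rewrite /rho max_r ?add0r; last lra.
have so : sorted <=%R (times v) by case: hok.
have sv : size (times v) = size v by rewrite size_map.
apply: eq_bigl => -[j jv] /=.
have tauE i : (i < size v)%N -> (nth 0 (times v) i <= s) = (i < count (<= s) (times v))%N.
  move=> iv; apply/idP/idP => h; last exact: nth_count_le.
  rewrite ltnNge; apply/negP => hi; move: h; apply/negP; rewrite -ltNge.
  by apply: nth_count_gt => //; rewrite hi sv.
rewrite tauE//; have [jn|nj] /= := ltnP j (count (<= s) (times v)); last first.
  by apply/esym/negbTE; rewrite gtn_eqF// ltnS.
have cs : (count (<= s) (times v) <= size v)%N by rewrite -sv count_size.
have [j1|j1] := eqVneq j.+1 (size v).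
  by apply/esym; rewrite /= eqn_leq jn j1 cs.
have j1v : (j.+1 < size v)%N by rewrite ltn_neqAle j1.
rewrite /= ltNge tauE// -leqNgt; apply/idP/idP; first by rewrite eqn_leq jn => ->.
by move/eqP => ->.
Qed.

(** Three regimes: initial transitions, rest, and a running batch. In the last, [e0] is a slowest
    request of the batch, the one that realizes the remaining time. *)
Lemma phases s : t <= s ->
  [\/ [/\ s < t + w, forall k, last_req k v s = None & rho M t w v s = w - (s - t)],
      (forall k, is_level (alphaB M t a w v s k)) /\ rho M t w v s = 0 |
      exists e0, [/\ [/\ e0 \in v, e0.1 <= s, s < e0.1 + batch_delay M v e0.1 &
        req_delay M e0.2 = batch_delay M v e0.1],
        rho M t w v s = batch_delay M v e0.1 - (s - e0.1),
        last_req e0.2.1 v s = Some e0 &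
        forall k, is_level (alphaB M t a w v s k) \/
          exists2 e, last_req k v s = Some e & e.1 = e0.1]].
Proof.
move=> ts; have w0 := psi_ge0 M a r.
have arr k : is_level (arrival (a k)) by case: (a k).
have [stw|tws] := ltP s (t + w).
  have none e : e \in v -> s < e.1 by move=> /hstart; exact: lt_le_trans.
  constructor 1; split => //.
    move=> k; case h : last_req => [e|//].
    by have [/none] := last_req_Some h; rewrite ltNge => /negP.
  rewrite /rho max_l; last lra.
  rewrite big_pred0 ?addr0// => -[j jv] /=.
  have sj : s < nth 0 (times v) j.
    have jt : (j < size (times v))%N by rewrite size_map.
    by have /mapP[e /none h ->] := mem_nth 0 jt.
  by rewrite leNgt sj.
have so : sorted <=%R (times v) by case: hok.
have sv : size (times v) = size v by rewrite size_map.
have rhoE := rho_current tws.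
have alphaBE k : alphaB M t a w v s k = if last_req k v s is Some (tau, (_, (l, l'))) then
    if s < tau + batch_delay M v tau then Sw l l' else Lvl l' else arrival (a k).
  by rewrite /alphaB ltNge tws.
case cE : (count (<= s) (times v)) => [|n].
  constructor 2; split; last by rewrite rhoE cE big_pred0.
  move=> k; rewrite alphaBE; case h : last_req => [[tau [k' [l l']]]|//].
  have [ev _ es] := last_req_Some h.
  have : (0 < count (<= s) (times v))%N.
    by rewrite -has_count; apply/hasP; exists tau => //; exact: (map_f fst ev).
  by rewrite cE.
have nv : (n < size v)%N by rewrite -sv -cE count_size.
set tau := nth 0 (times v) n.
have taus : tau <= s by apply: nth_count_le => //; rewrite cE.
have tau_max e : e \in v -> e.1 <= s -> e.1 <= tau.
  move=> ev es; have /(nthP 0)[i iv ei] : e.1 \in times v by exact: map_f.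
  rewrite -ei; apply: (sorted_leq_nth le_trans) => //; rewrite ?inE ?sv//.
  rewrite -ltnS -cE ltnNge; apply/negP => hi.
  have := @nth_count_gt _ _ s 0 (times v) i so; rewrite hi iv => /(_ isT).
  by rewrite ei ltNge es.
have rhoE' : rho M t w v s = Num.max (batch_delay M v tau - (s - tau)) 0.
  rewrite rhoE cE (big_pred1 (Ordinal nv))//.
have [e1 e1v e1tau] : exists2 e, e \in v & e.1 = tau.
  have nt : (n < size (times v))%N by rewrite sv.
  by have /mapP[e ev e1] := mem_nth 0 nt; exists e.
(* Generators whose last request belongs to an earlier batch have finished, by [batch_done]. *)
have lvl_before k e : last_req k v s = Some e -> e.1 < tau -> is_level (alphaB M t a w v s k).
  move=> h et; have [ev _ _] := last_req_Some h.
  rewrite alphaBE h; case: e et ev {h} => tau' [k' [l l']] /= et ev.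
  by rewrite ltNge (le_trans _ taus)// -e1tau; apply: (batch_done ev e1v); rewrite e1tau.
have [dn|run] := leP (tau + batch_delay M v tau) s.
  constructor 2; split; last by rewrite rhoE' max_r//; lra.
  move=> k; case h : (last_req k v s) => [e|]; last by rewrite alphaBE h.
  have [ev _ es] := last_req_Some h; have := tau_max e ev es.
  rewrite le_eqVlt => /orP[/eqP et|]; last exact: lvl_before h.
  rewrite alphaBE h; case: e et {h ev es} => tau' [k' [l l']] /= ->.
  by rewrite ltNge dn.
have bd0 : 0 < batch_delay M v tau.
  by rewrite -e1tau; apply: lt_le_trans (le_batch_delay e1v); exact: req_delay_gt0.
have [e0 [e0v e0tau e0d]] : exists e0, [/\ e0 \in v, e0.1 = tau & req_delay M e0.2 = batch_delay M v tau].
  apply: contrapT => nex.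
  have : batch_delay M v tau < batch_delay M v tau; last by rewrite ltxx.
  rewrite {1}/batch_delay big_seq_cond; apply: bigmax_lt => // e /andP[ev /eqP et].
  rewrite lt_neqAle -{2}et le_batch_delay// andbT; apply/eqP => h.
  by apply: nex; exists e.
have so0 : sorted <%R (times (req_of e0.2.1 v)) by case: hok.
constructor 3; exists e0; split.
- by rewrite e0tau; split.
- by rewrite rhoE' e0tau max_l//; lra.
- case h : last_req => [e|]; last first.
    by have := last_req_None h e0v erefl; rewrite e0tau ltNge taus.
  have [ev ek es] := last_req_Some h.
  case: (last_req_max so0 h e0v erefl _) => [|->//|]; first by rewrite e0tau.
  by rewrite ltNge e0tau tau_max.
- move=> k; case h : (last_req k v s) => [e|]; last by left; rewrite alphaBE h.
  have [ev _ es] := last_req_Some h; have := tau_max e ev es.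
  rewrite le_eqVlt => /orP[/eqP et|/(lvl_before _ _ h)]; last by left.
  by right; exists e => //; rewrite et e0tau.
Qed.

(** A generator faster than its batch has arrived although its upper-bound mode is still the switch;
    capping the elapsed time at its own delay puts the ramp at its end, which is the level
    reached. *)
Definition batch_progress s : 'cV[R]_nG :=
  \col_k if alphaB M t a w v s k is Sw l l' then
    Num.min (if last_req k v s is Some (tau, _) then s - tau else s - t + r k 0)
      (delay M k (l, l'))
  else 0.

Lemma alphaB_is_mode s : is_mode M (alphaB M t a w v s).
Proof.
have [_ [_ [_ [hl _]]]] := hmodes.
move=> k; rewrite /alphaB; case h : last_req => [[tau [k' [l l']]]|].
  have [/request_allowed /= + kk _] := last_req_Some h; rewrite kk => hk.
  by case: ifP => // _; have [] := hl _ _ _ hk.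
case: ifP => _; first exact: ha.
by have := ha k; case: (a k) => //= l l' /hl[].
Qed.

Lemma batch_progress_closed s : t <= s ->
  closed_progress M (alphaB M t a w v s) (batch_progress s).
Proof.
move=> ts k; have := @alphaB_is_mode s k; rewrite mxE; case: alphaB => // l l' hk.
have [_ [_ [_ [_ h]]]] := hmodes; have [D0 _ _ _ _] := h _ _ _ hk.
rewrite ge_min lexx orbT andbT le_min (ltW D0) andbT.
case hL : last_req => [[tau [k' [l1 l2]]]|].
  by have [_ _ es] := last_req_Some hL; rewrite subr_ge0.
rewrite addr_ge0 ?subr_ge0//; have := hr k.
by case: (a k) => [_ ->//|l1 l2 /andP[]].
Qed.

Lemma zeta_batch_progress s : t <= s ->
  zeta M (alphaB M t a w v s) (batch_progress s) =
  zeta M (alpha M t a r v s) (xi M t a r v s).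
Proof.
move=> ts; apply/matrixP => k j; rewrite ord1 !mxE /alphaB /alpha.
have [_ [_ [_ [_ h]]]] := hmodes.
have ts' : (s < t) = false by rewrite ltNge ts.
case hL : last_req => [[tau [k' [l l']]]|].
  have [ev kk es] := last_req_Some hL; rewrite /= in kk; subst k'.
  have hd := le_batch_delay ev; rewrite /req_delay/= in hd.
  have [_ _ _ _ [_ hD _]] := h _ _ _ (request_allowed ev).
  have [sd|ds] := ltP s (tau + delay M k (l, l')).
    have -> : s < tau + batch_delay M v tau by rewrite (lt_le_trans sd)// lerD2l.
    by rewrite min_l//; lra.
  case: ifP => // _; rewrite min_r//; lra.
rewrite ts'; have hp := psi_start k; move: hp; rewrite /mode_delay.
have := ha k; case: (a k) => [l _ _|l l' hk hp]; first by rewrite if_same.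
have [_ _ _ _ [_ hD _]] := h _ _ _ hk.
have [sd|ds] := ltP (s - t + r k 0) (delay M k (l, l')).
  have -> : s < t + w by lra.
  by rewrite min_l// ltW.
by case: ifP => //= _; rewrite min_r.
Qed.

(** Initially the remaining time is realized by the transition that realizes [psi M a r], within a
    batch by its slowest request; every other generator has no more time left. *)
Lemma psi_batch_progress s : t <= s ->
  psi M (alphaB M t a w v s) (batch_progress s) = rho M t w v s /\
  progress_time (alphaB M t a w v s) (rho M t w v s).
Proof.
move=> ts.
have bpE k : batch_progress s k 0 = if alphaB M t a w v s k is Sw l l' then
    Num.min (if last_req k v s is Some (tau, _) then s - tau else s - t + r k 0)
      (delay M k (l, l')) else 0 by rewrite mxE.
have [[stw nn rE]|[lv rE]|[e0 [[e0v e0s se0 e0d] rE e0L hk]]] := phases ts.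
- have aE k : alphaB M t a w v s k = a k by rewrite /alphaB nn stw.
  split; last by left; rewrite rE; lra.
  apply/eqP; rewrite eq_le rE; apply/andP; split.
    apply: psi_le => [|k]; first lra.
    rewrite bpE /mode_delay aE nn; have := psi_start k; rewrite /mode_delay.
    case: (a k) => [l _|l l' hp]; first by lra.
    by case: (leP (s - t + r k 0) (delay M k (l, l'))); lra.
  have w0 : 0 < w by lra.
  have [k hk] := psi_attained w0.
  apply: le_trans (le_psi M (alphaB M t a w v s) (batch_progress s) k).
  rewrite bpE /mode_delay aE nn; move: hk (hr k); rewrite /mode_delay.
  case: (a k) => [l hk r0|l l' hk _]; first by lra.
  by rewrite min_l; lra.
- split; last by right.
  apply/eqP; rewrite eq_le rE psi_ge0 andbT; apply: psi_le => // k.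
  by rewrite bpE /mode_delay; have := lv k; case: alphaB => //; rewrite subrr.
- have r0 : 0 < rho M t w v s by rewrite rE; lra.
  split; last by left.
  have LE k e : last_req k v s = Some e -> e.1 = e0.1 ->
      alphaB M t a w v s k = Sw e.2.2.1 e.2.2.2.
    rewrite /alphaB => ->; case: e => tau [k' [l l']] /= ->.
    by rewrite se0.
  apply/eqP; rewrite eq_le; apply/andP; split.
    apply: psi_le => [|k]; first exact: ltW.
    rewrite bpE /mode_delay; have [|[e eL ee]] := hk k.
      by case: alphaB => // l _; rewrite subrr ltW.
    have [ev ek _] := last_req_Some eL.
    rewrite (LE k e eL ee) eL; have := le_batch_delay ev.
    rewrite ee /req_delay ek -surjective_pairing rE; case: e {eL ek ev} ee => tau [k' lm] /= -> hd.
    by case: (leP (s - e0.1) (delay M k lm)); lra.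
  apply: le_trans (le_psi M (alphaB M t a w v s) (batch_progress s) e0.2.1).
  rewrite bpE /mode_delay (LE _ _ e0L erefl) e0L -surjective_pairing rE -e0d.
  by move: e0d se0; rewrite /req_delay; case: e0 {e0v e0s rE e0L hk LE} => tau [k' lm] /= -> se0; rewrite min_l; lra.
Qed.

Lemma zeta_in_DGaw s : t <= s ->
  DGaw M (alphaB M t a w v s) (rho M t w v s) (zeta M (alpha M t a r v s) (xi M t a r v s)).
Proof.
move=> ts; have [pE pt] := psi_batch_progress ts.
rewrite -zeta_batch_progress//; apply: (zeta_DGaw hM) => //.
- exact: alphaB_is_mode.
- exact: batch_progress_closed.
Qed.

End controls_deterministic.

(** * Measurability of the cost of the upper-bound problem *)

Section section_integral.
Context {R : realType} d (X : measurableType d).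

Lemma ge0_measurable_section_integral (D : set R) (h : X * R -> \bar R) :
  measurable D -> measurable_fun (setT `*` D) h ->
  (forall z, (setT `*` D) z -> 0 <= h z)%E ->
  measurable_fun setT (fun x => \int[lebesgue_measure]_(u in D) h (x, u))%E.
Proof.
move=> mD mh h0.
pose h' := (h \_ (setT `*` D))%E.
have mh' : measurable_fun setT h'.
  by apply/(measurable_restrictT _ _).1 => //; exact: measurableX.
have h'0 z : (0 <= h' z)%E by rewrite /h' /patch; case: ifPn => //; rewrite inE => /h0.
apply: (@eq_measurable_fun _ _ _ _ setT (fun x => \int[lebesgue_measure]_u h' (x, u))%E).
  move=> x _; rewrite [RHS]integral_mkcond; apply: eq_integral => u _; rewrite /h' /patch /=.
  by rewrite in_setX in_setT.
exact: (@measurable_fun_fubini_tonelli_F _ _ X (measurableTypeR R) R lebesgue_measure h' mh' h'0).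
Qed.

Lemma measurable_section_integral (D : set R) (h : X * R -> \bar R) :
  measurable D -> measurable_fun (setT `*` D) h ->
  measurable_fun setT (fun x => \int[lebesgue_measure]_(u in D) h (x, u))%E.
Proof.
move=> mD mh; under eq_fun do rewrite integralE.
apply: emeasurable_funB.
- apply: (@eq_measurable_fun _ _ _ _ setT (fun x => \int[lebesgue_measure]_(u in D) h^\+ (x, u))%E).
    by move=> x _; apply: eq_integral => u _; rewrite !funeposE.
  by apply: ge0_measurable_section_integral => //; exact: measurable_funepos.
- apply: (@eq_measurable_fun _ _ _ _ setT (fun x => \int[lebesgue_measure]_(u in D) h^\- (x, u))%E).
    by move=> x _; apply: eq_integral => u _; rewrite !funenegE.
  by apply: ge0_measurable_section_integral => //; exact: measurable_funeneg.
Qed.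

End section_integral.

Section countable_pieces.
Context {R : realType} d (X : measurableType d) d' (Y : measurableType d').

Lemma measurable_fun_pieces (I : countType) (D : set X) (E : I -> set X) (f : X -> Y) :
  (forall i, measurable (E i)) -> D `<=` \bigcup_i E i ->
  measurable D -> (forall i, measurable_fun (E i `&` D) f) -> measurable_fun D f.
Proof.
move=> mE DE mD mf.
pose F n := if (unpickle n : option I) is Some i then E i `&` D else set0.
have mF n : measurable (F n).
  by rewrite /F; case: unpickle => // i; exact: measurableI.
have DF : D = \bigcup_n F n.
  apply/seteqP; split => x.
    by move=> Dx; have [i _ Ei] := DE x Dx; exists (pickle i) => //; rewrite /F pickleK.
  by move=> [n _]; rewrite /F; case: unpickle => // i [].
rewrite DF; apply/measurable_fun_bigcup => // n; rewrite /F; case: unpickle => [i|].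
  exact: mf.
exact: measurable_fun_set0.
Qed.

End countable_pieces.

Section control_measurability.
Context {R : realType} {nG nL nc : nat} (M : market R nG nL nc) (hM : market_ok M).
Notation PS := (path_space (T M)).
Variables (t w : R) (a : mode nG) (v : PS -> rcontrol R nG).
Hypotheses (tT : 0 <= t <= T M) (hv : controlsB M t a w v).
Implicit Types (p : PS) (s : R).

Let tau j p : R := nth 0 (times (v p)) j.

Let T0 : 0 <= T M. Proof. by case/andP: tT => t0; exact: le_trans. Qed.

Lemma filtration_measurable s A : s <= T M -> @FB R (T M) s A -> measurable (A : set PS).
Proof.
move=> sT; apply: smallest_sub; first exact: smallest_sigma_algebra.
move=> _ [i [u [B [/andP[u0 us] mB ->]]]]; apply: sub_sigma_algebra.
by exists i, u, B; rewrite u0 (le_trans us).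
Qed.

Let vT p e : e \in v p -> t <= e.1 <= T M.
Proof. by case: hv => _ /(_ p)[[_ h _ _] _ _]; exact: h. Qed.

Let requested j p : Prop := exists e, onth (v p) j = Some e.

Let mE j s : s \in `[0, T M] ->
  measurable ([set p | exists2 e, onth (v p) j = Some e & e.1 <= s] : set PS).
Proof.
move=> sT; case: hv => /(_ j s sT)[h _] _; apply: filtration_measurable h.
by move: sT; rewrite in_itv => /andP[].
Qed.

Let requestedP j p : requested j p <-> (j < size (v p))%N.
Proof.
rewrite /requested -onthTE; case: onth => [e|] /=; first by split => // _; exists e.
by split => // -[].
Qed.

Let onth_in j p e : onth (v p) j = Some e -> e \in v p.
Proof. by move=> h; apply/onthP; exists j. Qed.

Let m_size n : measurable ([set p | size (v p) = n] : set PS).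
Proof.
have mR j : measurable ([set p | (j <= size (v p))%N] : set PS).
  case: j => [|j].
    by rewrite [X in measurable X](_ : _ = setT)//; apply/seteqP; split.
  have := @mE j (T M); rewrite in_itv/= lexx T0 => /(_ isT).
  congr measurable; apply/seteqP; split => p /=.
    by move=> [e h _]; apply/requestedP; exists e.
  by move=> /requestedP[e h]; exists e => //; have /andP[] := vT (onth_in h).
rewrite [X in measurable X](_ : _ = [set p | (n <= size (v p))%N] `\`
    [set p | (n < size (v p))%N]).
  by apply: measurableD => //; case: n.
apply/seteqP; split => p /=.
  by move=> <-; rewrite leqnn ltnn.
by move=> [h1 /negP h2]; apply/eqP; rewrite eqn_leq leqNgt h2.
Qed.

Let m_request j b : measurable ([set p | exists2 e, onth (v p) j = Some e & e.2 = b] : set PS).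
Proof.
have TT : T M \in `[0, T M] by rewrite in_itv/= lexx T0.
case: hv => /(_ j _ TT)[_ /(_ b) h] _; have := filtration_measurable (lexx _) h.
congr measurable; apply/seteqP; split => p /=; first by move=> [e h1 [_ h2]]; exists e.
by move=> [e h1 h2]; exists e => //; split => //; have /andP[] := vT (onth_in h1).
Qed.

Definition reqs (u : rcontrol R nG) : seq (request nG) := [seq e.2 | e <- u].

(** Lists of requests are countable, so this cuts path space into countably many measurable
    pieces. *)
Lemma measurable_reqs bs : measurable ([set p | reqs (v p) = bs] : set PS).
Proof.
rewrite [X in measurable X](_ : _ = [set p | size (v p) = size bs] `&`
  \bigcap_(j in [set: 'I_(size bs)])
     [set p | exists2 e, onth (v p) j = Some e & e.2 = tnth (in_tuple bs) j]).
  apply: measurableI; first exact: m_size.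
  apply: fin_bigcap_measurable => [|j _]; last exact: m_request.
  exact: finite_finset.
apply/seteqP; split => p /=.
  move=> E; have sE : size (v p) = size bs by rewrite -E size_map.
  split => // j _; have [e he] : requested j p by apply/requestedP; rewrite sE.
  exists e => //; apply/esym/tnth_onth.
  by have := congr1 (fun u => onth u j) E; rewrite /= onth_map he /= => /esym.
move=> [sE h]; apply: eq_from_onth_le => i; rewrite size_map sE maxnn => ib.
have [e he eb] := h (Ordinal ib) I.
by rewrite onth_map he /=; have /tnth_onth := esym eb => /esym.
Qed.

Lemma measurable_time j : measurable_fun setT (tau j).
Proof.
apply: (measurability _ (RGenOInfty.measurableE R)) => //.
move=> /= _ [_ [c ->] <-]; rewrite setTI.
rewrite [X in measurable X](_ : _ = ~` [set p | tau j p <= c]); last first.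
  by apply/seteqP; split => p /=; rewrite in_itv/= andbT ltNge => /negP.
apply: measurableC.
have mN : measurable ([set p | (size (v p) <= j)%N] : set PS).
  rewrite [X in measurable X](_ : _ = \bigcup_(n in [set n | (n <= j)%N]) [set p | size (v p) = n]).
    by apply: bigcup_measurable => n _; exact: m_size.
  by apply/seteqP; split => p /=; [move=> h; exists (size (v p))|move=> [n /= nj ->]].
(* A missing request has the default time 0 and the others come after [t]: no time is negative. *)
have [c0|c0] := ltP c 0.
  rewrite [X in measurable X](_ : _ = set0)//; apply/seteqP; split => // p /=.
  apply/negP; rewrite -ltNge (lt_le_trans c0)//.
  have [jv|vj] := ltnP j (size (v p)); last by rewrite /tau nth_default// size_map.
  have jt : (j < size (times (v p)))%N by rewrite size_map.
  have /mapP[e ev et] := mem_nth 0 jt; rewrite /tau et.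
  by have /andP[te _] := vT ev; case/andP: tT => t0 _; exact: le_trans te.
(* For [c >= 0] the default time 0 of a missing request meets the bound. The minimum with [T M] is
   there because [adapted] speaks of times in [0, T]. *)
rewrite [X in measurable X](_ : _ = [set p | (size (v p) <= j)%N] `|`
    [set p | exists2 e, onth (v p) j = Some e & e.1 <= Num.min c (T M)]).
  by apply: measurableU => //; apply: mE; rewrite in_itv/= le_min c0 T0 ge_min lexx orbT.
have tauE p e : onth (v p) j = Some e -> tau j p = e.1.
  by move=> h; rewrite /tau; apply: onth_nth; rewrite onth_map h.
apply/seteqP; split => p /=.
  move=> pc; have [jv|vj] := ltnP j (size (v p)); last by left.
  right; have [e he] := (requestedP j p).2 jv.
  exists e => //; rewrite le_min -(tauE _ _ he) pc /= (tauE _ _ he).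
  by have /andP[] := vT (onth_in he).
move=> [vj|[e he]]; first by rewrite /tau nth_default// size_map.
by rewrite le_min (tauE _ _ he) => /andP[].
Qed.

End control_measurability.

Lemma measurable_bigmax {R : realType} d (X : measurableType d) (D : set X) I (s : seq I) (f : I -> X -> R) :
  (forall i, measurable_fun D (f i)) ->
  measurable_fun D (fun x => \big[Num.max/0]_(i <- s) f i x).
Proof.
move=> mf; elim: s => [|i s IH].
  by under eq_fun do rewrite big_nil; exact: measurable_cst.
by under eq_fun do rewrite big_cons; exact: measurable_maxr.
Qed.

Section batch.
Context {R : realType} {nG nL nc : nat} (M : market R nG nL nc).
Implicit Types (u : rcontrol R nG) (bs : seq (request nG)).

(** For a fixed list [bs] of requests the batch delay becomes an expression in the request times
    alone, and these are measurable. *)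
Definition batch_delay_at bs j u : R :=
  \big[Num.max/0]_(i < size bs)
    if nth 0 (times u) i == nth 0 (times u) j then oapp (req_delay M) 0 (onth bs i) else 0.

Lemma batch_delayE u j : batch_delay M u (nth 0 (times u) j) = batch_delay_at (reqs u) j u.
Proof.
rewrite /batch_delay_at; move: (nth 0 (times u) j) => c.
case: u => [|e0 u']; first by rewrite /batch_delay big_nil big_ord0.
set u := e0 :: u'.
rewrite /batch_delay (big_nth e0) big_mkord bigmax_mkcond /= size_map.
apply: eq_bigr => i _; have iu : (i < size u)%N by exact: ltn_ord.
rewrite [RHS](_ : _ = if nth 0 (times u) i == c then oapp (req_delay M) 0 (onth (reqs u) i) else 0)//.
rewrite (nth_map e0)// onth_map.
rewrite onthE (nth_map e0)//=.
Qed.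

Definition rho_at (t w : R) bs u (s : R) : R :=
  Num.max (w - (s - t)) 0 + \sum_(j < size bs)
    if (nth 0 (times u) j <= s) && ((j.+1 == size bs) || (s < nth 0 (times u) j.+1))
    then Num.max (batch_delay_at bs j u - (s - nth 0 (times u) j)) 0 else 0.

Lemma rhoE t w u s : rho M t w u s = rho_at t w (reqs u) u s.
Proof.
rewrite /rho /rho_at size_map big_mkcond/=; congr (_ + _); apply: eq_bigr => j _.
by rewrite batch_delayE.
Qed.

(** Data with countably many possible values that determine the upper-bound mode at time [s]. *)
Definition snapshot (t w : R) u (s : R) : seq (request nG * (bool * bool)) * bool :=
  ([seq (e.2, (e.1 <= s, s < e.1 + batch_delay M u e.1)) | e <- u], s < t + w).

Definition mode_of (a : mode nG) (D : seq (request nG * (bool * bool)) * bool) : mode nG :=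
  fun k =>
  if ohead (rev [seq x <- D.1 | (x.1.1 == k) && x.2.1]) is Some ((_, (l, l')), (_, b)) then
    if b then Sw l l' else Lvl l'
  else if D.2 then a k else arrival (a k).

Lemma alphaB_snapshot t a w u s : alphaB M t a w u s = mode_of a (snapshot t w u s).
Proof.
apply/funext => k; rewrite /alphaB /mode_of /snapshot /last_req /req_of /= filter_map -map_rev.
have -> : [seq e <- [seq e <- u | e.2.1 == k] | e.1 <= s] = [seq e <- u | (e.2.1 == k) && (e.1 <= s)].
  by rewrite -filter_predI; apply: eq_filter => e /=; rewrite andbC.
by case: (rev _) => [|[c [k' [l l']]] f].
Qed.

End batch.

Section integrand_measurability.
Context {R : realType} {nG nL nc : nat} (M : market R nG nL nc) (hM : market_ok M).
Notation PS := (path_space (T M)).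
Variables (t : R) (a : mode nG) (r : 'cV[R]_nG) (v : PS -> rcontrol R nG).
Notation w := (psi M a r).
Hypotheses (tT : 0 <= t <= T M) (ha : is_mode M a) (hr : H M a r) (hv : controlsB M t a w v).
Implicit Types (z : PS * R) (bs : seq (request nG)).

Let mtau j : measurable_fun setT (fun z => nth 0 (times (v z.1)) j : R).
Proof. exact: (measurableT_comp (measurable_time tT hv j) measurable_fst). Qed.

Let mtime : measurable_fun setT (fun z => z.2 : R).
Proof. exact: measurable_snd. Qed.

Lemma measurable_batch_delay_at bs j :
  measurable_fun setT (fun z => batch_delay_at M bs j (v z.1)).
Proof.
apply: measurable_bigmax => i; apply: measurable_fun_ifT => //.
exact: measurable_fun_eqr.
Qed.

Lemma measurable_rho_at bs : measurable_fun setT (fun z => rho_at M t w bs (v z.1) z.2).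
Proof.
apply: measurable_funD.
  apply: measurable_maxr; last exact: measurable_cst.
  by apply: measurable_funB => //; apply: measurable_funB.
apply: measurable_sum => j; apply: measurable_fun_ifT => //.
  apply: measurable_and; first exact: measurable_fun_ler.
  by apply: measurable_or => //; exact: measurable_fun_ltr.
apply: measurable_maxr; last exact: measurable_cst.
apply: measurable_funB; first exact: measurable_batch_delay_at.
exact: measurable_funB.
Qed.

Let bool_set (f : PS * R -> bool) b : measurable_fun setT f -> measurable [set z | f z = b].
Proof. by move=> mf; rewrite -[X in measurable X]setTI; exact: (mf measurableT [set b] I). Qed.

Lemma measurable_snapshot D : measurable [set z | snapshot M t w (v z.1) z.2 = D].
Proof.
case: D => D b; pose bs := map fst D.
rewrite [X in measurable X](_ : _ = ((fst @^-1` [set p | reqs (v p) = bs]) `&`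
  \bigcap_(j in [set: 'I_(size D)])
    ([set z | (nth 0 (times (v z.1)) j <= z.2) = (tnth (in_tuple D) j).2.1] `&`
     [set z | (z.2 < nth 0 (times (v z.1)) j + batch_delay_at M bs j (v z.1)) = (tnth (in_tuple D) j).2.2])) `&`
   [set z | (z.2 < t + w) = b]).
  apply: measurableI; first apply: measurableI.
  - by rewrite -[X in measurable X]setTI; apply: measurable_fst => //; exact: (measurable_reqs tT hv).
  - apply: fin_bigcap_measurable => [|j _]; first exact: finite_finset.
    apply: measurableI; apply: bool_set; first exact: measurable_fun_ler.
    apply: measurable_fun_ltr => //; apply: measurable_funD => //.
    exact: measurable_batch_delay_at.
  - by apply: bool_set; apply: measurable_fun_ltr.
apply/seteqP; split => -[p s] /=.
  move=> [E ->]; have Er : reqs (v p) = bs by rewrite /bs -E -map_comp.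
  split=> //; split=> // j _ /=; rewrite -Er -batch_delayE.
  have jv : (j < size (v p))%N by rewrite -(size_map (fun e => (e.2, (e.1 <= s, s < e.1 + batch_delay M (v p) e.1)))) E.
  have [e he] : exists e, onth (v p) j = Some e.
    by move: jv; rewrite -onthTE; case: onth => // e _; exists e.
  have := congr1 (fun u => onth u j) E; rewrite /= onth_map he /= => /esym hj.
  rewrite ((tnth_onth _ (in_tuple D) j).2 hj) /=.
  by rewrite (_ : nth 0 (times (v p)) j = e.1)//; apply: onth_nth; rewrite onth_map he.
move=> [[Er h] hb]; rewrite /snapshot hb; congr pair; apply: eq_from_onth_le => i.
rewrite size_map; have sE : size (v p) = size D by rewrite -(size_map snd) -/(reqs _) Er size_map.
rewrite sE maxnn => iD; have := h (Ordinal iD) I; rewrite /= -Er -batch_delayE.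
have [e he] : exists e, onth (v p) i = Some e.
  by move: iD; rewrite -sE -onthTE; case: onth => // e _; exists e.
rewrite (_ : nth 0 (times (v p)) i = e.1); last by apply: onth_nth; rewrite onth_map he.
move=> [h1 h2]; rewrite onth_map he /= h1 h2.
set x := tnth _ _; have /tnth_onth hx : tnth (in_tuple D) (Ordinal iD) = x by [].
have := congr1 (fun u => onth u i) Er; rewrite /= !onth_map he /= => -[].
rewrite hx /= => -[->]; congr Some; by case: x {hx} => ? [].
Qed.

(** Joint measurability comes from continuity of the paths, which holds on [0, T], hence the
    clamp. *)
Lemma measurable_path : measurable_fun setT (fun z => z.1 (clamp 0 (T M) z.2) : R).
Proof.
have T0 : 0 <= T M by case/andP: tT => t0; exact: le_trans.
have h1 u : measurable_fun setT (fun p : PS => p (clamp 0 (T M) u) : R).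
  move=> _ B mB; rewrite setTI; apply: sub_sigma_algebra.
  by exists tt, (clamp 0 (T M) u), B; rewrite clampP.
have h2 (p : PS) : continuous (fun u => p (clamp 0 (T M) u)).
  have h (u : R) : [set` `[0, T M]] (clamp 0 (T M) u) by rewrite /= in_itv/=; exact: clampP.
  exact: (@continuous_comp_within R p (clamp 0 (T M)) _ (@path_cont R (T M) p) (@continuous_clamp R 0 (T M)) h).
have := @measurable_caratheodory R _ PS (fun u p => p (clamp 0 (T M) u)) h1 h2.
by move=> /measurableT_comp /(_ (@measurable_swap _ _ PS (measurableTypeR R))).
Qed.

End integrand_measurability.

(* The integrands need not be measurable: integrals are suprema over simple functions. *)
Lemma integral_mono {R : realType} d (X : measurableType d) (mu : {measure set X -> \bar R})
    (D : set X) (f g : X -> \bar R) : (forall x, D x -> f x <= g x)%E ->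
  (\int[mu]_(x in D) f x <= \int[mu]_(x in D) g x)%E.
Proof.
have ge0_mono (f1 g1 : X -> \bar R) : (forall x, 0 <= f1 x)%E -> (forall x, f1 x <= g1 x)%E ->
    (\int[mu]_x f1 x <= \int[mu]_x g1 x)%E.
  move=> f0 fg; have g0 x : (0 <= g1 x)%E by exact: le_trans (f0 x) (fg x).
  rewrite !ge0_integralTE//; apply: le_ereal_sup => _ [h hf <-].
  by exists h => // x; exact: le_trans (hf x) (fg x).
move=> fg; rewrite (integral_mkcond D f) (integral_mkcond D g).
have fgD x : ((f \_ D) x <= (g \_ D) x)%E by rewrite /patch; case: ifPn => //; rewrite inE => /fg.
rewrite [leLHS]integralE [leRHS]integralE; apply: leeB; apply: ge0_mono => x.
- exact: funepos_ge0.
- by rewrite !funeposE ge_max !le_max fgD lexx orbT.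
- exact: funeneg_ge0.
- by rewrite !funenegE ge_max !le_max leeN2 fgD lexx orbT.
Qed.

Section value_measurability.
Context {R : realType} {nG nL nc : nat} (M : market R nG nL nc) (hM : market_ok M).
Notation PS := (path_space (T M)).
Variables (t : R) (a : mode nG) (r : 'cV[R]_nG) (v : PS -> rcontrol R nG).
Notation w := (psi M a r).
Hypotheses (tT : 0 <= t <= T M) (ha : is_mode M a) (hr : H M a r) (hv : controlsB M t a w v).
Implicit Types (z : PS * R) (bs : seq (request nG)).

Definition path_running_cost z : R :=
  f2B M z.2 (XB tt z.2 z.1) (alphaB M t a w (v z.1) z.2) (rho M t w (v z.1) z.2).

(** Where the snapshot is [D] the mode is fixed, and the cost is [f2B] composed with the measurable
    map [phi]; sublevel sets of [f2B] are traces of Borel sets by [f2B_usc]. *)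
Lemma measurable_path_running_cost :
  measurable_fun (setT `*` `[t, T M]) path_running_cost.
Proof.
have mT : measurable (`[t, T M] : set R) by exact: measurable_itv.
have mD : measurable ((setT : set PS) `*` `[t, T M]) by exact: measurableX.
apply: (@measurable_fun_pieces _ _ _ _ _ _ (fun D => [set z | snapshot M t w (v z.1) z.2 = D])) => //.
- by move=> D; exact: measurable_snapshot.
- by move=> z _; exists (snapshot M t w (v z.1) z.2).
move=> D; set E := [set z | _] `&` _.
have mE : measurable E by apply: measurableI => //; exact: measurable_snapshot.
have [[z0 [z0D z0T]]|E0] := pselect (exists z, E z); last first.
  by rewrite (_ : E = set0); [exact: measurable_fun_set0|apply/seteqP; split => // z Ez; case: E0; exists z].
have hA : is_mode M (mode_of a D).
  rewrite -[D]z0D -alphaB_snapshot; case: hv => _ /(_ z0.1)[h1 h2 h3].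
  exact: alphaB_is_mode.
pose phi z := ((z.2, z.1 (clamp 0 (T M) z.2)), rho_at M t w (map fst D.1) (v z.1) z.2).
have mphi : measurable_fun setT phi.
  apply: measurable_fun_pair; last exact: measurable_rho_at.
  apply: measurable_fun_pair; first exact: measurable_snd.
  exact: (measurable_path tT).
have costE z : E z -> path_running_cost z =
    f2B M (phi z).1.1 (phi z).1.2 (mode_of a D) (phi z).2.
  move=> [zD zT]; rewrite /path_running_cost /phi/= rhoE alphaB_snapshot zD.
  have zT' : 0 <= z.2 <= T M.
    by move: zT => [_ /=]; rewrite in_itv/= => /andP[h ->]; case/andP: tT => /le_trans ->.
  rewrite clamp_id// /XB; congr (f2B _ _ _ _ (rho_at _ _ _ _ _ _)).
  by rewrite -zD /= -map_comp.
(* [f2B_usc] covers only remaining times for which [DGaw] is nonempty; the production of the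
   original problem is an element of it. *)
have phiD z : E z -> (phi z).1.1 \in `[0, T M] /\ exists g, DGaw M (mode_of a D) (phi z).2 g.
  move=> [zD [_ zT]]; move: zT; rewrite /= in_itv/= => /andP[tz zT]; split.
    by rewrite /= in_itv/= zT andbT; case/andP: tT => /le_trans ->.
  case: hv => _ /(_ z.1)[h1 h2 h3]; have := zeta_in_DGaw hM ha hr h1 h2 h3 tz.
  rewrite alphaB_snapshot zD rhoE (_ : reqs (v z.1) = map fst D.1); last by rewrite -zD /= -map_comp.
  by exists (zeta M (alpha M t a r (v z.1) z.2) (xi M t a r (v z.1) z.2)).
apply: (measurability _ (RGenInftyO.measurableE R)) => //.
move=> /= _ [_ [c ->] <-].
have [|B mB hB] := @usc_sublevel_measurable R
  [set x | x.1.1 \in `[0, T M] /\ exists g, DGaw M (mode_of a D) x.2 g]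
  (fun x => f2B M x.1.1 x.1.2 (mode_of a D) x.2) c.
  move=> [[s0 y0] w0] /= [s0T ne] lt.
  by apply: filterS (f2B_usc hM hA s0T ne lt) => x hx [xT xne]; exact: hx.
rewrite [X in measurable X](_ : _ = E `&` phi @^-1` B).
  by apply: measurableI => //; rewrite -[X in measurable X]setTI; exact: mphi.
apply/seteqP; split => z /= [Ez]; rewrite in_itv/= (costE _ Ez) => /(hB _ (phiD _ Ez)) //.
Qed.

Definition path_value (p : PS) : \bar R :=
  (\int[lebesgue_measure]_(s in `[t, T M]) (path_running_cost (p, s))%:E
   + switching_costs M (v p))%E.

Let sc (bs : seq (request nG)) : R := \sum_(b <- bs) swcost M b.1 b.2.

Lemma switching_costs_reqs p : switching_costs M (v p) = (sc (reqs (v p)))%:E.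
Proof.
rewrite /switching_costs /sc big_map -sumEFin big_seq_cond [RHS]big_seq_cond; apply: eq_bigl => e.
have [ev|//] := boolP (e \in v p); case: hv => _ /(_ p)[[_ h _ _] _ _].
by have /andP[_ ->] := h e ev.
Qed.

Lemma switching_costs_ge0 p : (0 <= switching_costs M (v p))%E.
Proof.
rewrite switching_costs_reqs lee_fin /sc big_map big_seq; apply: sumr_ge0 => e ev.
case: hv => _ /(_ p)[h1 _ _]; have := request_allowed h1 ev.
have [_ [_ [_ [_ h]]]] : modes_ok M by case: hM.
by case: e {ev} => c [k [l l']] /= /h[].
Qed.

Lemma measurable_path_value : measurable_fun setT path_value.
Proof.
apply: emeasurable_funD.
  apply: (measurable_section_integral (h := fun z => (path_running_cost z)%:E)); first exact: measurable_itv.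
  by apply/measurable_EFinP; exact: measurable_path_running_cost.
apply: (@measurable_fun_pieces _ _ _ _ _ _ (fun bs => [set p | reqs (v p) = bs])) => //.
- by move=> bs; exact: (measurable_reqs tT hv).
- by move=> p _; exists (reqs (v p)).
move=> bs; apply: (@eq_measurable_fun _ _ _ _ _ (fun=> (sc bs)%:E)).
  by move=> p; rewrite inE => -[/= <- _]; rewrite switching_costs_reqs.
exact: measurable_cst.
Qed.

(** Provides the constant that makes the cost nonnegative, as Tonelli's theorem requires. *)
Lemma path_value_bounded_below : exists2 K, 0 <= K & forall p, ((- K)%:E <= path_value p)%E.
Proof.
have [C C0 hC] := CG_bounded hM.
exists (C * (T M - t)).
  by rewrite mulr_ge0// subr_ge0; case/andP: tT.
move=> p; rewrite -[X in (X <= _)%E]adde0; apply: leeD; last exact: switching_costs_ge0.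
apply: (@le_trans _ _ (\int[lebesgue_measure]_(s in `[t, T M]) (- C)%:E)%E).
  rewrite integral_cst//= lebesgue_measure_itv/= lte_fin.
  have [tT'|Tt] := ltP t (T M); first by rewrite -EFinB -EFinM mulNr.
  by rewrite mule0 lee_fin oppr_le0 mulr_ge0// subr_ge0; case/andP: tT.
apply: integral_mono => s; rewrite /= in_itv/= => /andP[ts sT]; rewrite lee_fin.
case: hv => _ /(_ p)[h1 _ _]; exact: (f2B_ge hM (alphaB_is_mode hM ha h1 s) C0 hC).
Qed.

End value_measurability.

(** * Transfer of the controls *)

Section section_selection.
Context {R : realType}.
Local Open Scope ereal_scope.

Let integral_constant d (X : measurableType d) (P : probability X R) (K : \bar R) :
  \int[P]_x K = K.
Proof. by rewrite (integral_cst P measurableT K) [X in _ * X](@probability_setT _ _ _ P) mule1. Qed.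

(** The integral of [g] may be infinite, but the negative part is at most [K], so its integral is
    finite and can be cancelled. *)
Lemma integral_shift d (X : measurableType d) (P : probability X R) (g : X -> \bar R) (K : R) :
  measurable_fun setT g -> (0 <= K)%R -> (forall x, (- K)%:E <= g x) ->
  \int[P]_x (g x + K%:E) = \int[P]_x g x + K%:E.
Proof.
move=> mg K0 gK.
have gK0 x : 0 <= g x + K%:E by rewrite -leeBlDr// sub0e -EFinN.
have mgK : measurable_fun setT (fun x => g x + K%:E) by apply: emeasurable_funD.
have nK x : g^\- x <= K%:E.
  by rewrite funenegE ge_max lee_fin K0 andbT leeNl -EFinN.
have In : \int[P]_x g^\- x \is a fin_num.
  rewrite ge0_fin_numE; last by apply: integral_ge0 => x _; exact: funeneg_ge0.
  apply: (@le_lt_trans _ _ (\int[P]_x K%:E)); first by apply: integral_mono => x _.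
  by rewrite integral_constant ltry.
have E : \int[P]_x (g x + K%:E) + \int[P]_x g^\- x = \int[P]_x g^\+ x + K%:E.
  rewrite -[K%:E in RHS](integral_constant P).
  have mn : measurable_fun setT g^\- by exact: measurable_funeneg.
  have mp : measurable_fun setT g^\+ by exact: measurable_funepos.
  rewrite -!ge0_integralD//.
  apply: eq_integral => x _.
  have -> : g x = g^\+ x - g^\- x by exact: (congr1 (fun f => f x) (funeposneg g)).
  have fn : g^\- x \is a fin_num by rewrite ge0_fin_numE ?funeneg_ge0// (le_lt_trans (nK x))// ltry.
  by rewrite addeAC subeK.
rewrite [in RHS]integralE addeAC -E addeK//.
Qed.

(** Otherwise [F] minus its integral would be positive everywhere and have integral 0. *)
Lemma exists_le_integral d (X : measurableType d) (Q : probability X R) (F : X -> \bar R) :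
  measurable_fun setT F -> (forall x, 0 <= F x) -> exists x, F x <= \int[Q]_x F x.
Proof.
move=> mF F0; apply: contrapT => nF.
have {}nF x : \int[Q]_x F x < F x by rewrite ltNge; apply/negP => h; apply: nF; exists x.
have IF0 : 0 <= \int[Q]_x F x by exact: integral_ge0.
have [x0] : exists x : X, True.
  apply: contrapT => nX; have := probability_setT Q; rewrite (_ : setT = set0) ?measure0; last first.
    by apply/seteqP; split => // x _; case: nX; exists x.
  by move=> /eqP; rewrite eqe eq_sym oner_eq0.
move=> _; have If : \int[Q]_x F x \is a fin_num.
  by rewrite ge0_fin_numE// (lt_le_trans (nF x0))// leey.
set c := \int[Q]_x F x in nF IF0 If.
have mFc : measurable_fun setT (fun x => F x - c) by apply: emeasurable_funB.
have Fc0 x : 0 <= F x - c by rewrite sube_ge0 ?If ?orbT//; apply: ltW.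
have I0 : \int[Q]_x (F x - c) = 0.
  have : \int[Q]_x (F x - c) + c = c.
    rewrite -[X in _ + X](integral_constant Q).
    rewrite -ge0_integralD//; apply: eq_integral => x _.
    by rewrite subeK.
  by move=> /(congr1 (fun y => y - c)); rewrite addeK// subee.
have /(ae_eq_integral_abs Q measurableT mFc) : \int[Q]_x `|F x - c| = 0.
  by rewrite -[RHS]I0; apply: eq_integral => x _; rewrite gee0_abs.
case=> N [mN N0 hN].
have : Q N = 1.
  rewrite (_ : N = setT) ?probability_setT//; apply/seteqP; split => // x _; apply: hN => /= /(_ I).
  by move=> h; have := nF x; rewrite -sube_gt0 h ltxx.
by rewrite N0 => /eqP; rewrite eqe eq_sym oner_eq0.
Qed.

(** By Tonelli's theorem and the invariance of the law, the average of the left-hand side over [x]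
    is the right-hand side, once [g] is shifted by [K]. *)
Lemma exists_section_integral_le d (X : measurableType d) (Q : probability X R)
    d' (Om : measurableType d') (P : probability Om R) (Phi : X * Om -> X)
    (g : X -> \bar R) (K : R) :
  measurable_fun setT Phi ->
  (forall A, measurable A -> (Q \x P) (Phi @^-1` A) = Q A) ->
  measurable_fun setT g -> (0 <= K)%R -> (forall x, (- K)%:E <= g x) ->
  exists x, \int[P]_w g (Phi (x, w)) <= \int[Q]_x g x.
Proof.
move=> mPhi law mg K0 gK.
pose G x := g x + K%:E.
have G0 x : 0 <= G x by rewrite -leeBlDr// sub0e -EFinN.
have mG : measurable_fun setT G by apply: emeasurable_funD.
have mGP : measurable_fun setT (G \o Phi) by exact: measurableT_comp.
have IG : \int[Q]_x G x = \int[Q]_x \int[P]_w G (Phi (x, w)).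
  rewrite -(@fubini_tonelli1 _ _ _ _ _ Q P (G \o Phi) mGP) => [|z]; last exact: G0.
  rewrite -(@ge0_integral_pushforward _ _ _ _ _ Phi mPhi (Q \x P) setT)//.
  by apply: eq_measure_integral => A mA _ /=; rewrite /pushforward -law.
have [x hx] := @exists_le_integral _ _ Q (fun x => \int[P]_w G (Phi (x, w)))
  (@measurable_fun_fubini_tonelli_F _ _ _ _ _ P (G \o Phi) mGP (fun z => G0 _))
  (fun x => integral_ge0 _ (fun w _ => G0 _)).
exists x; move: hx; rewrite -IG /G integral_shift//; last first.
  exact: (measurableT_comp mg (measurable_fun_pair2 x mPhi)).
by rewrite integral_shift// leeD2rE.
Qed.

End section_selection.

Lemma probability_setI_sure {R : realType} d (X : measurableType d) (P : probability X R)
    (A E : set X) : measurable A -> measurable E -> P E = 1%E -> P (A `&` E) = P A.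
Proof.
move=> mA mE PE; rewrite (measureDI P mA mE) [X in (X + _)%E](_ : _ = 0%E) ?add0e//.
apply/eqP; rewrite eq_le measure_ge0 andbT.
have -> : 0%E = P (~` E) by rewrite probability_setC// PE subee.
by apply: le_measure; rewrite ?inE; [exact: measurableD|exact: measurableC|move=> x []].
Qed.

(** * Splicing the past of a path with the radius of a solution *)

Section splice.
Context {R : realType} {nG nL nc : nat} (M : market R nG nL nc) (hM : market_ok M).
Context d (Om : measurableType d) (P : probability Om R) (W : R -> Om -> 'cV[R]_nL)
  (hW : brownian P W) (Z : R -> 'cV[R]_nL -> R -> Om -> 'cV[R]_nL).
Hypothesis hZ : forall t z, 0 <= t <= T M -> OU_solution M W t z (Z t z).
Notation PS := (path_space (T M)).
Variables (t : R) (z : 'cV[R]_nL).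
Hypothesis tT : 0 <= t <= T M.
Notation y := (enorm (invmx (sigma M) *m z)).
Implicit Types (p : PS) (w : Om) (s u : R).

Let t0 : 0 <= t. Proof. by case/andP: tT. Qed.
Let tleT : t <= T M. Proof. by case/andP: tT. Qed.
Let T0 : 0 <= T M. Proof. exact: le_trans tleT. Qed.
Let Su : sigma M \in unitmx. Proof. by case: hM => _ _ _ _ []. Qed.
Let i0 : 'I_nL. Proof. by case: hM => -[_ nL0] *; exact: Ordinal nL0. Qed.

Lemma ou_start z' w : Z t z' t w = z'.
Proof.
have [_ ->] := hZ z' tT w; last by rewrite in_itv/= lexx.
rewrite (_ : \col_i _ = 0); last first.
  by apply/matrixP => i j; rewrite !mxE set_itv1 Rintegral_set1.
by rewrite scaler0 subr0 subrr mulmx0 addr0.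
Qed.

Definition future_radius w s : R := enorm (invmx (sigma M) *m Z t z (clamp t (T M) s) w).

Lemma future_radiusE w s : t <= s <= T M -> future_radius w s = enorm (invmx (sigma M) *m Z t z s w).
Proof. by move=> sT; rewrite /future_radius clamp_id. Qed.

Lemma future_radius_past w s : s <= t -> future_radius w s = y.
Proof.
move=> st; have -> : future_radius w s = future_radius w t.
  by rewrite /future_radius /clamp !min_r ?(le_trans st)// !max_l.
by rewrite future_radiusE ?lexx// ou_start.
Qed.

Lemma continuous_future_radius w : continuous (future_radius w).
Proof.
have [cZ _] := hZ z tT w.
have cZc i : continuous (fun s => Z t z (clamp t (T M) s) w i 0).
  have h (u : R) : [set` `[t, T M]] (clamp t (T M) u) by rewrite /= in_itv/=; exact: clampP.
  exact: (@continuous_comp_within R (fun s => Z t z s w i 0) (clamp t (T M)) _ (cZ i) (@continuous_clamp R t (T M)) h).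
move=> s; apply: (@cvg_enorm R _ (nbhs s) (nbhs_filter s)) => i.
have h (i' : 'I_nL) (j : 'I_1) : Z t z (clamp t (T M) u) w i' j @[u --> s] --> Z t z (clamp t (T M) s) w i' j.
  by rewrite ord1; exact: cZc.
have hm := @cvg_mulmxl R _ (nbhs s) (nbhs_filter s) _ _ _ (invmx (sigma M)) _ _ h.
have hc (v0 : 'cV[R]_nL) : v i 0 @[v --> v0] --> v0 i 0 by exact: coord_continuous.
exact: (cvg_comp _ (fun v : 'cV[R]_nL => v i 0) hm (hc _)).
Qed.

(** Defined for every [p], also when [p t] is not [y]: the shift makes the path continuous at [t]
    and the absolute value keeps it nonnegative. Up to [t] the last term vanishes, and the past is
    that of [p] when [p t = y]. *)
Definition splice_fun p w s : R :=
  `|p (clamp 0 t s) - p t + y| + (future_radius w s - y).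

Lemma continuous_splice_fun p w : continuous (splice_fun p w).
Proof.
have h (u : R) : [set` `[0, T M]] (clamp 0 t u).
  by rewrite /= in_itv/=; have /andP[-> /le_trans ->] := clampP u t0.
have cp : continuous (fun s => p (clamp 0 t s)).
  exact: (@continuous_comp_within R p (clamp 0 t) _ (@path_cont R (T M) p) (@continuous_clamp R 0 t) h).
move=> s; apply: cvgD; last by apply: cvgB; [exact: continuous_future_radius|exact: cvg_cst].
apply: cvg_norm; apply: cvgD; last exact: cvg_cst.
by apply: cvgB; [exact: cp|exact: cvg_cst].
Qed.

Lemma splice_future p w s : t <= s <= T M ->
  splice_fun p w s = enorm (invmx (sigma M) *m Z t z s w).
Proof.
move=> /andP[ts sT]; rewrite /splice_fun future_radiusE ?ts//.
have -> : clamp 0 t s = t by rewrite /clamp min_l// max_r.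
by rewrite subrr add0r ger0_norm ?enorm_ge0// addrC subrK.
Qed.

Lemma splice_past p w s : 0 <= s <= t ->
  splice_fun p w s = `|p s - p t + y|.
Proof.
move=> /andP[s0 st]; rewrite /splice_fun future_radius_past// clamp_id ?s0// subrr addr0//.
Qed.

Lemma splice_ge0 p w : {in `[0, T M], forall s, 0 <= splice_fun p w s}.
Proof.
move=> s; rewrite in_itv/= => /andP[s0 sT]; have [ts|st] := leP t s.
  by rewrite splice_future ?ts// enorm_ge0.
by rewrite splice_past ?s0 ?(ltW st)// normr_ge0.
Qed.

(* The past of [p], shifted so as to reach the radius [y] at time [t], followed
   by the radius of the solution started from [z]. *)
Definition splice (pw : PS * Om) : PS :=
  RadialPath (continuous_subspaceT (@continuous_splice_fun pw.1 pw.2)) (@splice_ge0 pw.1 pw.2).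

Let measurable_eval u : 0 <= u <= T M -> measurable_fun setT (fun p : PS => p u : R).
Proof.
move=> uT _ B mB; rewrite setTI; apply: sub_sigma_algebra.
by exists tt, u, B.
Qed.

Lemma measurable_radius_event n (s : nat -> R) (B : nat -> set R) z' :
  (forall j, t <= s j <= T M) -> (forall j, measurable (B j)) ->
  measurable [set w | forall j, (j < n)%N -> B j (enorm (invmx (sigma M) *m Z t z' (s j) w))].
Proof.
move=> sT mB; have := measurable_radius_cylinder (gamma M) t0 tleT (invmx (sigma M) *m z') n sT mB.
move=> /(brownian_path_law i0 hW hW T0)[+ _ _]; congr measurable.
by apply/seteqP; split => w /= h j jn; have := h j jn; rewrite (ou_radius Su hZ hW).
Qed.

Let measurable_future_radius u : measurable_fun setT (fun w => future_radius w u).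
Proof.
move=> _ B mB; rewrite setTI.
have := @measurable_radius_event 1 (fun=> clamp t (T M) u) (fun=> B) z (fun=> clampP u tleT) (fun=> mB).
congr measurable; apply/seteqP; split => w /=; first by move=> /(_ 0%N); apply.
by move=> h [|].
Qed.

Lemma measurable_splice : measurable_fun setT splice.
Proof.
apply: (@measurability _ _ _ PS setT splice (past_events (@XB R (T M)) (T M))) => //.
move=> _ [_ [i [u [B [uT mB ->]]]] <-]; rewrite setTI.
have ct : 0 <= clamp 0 t u <= T M.
  by have /andP[-> /le_trans ->] := clampP u t0.
have m1 : measurable_fun setT (fun pw : PS * Om => splice_fun pw.1 pw.2 u).
  apply: measurable_funD.
    apply: (@measurableT_comp _ _ _ _ _ _ (@Num.norm R R)); first exact: normr_measurable.
    apply: measurable_funD; last exact: measurable_cst.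
    by apply: measurable_funB; apply: (measurableT_comp (measurable_eval _) measurable_fst).
  apply: measurable_funB; last exact: measurable_cst.
  exact: (measurableT_comp (measurable_future_radius u) measurable_snd).
by have := m1 measurableT B mB; rewrite setTI.
Qed.

Section law.
Variable Q : probability PS R.
Hypothesis hQ : conditional_law M P Z t y Q.

(** [conditional_law] describes the future through some starting point of radius [y], which may
    differ from [z]. *)
Lemma radial_law_ou z' n (s : nat -> R) (B : nat -> set R) :
  enorm (invmx (sigma M) *m z') = y ->
  (forall j, t <= s j <= T M) -> (forall j, measurable (B j)) ->
  P [set w | forall j, (j < n)%N -> B j (enorm (invmx (sigma M) *m Z t z' (s j) w))] =
  P [set w | forall j, (j < n)%N -> B j (enorm (invmx (sigma M) *m Z t z (s j) w))].
Proof.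
move=> ez sT mB.
have E z1 : [set w | forall j, (j < n)%N -> B j (enorm (invmx (sigma M) *m Z t z1 (s j) w))] =
    brownian_cpath hW @^-1` radius_cylinder (gamma M) t (invmx (sigma M) *m z1) n s B.
  by apply/seteqP; split => w /= h j jn; have := h j jn; rewrite (ou_radius Su hZ hW).
by rewrite !E; exact: (radial_law (gamma M) t0 tleT hW i0 ez).
Qed.

Lemma start_as : Q [set p | p t = y] = 1%E.
Proof.
have [z' ez hz] := hQ.
(* No constraint on the past and a single one on the future, at time [t] itself. *)
have := hz 0%N 1%N (fun=> t) (fun=> t) (fun=> setT) (fun=> [set y]).
cbv zeta; rewrite (_ : [set p : PS | _] `&` _ = [set p : PS | p t = y]); last first.
  apply/seteqP; split => p /=; first by move=> [_ /(_ 0%N)]; apply.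
  by move=> h; split => // -[|].
rewrite (_ : [set p : PS | forall j, (j < 0)%N -> [set: R] (XB tt t p)] = setT); last by apply/seteqP; split.
rewrite (_ : [set w : Om | _] = setT); last first.
  by apply/seteqP; split => // w _ j _; rewrite /= ou_start.
rewrite [in X in _ -> X]/= => -> //.
- by rewrite !probability_setT mule1.
- by move=> _; rewrite lexx t0.
- by move=> _; rewrite lexx tleT.
Qed.

Lemma splice_law A : measurable A -> (Q \x P)%E (splice @^-1` A) = Q A.
Proof.
move=> mA; have mS (B : set PS) : past_events (@XB R (T M)) (T M) B -> measurable (splice @^-1` B).
  move=> hB; rewrite -[X in measurable X]setTI; apply: measurable_splice => //.
  exact: sub_sigma_algebra.
have mI (B : set PS) : past_events (@XB R (T M)) (T M) B -> measurable (id @^-1` B : set PS).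
  by move=> hB; exact: sub_sigma_algebra.
have [//|_ _ //] := cylinder_law_unique tt T0 (P1 := (Q \x P)%E) (P2 := Q) mS mI _ mA.
move=> n i u B uT mB.
(* Constraints at times up to [t] bear on the past, the others on the future; cutting the times at
   [t] keeps the trivial constraints within the ranges that [conditional_law] imposes. *)
pose A' j := if u j <= t then B j else setT.
pose B' j := if u j <= t then setT else B j.
pose u' j := Num.min (u j) t; pose s' j := Num.max (u j) t.
have mA' j : measurable (A' j : set R) by rewrite /A'; case: ifP.
have mB' j : measurable (B' j : set R) by rewrite /B'; case: ifP.
have u't j : 0 <= u' j <= t by rewrite /u' le_min t0 ge_min lexx orbT !andbT; have /andP[] := uT j.
have s't j : t <= s' j <= T M by rewrite /s' le_max lexx orbT ge_max tleT andbT; have /andP[] := uT j.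
pose past := [set p : PS | forall j, (j < n)%N -> A' j (p (u' j))].
pose fut z' := [set w | forall j, (j < n)%N -> B' j (enorm (invmx (sigma M) *m Z t z' (s' j) w))].
pose E0 := [set p : PS | p t = y].
have mev (v : R) (B0 : set R) : 0 <= v <= T M -> measurable B0 ->
    measurable ([set p : PS | B0 (p v)]).
  by move=> vT mB0; have := measurable_eval vT measurableT mB0; rewrite setTI.
have mpast : measurable past.
  rewrite [past](_ : _ = \bigcap_j if (j < n)%N then [set p : PS | A' j (p (u' j))] else setT).
    apply: bigcapT_measurable => j; case: ifP => // _; apply: mev => //.
    by have /andP[-> /le_trans ->] := u't j.
  apply/seteqP; split => p h; first by move=> j _; case: ifP => // /h.
  by move=> j jn; have := h j I; rewrite jn.
have mE0 : measurable E0 by apply: (mev t [set y]); rewrite ?t0.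
have mfut : measurable (fut z) by exact: measurable_radius_event.
have [z' ez hz] := hQ.
have -> : Q (id @^-1` cylinder (@XB R (T M)) n i u B) = (Q past * P (fut z))%E.
  rewrite -(radial_law_ou n ez s't mB') -(hz n n u' s' A' B' u't s't mA' mB'); congr (Q _).
  apply/seteqP; split => p /=.
    by move=> h; split => j jn; have := h j jn; rewrite /A' /B' /u' /s' /XB; case: (leP (u j) t).
  move=> [h1 h2] j jn; have := h1 j jn; have := h2 j jn; rewrite /A' /B' /u' /s' /XB.
  by case: (leP (u j) t).
(* Before [t] the spliced path is known to agree with [p] when [p t = y], an event of full
   probability. *)
have -> : (Q past = Q (past `&` E0))%E by rewrite (probability_setI_sure mpast mE0 start_as).
have pastE p w j : p t = y -> u j <= t -> splice_fun p w (u j) = p (u j).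
  move=> py ut; have /andP[u0 uTj] := uT j; rewrite splice_past ?u0// py subrK ger0_norm//.
  by apply: path_ge0; rewrite in_itv/= u0.
rewrite -product_measure1E//; last exact: measurableI.
have -> : ((past `&` E0) `*` fut z = splice @^-1` cylinder (@XB R (T M)) n i u B `&` (E0 `*` setT)).
  apply/seteqP; split => -[p w] /=.
    move=> [[hp py] hf]; split => // j jn; have := hp j jn; have := hf j jn.
    rewrite /A' /B' /u' /s' /XB /=; case: (leP (u j) t) => [ut _|ut].
      by rewrite /splice/= pastE.
    by rewrite splice_future ?(ltW ut)//; have /andP[] := uT j.
  move=> [h [py _]]; split; first split => // j jn.
    by have := h j jn; rewrite /A' /u' /XB /=; case: (leP (u j) t) => // ut; rewrite pastE.
  move=> j jn; have := h j jn; rewrite /B' /s' /XB /=; case: (leP (u j) t) => // ut.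
  by rewrite splice_future ?(ltW ut)//; have /andP[] := uT j.
rewrite (probability_setI_sure (P := (Q \x P)%E)) => //.
- rewrite -[X in measurable X]setTI; apply: measurable_splice => //.
  rewrite [cylinder _ _ _ _ _](_ : _ = \bigcap_j if (j < n)%N then [set p : PS | B j (p (u j))] else setT).
    by apply: bigcapT_measurable => j; case: ifP => // _; exact: mev.
  apply/seteqP; split => p h; first by move=> j _; case: ifP => // /h.
  by move=> j jn; have := h j I; rewrite jn.
- exact: measurableX.
- apply: etrans; first exact: (product_measure1E Q P mE0 measurableT).
  have QP : (Q E0 * P setT = 1)%E by rewrite probability_setT mule1; exact: start_as.
  exact: QP.
Qed.

End law.

End splice.

Section spliced_control.
Context {R : realType} {nG nL nc : nat} (M : market R nG nL nc) (hM : market_ok M).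
Context d (Om : measurableType d) (P : probability Om R) (W : R -> Om -> 'cV[R]_nL)
  (hW : brownian P W) (Z : R -> 'cV[R]_nL -> R -> Om -> 'cV[R]_nL).
Hypothesis hZ : forall t z, 0 <= t <= T M -> OU_solution M W t z (Z t z).
Notation PS := (path_space (T M)).
Variables (t : R) (x : 'cV[R]_nL).
Hypothesis tT : 0 <= t <= T M.
Notation z := (x - m M t).
Notation y := (enorm (invmx (sigma M) *m z)).
Variable p0 : PS.

Let Su : sigma M \in unitmx. Proof. by case: hM => _ _ _ _ []. Qed.
Let phi w : PS := splice hZ z tT (p0, w).

Let X (i : 'I_nL) (s : R) (w : Om) : R := Xfrom M Z 0 (x0 M) s w i 0.

(** With the past frozen, the path is deterministic up to [t], so events there are full or empty.
    Later, [ou_restart] writes the radius at time [u] through the solution started at time 0, taken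
    at [u] and at [t], both at most [s]. *)
Lemma splice_adapted s A : 0 <= s <= T M -> @FB R (T M) s A -> FX M Z s (phi @^-1` A).
Proof.
move=> /andP[s0 sT].
have mX u i : 0 <= u <= s ->
    @measurable_fun _ _ (g_sigma_algebraType (past_events X s)) R setT (fun w => Z 0 (x0 M - m M 0) u w i 0).
  move=> us.
  rewrite (_ : (fun w => _) = fun w => X i u w - m M u i 0); last first.
    by apply/funext => w; rewrite /X /Xfrom !mxE; ring.
  apply: measurable_funB; last exact: measurable_cst.
  move=> _ B mB; rewrite setTI; apply: sub_sigma_algebra.
  by exists i, u, B.
have mY u i : 0 <= u <= s ->
    @measurable_fun _ _ (g_sigma_algebraType (past_events X s)) R setT
      (fun w => (invmx (sigma M) *m Z 0 (x0 M - m M 0) u w) i 0).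
  move=> us; under eq_fun do rewrite mxE.
  by apply: measurable_sum => k; apply: measurable_funM; [exact: measurable_cst|exact: mX].
suff : @measurable_fun _ _ (g_sigma_algebraType (past_events X s))
    (g_sigma_algebraType (past_events (@XB R (T M)) s)) setT phi.
  by move=> h hA; have := h measurableT A hA; rewrite setTI.
apply: (@measurability _ _ (g_sigma_algebraType (past_events X s)) (g_sigma_algebraType (past_events (@XB R (T M)) s)) setT phi (past_events (@XB R (T M)) s)) => //.
move=> _ [_ [i [u [B [us mB ->]]]] <-]; rewrite setTI; have /andP[u0 us'] := us.
have [ut|tu] := leP u t.
  have [hB|hB] := pselect (B (`|p0 u - p0 t + y|)).
    rewrite (_ : _ @^-1` _ = setT); first exact: measurableT.
    by apply/seteqP; split => // w _; rewrite /= /XB /= (splice_past hZ)// ?u0.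
  rewrite (_ : _ @^-1` _ = set0); first exact: measurable0.
  by apply/seteqP; split => // w; rewrite /= /XB /= (splice_past hZ)// ?u0.
have ut : t <= u <= T M by rewrite (ltW tu) (le_trans us').
have t_s : 0 <= t <= s by case/andP: tT => -> _; rewrite (le_trans (ltW tu)).
have m1 : @measurable_fun _ _ (g_sigma_algebraType (past_events X s)) R setT
    (fun w => enorm (invmx (sigma M) *m Z 0 (x0 M - m M 0) u w +
       damped (gamma M) t (fun=> 1) u *:
         (invmx (sigma M) *m z - invmx (sigma M) *m Z 0 (x0 M - m M 0) t w))).
  apply: measurable_enorm => k.
  rewrite (_ : (fun w => _) = fun w => (invmx (sigma M) *m Z 0 (x0 M - m M 0) u w) k 0 +
      damped (gamma M) t (fun=> 1) u * ((invmx (sigma M) *m z) k 0 -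
        (invmx (sigma M) *m Z 0 (x0 M - m M 0) t w) k 0)); last first.
    by apply/funext => w; rewrite !mxE.
  apply: measurable_funD; first exact: mY.
  apply: measurable_funM; first exact: measurable_cst.
  by apply: measurable_funB; [exact: measurable_cst|exact: mY].
have := m1 measurableT B mB; rewrite setTI; congr measurable.
apply/seteqP; split => w /=; rewrite /XB/= splice_future// (ou_restart Su hZ hW z (x0 M - m M 0) w tT ut)//.
Qed.

Variables (a : mode nG) (r : 'cV[R]_nG) (v : PS -> rcontrol R nG).
Notation w0 := (psi M a r).
Hypotheses (ha : is_mode M a) (hr : H M a r) (hv : controlsB M t a w0 v).

Lemma spliced_control : controls M Z t a r (fun w => v (phi w)).
Proof.
have [ad ok] := hv; split => [j s sT|w]; last first.
  by have [h1 h2 h3] := ok (phi w); exact: (realization_ok_alpha h1).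
have sT' : 0 <= s <= T M by move: sT; rewrite in_itv.
have [h1 h2] := ad j s sT; split => [|b]; first exact: (splice_adapted sT' h1).
exact: (splice_adapted sT' (h2 b)).
Qed.

Lemma spliced_cost : (J M P Z t x a r (fun w => v (phi w)) <=
  \int[P]_w path_value t a r v (phi w))%E.
Proof.
apply: integral_mono => w _; apply: leeD => //.
apply: integral_mono => s; rewrite /= in_itv/= => sT.
have [_ /(_ (phi w))[h1 h2 h3]] := hv; have /andP[ts sT'] := sT.
have hD := zeta_in_DGaw hM ha hr h1 h2 h3 ts.
have hB := alphaB_is_mode hM ha h1 s.
rewrite lee_fin; apply: le_trans (running_cost_le_f1B hM _ s (DGaw_DG hM hB hD)) _.
rewrite /path_running_cost /XB /= splice_future// /Xfrom addrC addKr.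
exact: (f1B_le_f2B hM hB s _ hD).
Qed.

End spliced_control.

Unset Implicit Arguments.

Theorem theorem4p23 (R : realType) (nG nL nc : nat) (M : market R nG nL nc)
    (hM : market_ok M)
    (d : measure_display) (Om : measurableType d) (P : probability Om R)
    (W : R -> Om -> 'cV[R]_nL) (hW : brownian P W)
    (Z : R -> 'cV[R]_nL -> R -> Om -> 'cV[R]_nL)
    (hZ : forall t z, 0 <= t <= T M -> OU_solution M W t z (Z t z))
    (Q : R -> R -> probability (path_space (T M)) R)
    (hQ : forall t y, 0 <= t <= T M -> 0 <= y ->
            conditional_law M P Z t y (Q t y)) :
  forall (t : R) (x : 'cV[R]_nL) (a : mode nG),
    0 <= t <= T M -> is_mode M a ->
    forall r : 'cV[R]_nG, H M a r ->
      (V M P Z t x a r <=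
       VUB M Q t (enorm (invmx (sigma M) *m (x - m M t))) a (psi M a r))%E.
Proof.
move=> t x a tT ha r hr; apply: le_ereal_inf_tmp => _ [v hv <-].
have [K K0 hK] := path_value_bounded_below hM tT ha hv.
have hQt := hQ t _ tT (enorm_ge0 (invmx (sigma M) *m (x - m M t))).
have [p hp] := exists_section_integral_le (measurable_splice hM hW hZ (x - m M t) tT)
  (splice_law hM hW hZ tT hQt) (measurable_path_value hM tT ha hr hv) K0 hK.
apply: (le_trans _ hp).
apply: (le_trans _ (spliced_cost hM P hZ x tT p ha hr hv)).
by apply: ereal_inf_lbound; exists (fun w => v (splice hZ (x - m M t) tT (p, w))) => //;
  exact: (spliced_control hM hW hZ x tT p hv).
Qed.
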